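(* For each $n\ge 1$ let $(x_i,y_i)_{i=1}^{2n}$ be i.i.d. observations from the single-index model $y_i=f_i(\langle x_i,\tau\rangle)$ with $x_i\sim N(0,\Sigma)$ in $\mathbf{R}^p$, and let $\mu,\beta,z_i,\gamma,r_i$ and the debiased estimator $\tilde\beta_1$ be as defined in the context (known $\Sigma$). Let $$\nu^2=\frac{\mathbf{E}[r_n^2z_n^2]}{(\mathbf{E}[r_n^2])^2}.$$ Assume: 1. The sparsity $s=\|\beta\|_0$ satisfies $s=o\big(\tfrac{n}{\log^2(p)}\big)$. 2. There exist $0<c,C<\infty$ (not depending on $n$) such that $c\le\lambda_{\min}(\Sigma)\le\lambda_{\max}(\Sigma)\le C$. 3. $\mathbf{E}|y_n|^{2+\alpha}\le M<\infty$ for some $\alpha,M>0$ and all $n\ge1$. 4. The pilot estimator $\hat\beta$ satisfies $\|\hat\beta-\beta\|_2\lesssim\sqrt{\frac{s\log(p)}{n}}$ with probability $1-o(1)$. Then $$\sqrt n(\tilde\beta_1-\beta_1)=\nu\cdot\Xi_n,\qquad\text{where }\Xi_n\to_d N(0,1)\text{ as }n\to\infty.$$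
   Context: Asymptotic setting: $p$, $\Sigma$, $\tau$ and the law of the random link function may depend on $n$; ''constants'' do not. $t_n\lesssim s_n$ means $t_n\le c\,s_n$ for all $n\ge 1$ and some constant $c>0$ not depending on $n$ ($\gtrsim$ is the reverse). Model: $f_i:\mathbf{R}\to\mathbf{R}$ are i.i.d. realizations of an unknown random function $f$, independent of the $x_i$ (equivalently $y_i=f(\langle x_i,\tau\rangle,u_i)$ for a deterministic measurable $f$ and i.i.d. uniform $u_i$ independent of the $x_i$); the $x_i$ are i.i.d. $N(0,\Sigma)$ with $\Sigma$ positive definite; $\tau\in\mathbf{R}^p$ is normalized so that $\|\Sigma^{1/2}\tau\|_2=1$. Put $\mu:=\mathbf{E}[y_n\langle x_n,\tau\rangle]$, assumed nonzero, $\beta:=\mu\tau$, and $z_i:=y_i-\langle x_i,\beta\rangle$. Write $x_{i,1}$ for the first coordinate of $x_i$ and $x_{i,-1}\in\mathbf{R}^{p-1}$ for the remaining ones. Let $\gamma:=(\mathbf{E}[x_{n,-1}x_{n,-1}^T])^{-1}\mathbf{E}[x_{n,-1}x_{n,1}]$ and $r_i:=x_{i,1}-\langle\gamma,x_{i,-1}\rangle$. Pilot estimator (computed on the second half of the sample): $$\hat\beta\in\arg\min_{\beta'}\Big\{\tfrac1{2n}\sum_{i=n+1}^{2n}(y_i-\langle x_i,\beta'\rangle)^2+\lambda\|\beta'\|_1\Big\},\qquad \lambda\gtrsim\sigma_x\sigma_z\sqrt{\log(p)/n},$$ where $\sigma_x,\sigma_z$ are the subgaussian constants of $x_n$ and $z_n$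 (the subgaussian constant of a random vector $x$ is $\sup_{\|u\|_2=1}\|\langle u,x\rangle\|_{\psi_2}$). Debiased estimator (computed on the first half): $$\tilde\beta_1:=\hat\beta_1+\frac{\sum_{i=1}^n r_i(y_i-\langle x_i,\hat\beta\rangle)}{\sum_{i=1}^n r_ix_{i,1}}.$$
   Formalization: The formal theorem additionally assumes that ν is bounded below by a positive constant not depending on n; without this the claim fails, e.g. for noiseless y=x_2 (ν=0), or y=x_2+ε/n with λ of order n^{-1/2}, where Ξ_n is not tight. *)

(* Defs.v *)
From HB Require Import structures.
From mathcomp Require Import all_boot all_order all_algebra.
From mathcomp Require Import all_classical all_reals all_analysis.

Set Implicit Arguments.
Unset Strict Implicit.
Unset Printing Implicit Defensive.

Import Order.TTheory GRing.Theory Num.Theory.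
Import numFieldNormedType.Exports.

Local Open Scope classical_set_scope.
Local Open Scope ring_scope.

Definition dotp {R : realType} {p : nat} (u v : 'cV[R]_p) : R :=
  \sum_(k < p) u k 0 * v k 0.

Definition norm2 {R : realType} {p : nat} (u : 'cV[R]_p) : R :=
  Num.sqrt (dotp u u).

Definition norm1 {R : realType} {p : nat} (u : 'cV[R]_p) : R :=
  \sum_(k < p) `|u k 0|.

Definition norm0 {R : realType} {p : nat} (u : 'cV[R]_p) : nat :=
  #|[set k : 'I_p | u k 0 != 0]%SET|.

Definition posdefmx {R : realType} {p : nat} (A : 'M[R]_p) : Prop :=
  A^T = A /\ forall v : 'cV[R]_p, v != 0 -> 0 < dotp v (A *m v).

                                                                       
Definition is_sqrtmx {R : realType} {p : nat} (A S : 'M[R]_p) : Prop :=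
  posdefmx S /\ S *m S = A.

Definition lambda_min {R : realType} {p : nat} (A : 'M[R]_p) : R :=
  inf [set a | eigenvalue A a].

Definition lambda_max {R : realType} {p : nat} (A : 'M[R]_p) : R :=
  sup [set a | eigenvalue A a].

Definition lesssim {R : realType} (t s : nat -> \bar R) : Prop :=
  exists2 K : R, 0 < K & forall n : nat, (0 < n)%N -> (t n <= K%:E * s n)%E.

                                                                           
Definition sigma_of {T I : Type} {R : realType} (A : set I) (X : I -> T -> R) :
    set (set T) :=
  <<s [set X k @^-1` B | k in A & B in (measurable : set (set R))] >>.

                                                                              
                               
Definition indep_family {d} {T : measurableType d} {R : realType}
    (P : probability T R) (s : seq nat) (F : nat -> set (set T)) : Prop :=
  forall A : nat -> set T, (forall i, i \in s -> F i (A i)) ->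
    P (\bigcap_(i in [set` s]) A i) = (\prod_(i <- s) P (A i))%E.

Definition indep_pair {d} {T : measurableType d} {R : realType}
    (P : probability T R) (F G : set (set T)) : Prop :=
  forall A B : set T, F A -> G B -> P (A `&` B) = (P A * P B)%E.

Definition random_vector {d} {T : measurableType d} {R : realType} {p : nat}
    (X : T -> 'cV[R]_p) : Prop :=
  forall k : 'I_p, measurable_fun [set: T] (fun w => X w k 0).

                                                                 
                                                                          
                                                                               
                                                   
Definition gaussian_vector {d} {T : measurableType d} {R : realType} {p : nat}
    (P : probability T R) (Sigma : 'M[R]_p) (X : T -> 'cV[R]_p) : Prop :=
  random_vector X /\
  forall v : 'cV[R]_p, v != 0 -> forall B : set R, measurable B ->
    P ((fun w => dotp v (X w)) @^-1` B)
    = normal_prob 0 (Num.sqrt (dotp v (Sigma *m v))) B.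

Definition uniform01 {d} {T : measurableType d} {R : realType}
    (P : probability T R) (U : T -> R) : Prop :=
  measurable_fun [set: T] U /\
  forall B : set R, measurable B ->
    P (U @^-1` B) = uniform_prob (ltr01 : 0 < 1 :> R) B.

                                                                              
                                                                        
                                                      
Record single_index_model {d} {T : measurableType d} {R : realType} {p : nat}
    (P : probability T R) (n : nat) (Sigma : 'M[R]_p) (tau : 'cV[R]_p)
    (f : R * R -> R) (x : nat -> T -> 'cV[R]_p) (u : nat -> T -> R) : Prop := {
  sim_posdef : posdefmx Sigma;
  sim_tau : exists2 S : 'M[R]_p, is_sqrtmx Sigma S & norm2 (S *m tau) = 1;
  sim_f : measurable_fun [set: R * R] f;
  sim_x : forall i, (1 <= i <= 2 * n)%N -> gaussian_vector P Sigma (x i);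
  sim_u : forall i, (1 <= i <= 2 * n)%N -> uniform01 P (u i);
  sim_indep_x : indep_family P (iota 1 (2 * n))
    (fun i => sigma_of [set: 'I_p] (fun k w => x i w k 0));
  sim_indep_u : indep_family P (iota 1 (2 * n))
    (fun i => sigma_of [set: unit] (fun=> u i));
  sim_indep_xu : indep_pair P
    (sigma_of [set ik : nat * 'I_p | (1 <= ik.1 <= 2 * n)%N]
       (fun ik w => x ik.1 w ik.2 0))
    (sigma_of [set i : nat | (1 <= i <= 2 * n)%N] u)
}.

Definition response {T : Type} {R : realType} {p : nat} (tau : 'cV[R]_p)
    (f : R * R -> R) (x : nat -> T -> 'cV[R]_p) (u : nat -> T -> R)
    (i : nat) (w : T) : R :=
  f (dotp (x i w) tau, u i w).

Definition tail_cV {R : realType} {q : nat} (v : 'cV[R]_q.+1) : 'cV[R]_q :=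
  \col_(k < q) v (lift ord0 k) 0.

Definition node_coef {d} {T : measurableType d} {R : realType} {q : nat}
    (P : probability T R) (X : T -> 'cV[R]_q.+1) : 'cV[R]_q :=
  invmx (\matrix_(j < q, k < q)
           fine 'E_P[(fun w => tail_cV (X w) j 0 * tail_cV (X w) k 0)%R])
  *m \col_(j < q) fine 'E_P[(fun w => tail_cV (X w) j 0 * X w ord0 0)%R].

Definition node_resid {R : realType} {q : nat} (gamma : 'cV[R]_q)
    (v : 'cV[R]_q.+1) : R :=
  v ord0 0 - dotp gamma (tail_cV v).

Definition psi2_norm {d} {T : measurableType d} {R : realType}
    (P : probability T R) (X : T -> R) : \bar R :=
  ereal_inf [set t%:E | t in [set t : R | 0 < t /\
    ('E_P[(fun w => expR (X w ^+ 2 / t ^+ 2))%R] <= 2%:E)%E]].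

Definition subgaussian_const {d} {T : measurableType d} {R : realType} {p : nat}
    (P : probability T R) (X : T -> 'cV[R]_p) : \bar R :=
  ereal_sup [set psi2_norm P (fun w => dotp v (X w)) |
             v in [set v : 'cV[R]_p | norm2 v = 1]].

Definition lasso_obj {R : realType} {p : nat} (n : nat) (lam : R)
    (x : nat -> 'cV[R]_p) (y : nat -> R) (b : 'cV[R]_p) : R :=
  (2 * n%:R)^-1 * (\sum_(n.+1 <= i < (2 * n).+1) (y i - dotp (x i) b) ^+ 2)
  + lam * norm1 b.

                                                                           
                                                                               
                    
Definition pilot_estimator {T : Type} {R : realType} {p : nat} (n : nat)
    (lam : R) (x : nat -> T -> 'cV[R]_p) (y : nat -> T -> R)
    (bhat : T -> 'cV[R]_p) : Prop :=
  (forall w b, lasso_obj n lam (x^~ w) (y^~ w) (bhat w)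
               <= lasso_obj n lam (x^~ w) (y^~ w) b) /\
  forall (k : 'I_p) (B : set R), measurable B ->
    sigma_of [set ij : nat * option 'I_p | (n.+1 <= ij.1 <= 2 * n)%N]
      (fun ij w => if ij.2 is Some j then x ij.1 w j 0 else y ij.1 w)
      ((fun w => bhat w k 0) @^-1` B).

Definition debiased {R : realType} {q : nat} (n : nat) (r : nat -> R)
    (x : nat -> 'cV[R]_q.+1) (y : nat -> R) (bhat : 'cV[R]_q.+1) : R :=
  bhat ord0 0 +
  (\sum_(1 <= i < n.+1) r i * (y i - dotp (x i) bhat))
  / (\sum_(1 <= i < n.+1) r i * x i ord0 0).

                                                                            
                                                      
Definition cvg_in_distribution {R : realType} {d : nat -> measure_display}
    {T : forall n, measurableType (d n)} {P : forall n, probability (T n) R}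
    (X : forall n, {RV (P n) >-> R}) (m : set R -> \bar R) : Prop :=
  forall t : R, m [set t] = 0%E ->
    cdf (X n) t @[n --> \oo] --> m `]-oo, t]%classic.

(* Main.v *)
(* Write Delta = beta - bhat and let Delta' be Delta with its first coordinate
   set to 0.  Since y_i = <x_i, beta> + z_i, wherever sum_i r_i x_(i,1) is not 0,
     sqrt n (btilde_1 - beta_1) = (A_n + B_n) / H_n,
     A_n = n^(-1/2) sum_i r_i z_i,     B_n = n^(-1/2) sum_i r_i <x_i, Delta'>,
     H_n = n^(-1) sum_i r_i x_(i,1).
   H_n is close to E[r^2] by Chebyshev's inequality.  Delta' depends only on the
   second half of the sample and r is orthogonal to the coordinates of x other than
   the first, so the terms of B_n are uncorrelated and, on the event where the pilot
   estimator has its rate, E[B_n^2] <= const * s log p / n.  The summands of A_n are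
   centered: the part of r uncorrelated with <x, tau> may change sign without
   affecting the law of y.  As they have a bounded moment of order 2 + a, Lindeberg
   replacement of cos (t x + th) gives convergence of these means.  Smooth steps
   that are polynomials in sines and cosines then give convergence of the distribution
   functions, and Slutsky's argument is carried out at the level of these functions. *)

Require Import Defs.
From HB Require Import structures.
From mathcomp Require Import all_boot all_order all_algebra.
From mathcomp Require Import all_classical all_reals all_analysis.
From mathcomp Require Import measurable_realfun ring lra.

Set Implicit Arguments.
Unset Strict Implicit.
Unset Printing Implicit Defensive.

Import Order.TTheory GRing.Theory Num.Theory.
Import numFieldNormedType.Exports.

Local Open Scope classical_set_scope.
Local Open Scope ring_scope.

(** * Expectations of real-valued functions *)

(** The rows may live on different probability spaces, so every estimate is proved at a fixed sample
    size with constants uniform in n. The lower bound on nu is what makes standardization harmless: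
    nu is the standard deviation of r z divided by E[r^2], and E[r^2] >= c, so that standard
    deviation is at least nu0 * c. Dividing by it keeps the moment of order 2 + a bounded and B_n
    negligible. Conditioning on the second half is replaced by an expansion in coordinates: a
    quadratic form in Delta' is a finite sum of products of a first-half factor and a second-half
    factor, whose means factor. The pilot error is controlled only with high probability, so Delta'
    is multiplied by the indicator of the good event, which is itself determined by the second half.
    The sign change needs the joint law of two linear functionals of x and of u, whereas the model
    prescribes the law of one functional at a time. The Cramer-Wold device closes this gap, using
    the same trigonometric polynomials as the limit theorem. *)

Definition mean {d} {T : measurableType d} {R : realType} (P : probability T R)
  (f : T -> R) : R := fine 'E_P[f].

Definition pr {d} {T : measurableType d} {R : realType} (P : probability T R)
  (A : set T) : R := fine (P A).

Notation integ P f := (P.-integrable [set: _] (EFin \o f)).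

Section measurable_comparison.
Context {d} {T : measurableType d} {R : realType}.
Implicit Types f g : T -> R.

Lemma measurable_le f g : measurable_fun setT f -> measurable_fun setT g ->
  measurable [set w | f w <= g w].
Proof.
move=> mf mg; have := measurable_fun_ler mf mg.
by move=> /(_ measurableT [set true]); rewrite setTI; exact.
Qed.

Lemma measurable_lt f g : measurable_fun setT f -> measurable_fun setT g ->
  measurable [set w | f w < g w].
Proof.
move=> mf mg; have := measurable_fun_ltr mf mg.
by move=> /(_ measurableT [set true]); rewrite setTI; exact.
Qed.

End measurable_comparison.

Section mean_lemmas.
Context {d} {T : measurableType d} {R : realType} (P : probability T R).
Implicit Types (f g : T -> R) (A B : set T).

Lemma meanE f : mean P f = fine (\int[P]_w (f w)%:E).
Proof. by rewrite /mean unlock. Qed.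

Lemma mean_EFin f : integ P f -> (\int[P]_w (f w)%:E = (mean P f)%:E)%E.
Proof. by move=> h; rewrite meanE fineK// integrable_fin_num. Qed.

Lemma integ_meas f : integ P f -> measurable_fun setT f.
Proof. by move=> /measurable_int/measurable_EFinP. Qed.

Lemma integ_dom f g : measurable_fun setT f -> (forall w, `|f w| <= g w) ->
  integ P g -> integ P f.
Proof.
move=> mf fg ig; apply: le_integrable ig => //; first exact/measurable_EFinP.
by move=> w _; rewrite /= lee_fin (le_trans (fg w))// ler_norm.
Qed.

Lemma integ_cst c : integ P (fun=> c).
Proof. exact: finite_measure_integrable_cst. Qed.

Lemma integ_bnd c f : measurable_fun setT f -> (forall w, `|f w| <= c) ->
  integ P f.
Proof. by move=> mf fc; apply: integ_dom mf fc _; exact: integ_cst. Qed.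

Lemma integD f g : integ P f -> integ P g -> integ P (fun w => f w + g w).
Proof. by move=> hf hg; have := integrableD measurableT hf hg. Qed.

Lemma integB f g : integ P f -> integ P g -> integ P (fun w => f w - g w).
Proof. by move=> hf hg; have := integrableB measurableT hf hg. Qed.

Lemma integZ c f : integ P f -> integ P (fun w => c * f w).
Proof. by move=> hf; have := integrableZl measurableT c hf. Qed.

Lemma integ_norm f : integ P f -> integ P (fun w => `|f w|).
Proof. by move=> hf; exact: integrable_norm hf. Qed.

Lemma integ_sum (I : Type) (s : seq I) (p : pred I) (F : I -> T -> R) :
  (forall i, integ P (F i)) -> integ P (fun w => \sum_(i <- s | p i) F i w).
Proof.
move=> hF; rewrite (_ : _ \o _ = (fun w => \sum_(i <- s | p i) (F i w)%:E)%E).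
  by have := @integrable_sum _ _ _ P _ measurableT _ s p (fun i w => (F i w)%:E) (fun i _ => hF i).
by apply/funext => w /=; rewrite sumEFin.
Qed.

Lemma eq_mean f g : f =1 g -> mean P f = mean P g.
Proof. by move=> fg; congr mean; apply/funext. Qed.

Lemma meanD f g : integ P f -> integ P g ->
  mean P (fun w => f w + g w) = mean P f + mean P g.
Proof.
move=> hf hg; rewrite 3!meanE -fineD ?integrable_fin_num//; congr fine.
by rewrite -integralD.
Qed.

Lemma meanB f g : integ P f -> integ P g ->
  mean P (fun w => f w - g w) = mean P f - mean P g.
Proof. by move=> hf hg; rewrite !meanE; exact: RintegralB. Qed.

Lemma meanZ c f : integ P f -> mean P (fun w => c * f w) = c * mean P f.
Proof. by move=> hf; rewrite !meanE; exact: RintegralZl. Qed.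

Lemma mean_cst c : mean P (fun=> c) = c.
Proof. by rewrite /mean expectation_cst. Qed.

Lemma mean_sum (I : Type) (s : seq I) (p : pred I) (F : I -> T -> R) :
  (forall i, integ P (F i)) ->
  mean P (fun w => \sum_(i <- s | p i) F i w) = \sum_(i <- s | p i) mean P (F i).
Proof.
move=> hF; elim: s => [|i s IH].
  by under eq_mean do rewrite big_nil; rewrite mean_cst big_nil.
under eq_mean do rewrite big_cons; rewrite big_cons; case: (p i) => //.
by rewrite meanD ?IH//; exact: integ_sum.
Qed.

Lemma mean_ge0 f : (forall w, 0 <= f w) -> 0 <= mean P f.
Proof.
by move=> h; rewrite meanE fine_ge0// integral_ge0// => w _; rewrite lee_fin.
Qed.

Lemma mean_le f g : integ P f -> integ P g -> (forall w, f w <= g w) ->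
  mean P f <= mean P g.
Proof. by move=> hf hg fg; rewrite !meanE; exact: le_Rintegral. Qed.

Lemma mean_norm f : integ P f -> `|mean P f| <= mean P (fun w => `|f w|).
Proof. by move=> hf; rewrite !meanE; exact: le_normr_Rintegral. Qed.

Lemma mean_norm_le f c : integ P f -> (forall w, `|f w| <= c) -> `|mean P f| <= c.
Proof.
move=> hf fc; apply: le_trans (mean_norm hf) _.
rewrite -[leRHS](mean_cst c); apply: mean_le => //; first exact: integ_norm.
exact: integ_cst.
Qed.

Lemma integ_sqr f : measurable_fun setT f -> integ P (fun w => f w ^+ 2) ->
  integ P f.
Proof.
move=> mf hf; apply: (@integ_dom _ (fun w => 1 + f w ^+ 2)) => //; last first.
  by apply: integD => //; exact: integ_cst.
move=> w; have := sqr_ge0 (`|f w| - 1); have := real_normK (num_real (f w)).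
by move=> <-; have := normr_ge0 (f w); nra.
Qed.

Lemma integM f g : measurable_fun setT f -> measurable_fun setT g ->
  integ P (fun w => f w ^+ 2) -> integ P (fun w => g w ^+ 2) ->
  integ P (fun w => f w * g w).
Proof.
move=> mf mg hf hg.
apply: (@integ_dom _ (fun w => f w ^+ 2 + g w ^+ 2)); last exact: integD.
  exact: measurable_funM.
move=> w; rewrite normrM.
have := sqr_ge0 (`|f w| - `|g w|).
rewrite -(real_normK (num_real (f w))) -(real_normK (num_real (g w))).
by have := normr_ge0 (f w); have := normr_ge0 (g w); nra.
Qed.

Lemma mean_indic A : measurable A -> mean P \1_A = pr P A.
Proof. by move=> mA; rewrite /mean expectation_indic. Qed.

Lemma integ_indic A : measurable A -> integ P \1_A.
Proof. by move=> mA; exact: integrable_indic. Qed.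

Lemma prE A : measurable A -> (P A = (pr P A)%:E)%E.
Proof. by move=> mA; rewrite /pr fineK// fin_num_measure. Qed.

Lemma pr_le A B : measurable A -> measurable B -> A `<=` B -> pr P A <= pr P B.
Proof.
move=> mA mB AB; rewrite /pr fine_le ?fin_num_measure//.
by apply: le_measure; rewrite ?inE.
Qed.

Lemma prC A : measurable A -> pr P (~` A) = 1 - pr P A.
Proof.
move=> mA; rewrite /pr probability_setC// fineB ?fin_num_measure//.
Qed.

Lemma prU A B : measurable A -> measurable B -> pr P (A `|` B) <= pr P A + pr P B.
Proof.
move=> mA mB; rewrite -lee_fin EFinD -!prE//; last exact: measurableU.
exact: measureU2.
Qed.

Lemma pr_cheb f e : 0 < e -> measurable_fun setT f ->
  integ P (fun w => f w ^+ 2) ->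
  pr P [set w | e <= `|f w|] <= mean P (fun w => f w ^+ 2) / e ^+ 2.
Proof.
move=> e0 mf hf.
have mA : measurable [set w | e <= `|f w|].
  by apply: measurable_le => //; exact: measurableT_comp.
rewrite -mean_indic// ler_pdivlMr ?exprn_gt0// mulrC -meanZ; last exact: integ_indic.
apply: mean_le => //.
  exact/integZ/integ_indic.
move=> w; rewrite indicE; case: (boolP (w \in _)) => [|_]; rewrite ?mulr0 ?sqr_ge0//.
rewrite inE mulr1/= => h; rewrite -[leRHS](real_normK (num_real _)).
by rewrite ler_sqr ?nnegrE// ltW.
Qed.

Lemma mean_cvg (F : nat -> T -> R) f g :
  (forall n, measurable_fun setT (F n)) -> measurable_fun setT f ->
  (forall w, F ^~ w @ \oo --> f w) -> integ P g ->
  (forall n w, `|F n w| <= g w) -> (fun n => mean P (F n)) @ \oo --> mean P f.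
Proof.
move=> mF mf Ff ig Fg.
have hf : integ P f.
  apply: (integ_dom mf _ ig) => w.
  apply: (cvgr_to_le (cvg_norm (Ff w))).
  by apply: nearW => n; exact: Fg.
have hF n : integ P (F n) by apply: (integ_dom (mF n) _ ig).
have /= H := @dominated_cvg _ _ _ P setT measurableT (fun n w => (F n w)%:E)
  (EFin \o f) (EFin \o g).
apply: (@fine_cvg _ _ _ _ (fun n => (mean P (F n))%:E)) => /=.
rewrite -mean_EFin//.
rewrite (_ : (fun n => (mean P (F n))%:E) =
    (fun n => \int[P]_w (F n w)%:E)%E); last by apply/funext => n; rewrite mean_EFin.
apply: H => //.
- by move=> n; exact/measurable_EFinP.
- by move=> w _; apply: cvg_EFin; [exact: nearW|exact: Ff].
- by move=> n w _; rewrite lee_fin.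
Qed.
End mean_lemmas.

(** Both means are integrals against the same law on [T0]. The two source spaces may differ, so this
    serves both to compare a functional of x with the identity under [gauss] and to compare two
    observations of one row. *)
Lemma mean_law {d d' d0} {T : measurableType d} {T' : measurableType d'}
    {T0 : measurableType d0} {R : realType}
    (P : probability T R) (P' : probability T' R) (X : T -> T0) (X' : T' -> T0)
    (h : T0 -> R) :
  measurable_fun setT X -> measurable_fun setT X' ->
  (forall B, measurable B -> P (X @^-1` B) = P' (X' @^-1` B)) ->
  measurable_fun setT h ->
  (integ P (h \o X) -> integ P' (h \o X')) /\ mean P (h \o X) = mean P' (h \o X').
Proof.
move=> mX mX' XX' mh.
pose Y : {mfun T >-> T0} := mfun_Sub (mem_set mX).
pose Y' : {mfun T' >-> T0} := mfun_Sub (mem_set mX').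
have E (g : T0 -> \bar R) : measurable_fun setT g -> (forall t, 0 <= g t)%E ->
    (\int[P]_w g (X w) = \int[P']_w g (X' w))%E.
  move=> mg g0.
  have := @ge0_integral_distribution _ _ _ _ _ P Y g mg g0.
  have := @ge0_integral_distribution _ _ _ _ _ P' Y' g mg g0.
  rewrite /comp /= => <- <-.
  by apply: eq_measure_integral => A mA _; exact: XX'.
split.
  move=> /integrableP[_ hlt]; apply/integrableP; split.
    exact/measurable_EFinP/measurableT_comp.
  rewrite (E (fun t => `|(h t)%:E|)%E) in hlt => //.
  by apply: measurableT_comp => //; exact/measurable_EFinP.
rewrite !meanE; congr fine; rewrite integralE [RHS]integralE.
have mE : measurable_fun setT (EFin \o h) by exact/measurable_EFinP.
have := E ((EFin \o h)^\+)%E; have := E ((EFin \o h)^\-)%E.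
rewrite !unlock /= => En Ep; congr (_ - _)%E.
  by apply: Ep => [|t]; [by have := measurable_funepos mE; rewrite unlock|rewrite le_max lexx orbT].
by apply: En => [|t]; [by have := measurable_funeneg mE; rewrite unlock|rewrite le_max lexx orbT].
Qed.

(** * Gaussian laws *)

Section gaussian.
Context {R : realType}.
Notation leb := (@lebesgue_measure R).
Implicit Types (s t x : R).

(** The parameter is the standard deviation. The exponential formula for the density holds for
    [s != 0] only, whence that condition below. *)
Definition gauss s : probability (measurableTypeR R) R := normal_prob 0 s.

Lemma gauss_pdfE s x : s != 0 ->
  normal_pdf 0 s x = normal_peak s * expR (- (x ^+ 2 / (s ^+ 2 *+ 2))).
Proof. by move=> s0; rewrite normal_pdfE// /normal_fun subr0 mulNr. Qed.

(** Integrals against [gauss s] become Lebesgue integrals through the Radon-Nikodym derivative,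
    which equals the density only almost everywhere. *)
Lemma ge0_gauss_integral s (f : R -> \bar R) :
  measurable_fun [set: R] f -> (forall x, 0 <= f x)%E ->
  (\int[gauss s]_x f x = \int[leb]_x (f x * (normal_pdf 0 s x)%:E))%E.
Proof.
move=> mf f0; have dom := @normal_prob_dominates R 0 s.
rewrite -(Radon_Nikodym_SigmaFinite.change_of_variables dom f0 measurableT mf).
have mpdf : measurable_fun [set: R] (fun x => (normal_pdf 0 s x)%:E).
  by apply/measurable_EFinP; exact: measurable_normal_pdf.
have ifn := Radon_Nikodym_SigmaFinite.f_integrable dom.
apply: ae_eq_integral => //.
- by apply: emeasurable_funM => //; exact: measurable_int ifn.
- exact: emeasurable_funM.
- apply: ae_eqe_mul2l; apply: integral_ae_eq => // A _ mA.
  by rewrite -Radon_Nikodym_SigmaFinite.f_integral.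
Qed.

Lemma integ_gaussP s (f : R -> R) : measurable_fun [set: R] f ->
  integ (gauss s) f <->
  leb.-integrable setT (fun x => (f x * normal_pdf 0 s x)%:E).
Proof.
have mpdf : measurable_fun [set: R] (normal_pdf 0 s) by exact: measurable_normal_pdf.
move=> mf.
have E : (\int[gauss s]_x `|(f x)%:E| = \int[leb]_x `|(f x * normal_pdf 0 s x)%:E|)%E.
  rewrite ge0_gauss_integral//; last first.
    by apply: measurableT_comp => //; exact/measurable_EFinP.
  apply: eq_integral => x _.
  by rewrite EFinM abseM (@gee0_abs _ (normal_pdf 0 s x)%:E)// lee_fin normal_pdf_ge0.
split => /integrableP[_ hf]; apply/integrableP; split.
- exact/measurable_EFinP/measurable_funM.
- by rewrite -E.
- exact/measurable_EFinP.
- by rewrite [X in (X < _)%E]E.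
Qed.

Lemma gauss_meanE s (f : R -> R) : measurable_fun [set: R] f ->
  mean (gauss s) f = \int[leb]_x (f x * normal_pdf 0 s x).
Proof.
have mpdf : measurable_fun [set: R] (normal_pdf 0 s) by exact: measurable_normal_pdf.
move=> mf; rewrite meanE /Rintegral; congr fine.
have mf' : measurable_fun [set: R] (EFin \o f) by exact/measurable_EFinP.
rewrite [LHS]integralE [RHS]integralE ge0_gauss_integral//; last exact: measurable_funepos.
rewrite ge0_gauss_integral//; last exact: measurable_funeneg.
by congr (_ - _)%E; apply: eq_integral => x _; rewrite !unlock /= -EFin_max -?EFinM -?EFin_max;
  rewrite ?maxr_pMl ?normal_pdf_ge0 ?mul0r ?mulNr.
Qed.

Lemma expR_ge_pow m (y : R) : 0 <= y -> y ^+ m <= m`!%:R * expR y.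
Proof.
case: m => [|m] y0; first by rewrite expr0 fact0 mul1r -[leLHS]expR0 ler_expR.
have := expR_ge1Dxn m y0; set e := expR y => h.
rewrite -ler_pdivrMl ?ltr0n ?fact_gt0// mulrC.
by apply: le_trans h; rewrite lerDr.
Qed.

(** The power is paid for by doubling the standard deviation. With y = x^2 / (8 s^2) the two
    densities are proportional to exp(-4 y) and exp(-y), and y^m <= m! exp(y) costs only one of the
    three spare factors exp(-y). The leading 2 is the ratio of the peaks. *)
Lemma gauss_pdf_moment s m x : s != 0 ->
  x ^+ (2 * m) * normal_pdf 0 s x <=
  2 * (m`!%:R * (8 * s ^+ 2) ^+ m) * normal_pdf 0 (2 * s) x.
Proof.
move=> s0; have s20 : 2 * s != 0 by rewrite mulf_neq0// pnatr_eq0.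
rewrite !gauss_pdfE//.
have ss0 : 0 < s ^+ 2 by rewrite exprn_even_gt0.
set y := x ^+ 2 / (8 * s ^+ 2).
have y0 : 0 <= y by rewrite divr_ge0 ?sqr_ge0// mulr_ge0// ltW.
have -> : x ^+ (2 * m) = (8 * s ^+ 2) ^+ m * y ^+ m.
  by rewrite -exprMn exprM /y mulrC divfK// gt_eqF// mulr_gt0.
have -> : x ^+ 2 / (s ^+ 2 *+ 2) = 4 * y by rewrite /y -mulr_natl; field; rewrite ?s0 ?pnatr_eq0.
have -> : x ^+ 2 / ((2 * s) ^+ 2 *+ 2) = y.
  by rewrite /y -mulr_natl; field; rewrite ?s0 ?pnatr_eq0.
have -> : normal_peak s = 2 * normal_peak (2 * s).
  rewrite /normal_peak (_ : (2 * s) ^+ 2 * pi *+ 2 = 2 ^+ 2 * (s ^+ 2 * pi *+ 2)); last ring.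
  rewrite (@sqrtrM _ (2 ^+ 2)) ?sqr_ge0// (_ : Num.sqrt (2 ^+ 2) = 2 :> R); last first.
    by rewrite sqrtr_sqr ger0_norm.
  by rewrite invfM mulrA divff ?pnatr_eq0// mul1r.
set pk := normal_peak _; have pk0 : 0 <= pk by exact: normal_peak_ge0.
have -> : 2 * (m`!%:R * (8 * s ^+ 2) ^+ m) * (pk * expR (- y)) =
  (8 * s ^+ 2) ^+ m * (2 * pk) * (m`!%:R * expR (- y)) by ring.
rewrite (_ : _ * _ * _ = (8 * s ^+ 2) ^+ m * (2 * pk) * (y ^+ m * expR (- (4 * y)))); last ring.
have s80 : 0 <= (8 * s ^+ 2) ^+ m by rewrite exprn_ge0// mulr_ge0// ltW.
apply: ler_wpM2l; first by rewrite !mulr_ge0.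
apply: (@le_trans _ _ (m`!%:R * expR y * expR (- (4 * y)))).
  by rewrite ler_wpM2r ?expR_ge0// expR_ge_pow.
by rewrite -mulrA -expRD ler_wpM2l// ler_expR; lra.
Qed.

Lemma gauss_moment s m : s != 0 ->
  integ (gauss s) (fun x => x ^+ (2 * m)) /\
  mean (gauss s) (fun x => x ^+ (2 * m)) <= 2 * (m`!%:R * (8 * s ^+ 2) ^+ m).
Proof.
move=> s0; set c := 2 * _.
have mX : measurable_fun [set: R] (fun x : R => x ^+ (2 * m)) by exact: measurable_funX.
have mpdf : measurable_fun [set: R] (normal_pdf 0 s) by exact: measurable_normal_pdf.
have i2 : leb.-integrable setT (EFin \o (fun x => c * normal_pdf 0 (2 * s) x)).
  by have := integrableZl measurableT c (integrable_normal_pdf 0 (2 * s)).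
have i1 : leb.-integrable setT (EFin \o (fun x => x ^+ (2 * m) * normal_pdf 0 s x)).
  apply: le_integrable i2 => //; first exact/measurable_EFinP/measurable_funM.
  move=> x _ /=; rewrite lee_fin ger0_norm; last first.
    by rewrite mulr_ge0 ?normal_pdf_ge0// exprM exprn_ge0// sqr_ge0.
  exact: le_trans (gauss_pdf_moment _ _ s0) (ler_norm _).
split; first exact/integ_gaussP.
rewrite gauss_meanE//.
apply: le_trans (le_Rintegral measurableT i1 i2 (fun x _ => gauss_pdf_moment m x s0)) _.
rewrite RintegralZl//; last exact: integrable_normal_pdf.
by rewrite /Rintegral integral_normal_pdf mulr1.
Qed.

End gaussian.

Section gaussian_stein.
Context {R : realType}.
Notation leb := (@lebesgue_measure R).
Implicit Types (s t x : R).

(** From exp(-t) <= 1 / t. Quadratic decay suffices to remove the boundary terms of an integration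
    by parts against a function of linear growth. *)
Lemma gauss_pdf_decay s x : s != 0 -> x != 0 ->
  normal_pdf 0 s x <= normal_peak s * (s ^+ 2 *+ 2) / x ^+ 2.
Proof.
move=> s0 x0; rewrite gauss_pdfE// -mulrA ler_wpM2l ?normal_peak_ge0//.
have x20 : 0 < x ^+ 2 by rewrite exprn_even_gt0.
have s20 : 0 < s ^+ 2 *+ 2 by rewrite mulrn_wgt0// exprn_even_gt0.
rewrite -[leRHS]invf_div expRN lef_pV2 ?posrE ?expR_gt0 ?divr_gt0//.
by apply: le_trans (expR_ge1Dx _); rewrite lerDr.
Qed.

Lemma is_derive_gauss_pdf s x : s != 0 ->
  is_derive x 1 (normal_pdf 0 s) (- (x / s ^+ 2) * normal_pdf 0 s x).
Proof.
move=> s0.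
have -> : normal_pdf 0 s = (fun x => normal_peak s * expR (- (s ^+ 2 *+ 2)^-1 * x ^+ 2)).
  by apply/funext => y; rewrite gauss_pdfE// mulrC [in RHS]mulrC; congr (expR _ * _); rewrite mulNr mulrC.
apply: is_derive_eq.
rewrite /GRing.scale/=.
rewrite -mulr_natl; field.
by rewrite s0.
Qed.

Lemma integ_gauss_norm s : s != 0 -> integ (gauss s) (fun x => 1 + `|x|).
Proof.
move=> s0; apply: integD; first exact: integ_cst.
apply: integ_norm; apply: integ_sqr => //.
by have [] := gauss_moment 1 s0.
Qed.

(** Integration by parts: the derivative of h times the density is [phi], that is h' - x h / s^2,
    times the density. The fundamental theorem is applied on [-(n+1), n+1]; the integrals converge
    by domination and the boundary terms are O(1/n). *)
Lemma gauss_stein s B (h h' : R -> R) : s != 0 ->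
  (forall x, is_derive x 1 h (h' x)) -> continuous h' ->
  (forall x, `|h x| <= B * (1 + `|x|)) -> (forall x, `|h' x| <= B) ->
  mean (gauss s) (fun x => x * h x) = s ^+ 2 * mean (gauss s) h'.
Proof.
move=> s0 dh ch' hB h'B.
have B0 : 0 <= B by apply: le_trans (h'B 0).
have ch : continuous h.
  by move=> x; apply/differentiable_continuous/derivable1_diffP; have [] := dh x.
have mh : measurable_fun [set: R] h by exact: continuous_measurable_fun.
have mh' : measurable_fun [set: R] h' by exact: continuous_measurable_fun.
have mpdf : measurable_fun [set: R] (normal_pdf 0 s) by exact: measurable_normal_pdf.
have i2 : integ (gauss s) (fun x => x ^+ 2) by have [] := gauss_moment 1 s0.
have ih' : integ (gauss s) h' by exact: (integ_bnd (gauss s) mh' h'B).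
have ixh : integ (gauss s) (fun x => x * h x).
  have Z := @integ_dom _ _ _ (gauss s) (fun x => x * h x) (fun x => B * (1 + 2 * x ^+ 2)). apply: Z.
  - exact: measurable_funM.
  - move=> x; rewrite normrM -(real_normK (num_real x)).
    have := hB x; have := normr_ge0 x; set a := `|x|; set b := `|h x| => a0 hb.
    apply: (@le_trans _ _ (a * (B * (1 + a)))); first by rewrite ler_wpM2l.
    by have := sqr_ge0 (a - 1); nra.
  - by apply/integZ/integD; [exact: integ_cst|exact: integZ].
pose phi x := h' x - (s ^+ 2)^-1 * (x * h x).
have iphi : integ (gauss s) phi by apply/integB => //; exact: integZ.
suff : mean (gauss s) phi = 0.
  rewrite /phi meanB//; last exact: integZ.
  rewrite meanZ// => /eqP; rewrite subr_eq0 => /eqP ->.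
  by rewrite mulrA divff ?mul1r// expf_neq0.
have mphi := integ_meas iphi.
rewrite gauss_meanE//.
pose g x := phi x * normal_pdf 0 s x; pose G x := h x * normal_pdf 0 s x.
have ig : leb.-integrable setT (EFin \o g) by exact/integ_gaussP.
have mg := measurable_int _ ig.
have dG x : is_derive x 1 G (g x).
  have ? := dh x; have ? := is_derive_gauss_pdf x s0.
  apply: is_derive_eq; rewrite /g /phi /GRing.scale/=.
  ring.
have cpdf : continuous (normal_pdf 0 s) by exact: continuous_normal_pdf.
have cg : continuous g.
  move=> x; apply: cvgM; last exact: cpdf.
  apply: cvgB; first exact: ch'.
  by apply: cvgM; [exact: cvg_cst|apply: cvgM => //; exact: ch].
have cG : continuous G by move=> x; apply: cvgM; [exact: ch|exact: cpdf].
have E n : \int[leb]_(x in `[- n.+1%:R, n.+1%:R]) g x = G n.+1%:R - G (- n.+1%:R).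
  rewrite /Rintegral (@continuous_FTC2 _ g G)//.
  - by rewrite (@lt_trans _ _ 0)// oppr_lt0.
  - by apply: continuous_subspaceT.
  - split; first by move=> x _; have [] := dG x.
      by apply: cvg_at_right_filter; exact: cG.
    by apply: cvg_at_left_filter; exact: cG.
  - by move=> x _; rewrite derive1E; have [_ ->] := dG x.
have lim1 : (fun n => \int[leb]_(x in `[- n.+1%:R, n.+1%:R]) g x) @ \oo -->
    \int[leb]_x g x.
  apply: fine_cvg.
  rewrite fineK; last exact: integrable_fin_num.
  rewrite (_ : (fun n => _) = (fun n => \int[leb]_x (g x * \1_`[- n.+1%:R, n.+1%:R] x)%:E))%E; last first.
    apply/funext => n; rewrite integral_mkcond; apply: eq_integral => x _.
    by rewrite patchE indicE; case: ifP; rewrite ?mulr1 ?mulr0.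
  apply: (@dominated_cvg _ _ _ leb setT measurableT _ _ (fun x => `|g x|%:E)) => //.
  - move=> n; apply/measurable_EFinP/measurable_funM; first exact/measurable_EFinP.
    exact: measurable_indic.
  - move=> x _; apply: cvg_near_cst.
    near=> n; rewrite indicE mem_set ?mulr1//=.
    rewrite in_itv/= -ler_norml.
    apply: (@le_trans _ _ n%:R); last by rewrite ler_nat.
    by near: n; exact: nbhs_infty_ger.
  - by have := integrable_norm ig.
  - move=> n x _ /=; rewrite lee_fin normrM ler_piMr// indicE.
    by case: (_ \in _); rewrite ?normr1 ?normr0.
have lim2 : (fun n => G n.+1%:R - G (- n.+1%:R)) @ \oo --> 0.
  (* Each endpoint contributes at most half of c / (n+1), by 1 + m <= 2 m for m >= 1 and the decay
     of the density. *)
  pose c := B * 4 * (normal_peak s * (s ^+ 2 *+ 2)).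
  have bnd n (x : R) : `|x| = n.+1%:R -> `|G x| <= c / 2 * n.+1%:R^-1.
    move=> xn; have x0 : x != 0 by rewrite -normr_eq0 xn pnatr_eq0.
    rewrite /G normrM (ger0_norm (normal_pdf_ge0 _ _ _)).
    apply: (@le_trans _ _ (B * (1 + `|x|) * (normal_peak s * (s ^+ 2 *+ 2) / x ^+ 2))).
      by apply: ler_pM => //; rewrite ?normal_pdf_ge0// gauss_pdf_decay.
    rewrite -(real_normK (num_real x)) xn /c.
    set pk := normal_peak s * _; set m : R := n.+1%:R.
    have m0 : 0 < m by rewrite ltr0n.
    have m1 : 1 <= m by rewrite ler1n.
    have m2 : 1 + m <= 2 * m by rewrite mulr_natl mulr2n lerD2r.
    have pk0 : 0 <= pk by rewrite mulr_ge0 ?normal_peak_ge0// mulrn_wge0// sqr_ge0.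
    rewrite (_ : _ * _ = (B * pk) * (1 + m) / m ^+ 2); last ring.
    rewrite (_ : B * 4 * pk / 2 / m = (B * pk) * (2 * m) / m ^+ 2); last first.
      by field; rewrite gt_eqF.
    rewrite ler_wpM2r ?invr_ge0 ?sqr_ge0// ler_wpM2l//.
    exact: mulr_ge0.
  have c0 : (fun n => c * n.+1%:R^-1) @ \oo --> 0.
    by rewrite -(mulr0 c); apply: cvgM; [exact: cvg_cst|exact: cvg_harmonic].
  have c1 : (fun n => - (c * n.+1%:R^-1)) @ \oo --> 0 by rewrite -oppr0; exact: cvgN.
  apply: (squeeze_cvgr _ c1 c0); apply: nearW => n; rewrite -ler_norml.
  apply: le_trans (ler_normB _ _) _.
  have h1 := @bnd n n.+1%:R (ger0_norm (ler0n _ _)).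
  have h2 := @bnd n (- n.+1%:R) _; rewrite normrN in h2.
  have {}h2 := h2 (ger0_norm (ler0n _ _)).
  by apply: le_trans (lerD h1 h2) _; rewrite -mulrDl -splitr.
rewrite (_ : (fun n => _) = (fun n => G n.+1%:R - G (- n.+1%:R))) in lim1; last exact/funext.
exact: cvg_unique lim1 lim2.
Unshelve. all: by end_near. Qed.

Lemma gauss_var s : s != 0 -> mean (gauss s) (fun x => x ^+ 2) = s ^+ 2.
Proof.
move=> s0; have := @gauss_stein s 1 id (fun=> 1) s0.
rewrite mean_cst mulr1 => <- //.
- by move=> x; exact: cvg_cst.
- by move=> x; rewrite mul1r lerDr.
- by move=> x; rewrite normr1.
Qed.

(** Stein's identity for sin turns the derivative in t of this mean [F] into -t F, so F times
    exp(t^2 / 2) is constant and is evaluated at t = 0. *)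
Lemma gauss_cos (t th : R) :
  mean (gauss 1) (fun x => cos (t * x + th)) = expR (- t ^+ 2 / 2) * cos th.
Proof.
have o0 : (1 : R) != 0 by exact: oner_neq0.
have mlin (a b : R) : measurable_fun [set: R] (fun x => a * x + b).
  by apply: measurable_funD => //; exact: measurable_funM.
have mcos (a b : R) : measurable_fun [set: R] (fun x => cos (a * x + b)).
  apply: measurableT_comp (mlin a b); exact: continuous_measurable_fun (@continuous_cos R).
have msin (a b : R) : measurable_fun [set: R] (fun x => sin (a * x + b)).
  apply: measurableT_comp (mlin a b); exact: continuous_measurable_fun (@continuous_sin R).
pose F (t : R) := mean (gauss 1) (fun x => cos (t * x + th)).
have dlin (x : R) (a b : R) : is_derive x 1 (fun x => a * x + b) a.
  by apply: is_derive_eq; rewrite /GRing.scale/= mulr1 addr0.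
have St t0 : mean (gauss 1) (fun x => x * sin (t0 * x + th)) = t0 * F t0.
  have h1 (x : R) : is_derive x 1 (fun x => sin (t0 * x + th)) (t0 * cos (t0 * x + th)).
    have ? := dlin x t0 th.
    by apply: is_derive_eq; rewrite /GRing.scale/= mulrC.
  have h2 : continuous (fun x => t0 * cos (t0 * x + th)).
    move=> x; apply: cvgM; first exact: cvg_cst.
    apply: (@continuous_comp _ _ _ (fun x => t0 * x + th) cos); last exact: continuous_cos.
    by apply: cvgD; [apply: cvgM; [exact: cvg_cst|exact: cvg_id]|exact: cvg_cst].
  have h3 (x : R) : `|sin (t0 * x + th)| <= (1 + `|t0|) * (1 + `|x|).
    apply: le_trans (sin_max _) _.
    by have := normr_ge0 x; have := normr_ge0 t0; nra.
  have h4 (x : R) : `|t0 * cos (t0 * x + th)| <= 1 + `|t0|.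
    rewrite normrM; have := cos_max (t0 * x + th).
    by have := normr_ge0 t0; nra.
  rewrite (gauss_stein o0 h1 h2 h3 h4) expr1n mul1r meanZ//.
  exact: (integ_bnd (gauss 1) (mcos t0 th) (fun x => cos_max _)).
have dF t0 : is_derive t0 1 F (- (t0 * F t0)).
  pose f (a x : R) : R := cos (a * x + th).
  have dcos (a x : R) : is_derive a 1 (fun a => f a x) (- (x * sin (a * x + th))).
    have : is_derive a 1 (fun a : R => a * x + th) x.
      by apply: is_derive_eq; rewrite /GRing.scale/=; ring.
    by move=> ?; apply: is_derive_eq; rewrite /GRing.scale/=; ring.
  have p1 x y : partial1of2 f x y = - (y * sin (x * y + th)).
    by rewrite partial1of2E; have [_ ->] := dcos x y.
  have FE : F = (fun a => \int[gauss 1]_x f a x).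
    by apply/funext => a; rewrite /F meanE.
  (* Differentiation under the integral takes place on this neighborhood; the derivative is
     dominated by the integrable function 1 + |x|. *)
  have t0I : `]t0 - 1, t0 + 1[%classic t0 by rewrite /= in_itv/=; lra.
  have if_ a : `]t0 - 1, t0 + 1[%classic a -> integ (gauss 1) (f a).
    by move=> _; exact: (integ_bnd (gauss 1) (mcos a th) (fun x => cos_max _)).
  have G0 (x : R) : 0 <= 1 + `|x| by rewrite addr_ge0.
  have df a x : `]t0 - 1, t0 + 1[%classic a -> [set: R] x -> derivable (f ^~ x) a 1.
    by move=> _ _; have [] := dcos a x.
  have ub a x : `]t0 - 1, t0 + 1[%classic a -> [set: R] x -> `|partial1of2 f a x| <= 1 + `|x|.
    move=> _ _; rewrite p1 normrN normrM; have := sin_max (a * x + th).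
    by have := normr_ge0 x; nra.
  have H1 := @derivable_under_integral R _ _ (gauss 1) f setT measurableT t0 _ _ t0I
    if_ df _ G0 (integ_gauss_norm o0) ub.
  have H2 := @differentiation_under_integral R _ _ (gauss 1) f setT measurableT t0 _ _ t0I
    if_ df _ G0 (integ_gauss_norm o0) ub.
  apply: DeriveDef; first by rewrite FE.
  rewrite -derive1E -St meanE [in LHS]FE H2.
  rewrite (_ : fine _ = \int[gauss 1]_x (x * sin (t0 * x + th)))//.
  under eq_Rintegral do rewrite p1 -mulN1r.
  rewrite RintegralZl// ?mulN1r//.
  have Z := @integ_dom _ _ _ (gauss 1) (fun x => x * sin (t0 * x + th)) (fun x => 1 + `|x|).
  have mxs : measurable_fun [set: R] (fun x => x * sin (t0 * x + th)) by exact: measurable_funM.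
  apply: Z (integ_gauss_norm o0); first exact: mxs.
  move=> x; rewrite normrM; have := sin_max (t0 * x + th).
  by have := normr_ge0 x; nra.
pose H (a : R) := F a * expR (a ^+ 2 / 2).
have dH (a : R) : is_derive a (1 : R) H 0.
  have ? := dF a.
  by apply: is_derive_eq; rewrite /GRing.scale/=; field.
have := is_derive_0_is_cst t 0 dH.
rewrite /H expr0n mul0r expR0 mulr1 /F.
under [X in _ = X -> _]eq_mean do rewrite mul0r add0r.
rewrite mean_cst => <-.
by rewrite mulrC -mulrA -expRD mulNr subrr expR0 mulr1.
Qed.

End gaussian_stein.

(** * Trigonometric polynomials and weak convergence *)

Section trigonometric_polynomials.
Context {R : realType}.
Implicit Types (s t x c th : R) (p q : R -> R).

(** The phase [th] makes sines and constants instances of the cosine, so real characteristic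
    functions suffice. The frequencies are arbitrary reals, which keeps the class closed under
    products. *)
Inductive trigpoly : (R -> R) -> Prop :=
| Trig_cos c s th : trigpoly (fun x => c * cos (s * x + th))
| Trig_add p q : trigpoly p -> trigpoly q -> trigpoly (fun x => p x + q x).

Lemma trigpoly_cst c : trigpoly (fun=> c).
Proof.
rewrite (_ : (fun=> c) = fun x => c * cos (0 * x + 0)); first exact: Trig_cos.
by apply/funext => x; rewrite mul0r addr0 cos0 mulr1.
Qed.

Lemma trigpoly_scale c p : trigpoly p -> trigpoly (fun x => c * p x).
Proof.
elim=> {p} [c' s th|p q _ hp _ hq].
  by under eq_fun do rewrite mulrA; exact: Trig_cos.
by under eq_fun do rewrite mulrDr; exact: Trig_add.
Qed.

Lemma cos_mul_cos x y : cos x * cos y = (cos (x + y) + cos (x - y)) / 2.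
Proof. by rewrite cosD cosB; field. Qed.

Lemma trigpoly_mul p q : trigpoly p -> trigpoly q -> trigpoly (fun x => p x * q x).
Proof.
move=> hp hq; elim: hp => {p} [c s th|p p' _ hp _ hp']; last first.
  by under eq_fun do rewrite mulrDl; exact: Trig_add.
elim: hq => {q} [c' s' th'|q q' _ hq _ hq']; last first.
  by under eq_fun do rewrite mulrDr; exact: Trig_add.
rewrite (_ : (fun x => _) = (fun x => c * c' / 2 * cos ((s + s') * x + (th + th')) +
    c * c' / 2 * cos ((s - s') * x + (th - th')))); first by apply: Trig_add; exact: Trig_cos.
apply/funext => x.
rewrite (_ : (s + s') * x + (th + th') = (s * x + th) + (s' * x + th')); last ring.
rewrite (_ : (s - s') * x + (th - th') = (s * x + th) - (s' * x + th')); last ring.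
by rewrite mulrACA cos_mul_cos; field.
Qed.

Lemma trigpoly_exp p n : trigpoly p -> trigpoly (fun x => p x ^+ n).
Proof.
move=> hp; elim: n => [|n IH]; first exact: trigpoly_cst.
by under eq_fun do rewrite exprS; exact: trigpoly_mul.
Qed.

Lemma trigpoly_continuous p : trigpoly p -> continuous p.
Proof.
elim=> {p} [c s th|p q _ hp _ hq] x; last by apply: cvgD; [exact: hp|exact: hq].
apply: cvgM; first exact: cvg_cst.
apply: (@continuous_comp _ _ _ (fun x => s * x + th) cos); last exact: continuous_cos.
by apply: cvgD; [apply: cvgM; [exact: cvg_cst|exact: cvg_id]|exact: cvg_cst].
Qed.

Lemma trigpoly_measurable p : trigpoly p -> measurable_fun [set: R] p.
Proof. by move=> /trigpoly_continuous; exact: continuous_measurable_fun. Qed.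

Lemma trigpoly_bounded p : trigpoly p -> exists B, forall x, `|p x| <= B.
Proof.
elim=> {p} [c s th|p q _ [B hB] _ [B' hB']].
  exists `|c| => x; rewrite normrM ler_piMr//; exact: cos_max.
by exists (B + B') => x; rewrite (le_trans (ler_normD _ _))// lerD.
Qed.

Lemma bernoulli_ineq (y : R) n : 0 <= y <= 1 -> 1 - n%:R * y <= (1 - y) ^+ n.
Proof.
move=> /andP[y0 y1]; elim: n => [|n IH]; first by rewrite mul0r subr0.
rewrite exprS; apply: (@le_trans _ _ ((1 - y) * (1 - n%:R * y))); last first.
  by rewrite ler_wpM2l// subr_ge0.
rewrite -natr1; have := ler0n R n; set m : R := n%:R => m0.
by rewrite -subr_ge0 (_ : _ - _ = m * (y * y)); [rewrite !mulr_ge0|ring].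
Qed.

Lemma exp_ineq (y : R) n : y <= 1 -> (1 - y) ^+ n <= expR (- (n%:R * y)).
Proof.
move=> y1; rewrite -mulrN expRM_natl lerXn2r ?nnegrE ?expR_ge0 ?subr_ge0//.
exact: expR_ge1Dx.
Qed.

(** With r the square root of a, one factor r^k absorbs k because k r^k (1 - r) <= 1 - r^k, and the
    other factor r^k tends to 0. *)
Lemma cvg_natX (a : R) : 0 <= a < 1 -> (fun k => k%:R * a ^+ k) @ \oo --> 0.
Proof.
move=> /andP[a0 a1]; pose r := Num.sqrt a.
have r0 : 0 <= r by exact: sqrtr_ge0.
have r1 : r < 1 by rewrite -sqrtr1 ltr_sqrt.
have bnd k : k%:R * r ^+ k * (1 - r) <= 1 - r ^+ k.
  elim: k => [|k IH]; first by rewrite mul0r mul0r expr0 subrr.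
  have rk0 : 0 <= r ^+ k by rewrite exprn_ge0.
  have rk1 : r ^+ k <= 1 by rewrite exprn_ile1// ltW.
  move: IH; rewrite -natr1 exprS; set m : R := k%:R; set z := r ^+ k => IH.
  have : 0 <= (1 - r) * (1 - r * z).
    by rewrite mulr_ge0// subr_ge0 ?mulr_ile1// ltW.
  have := ler_wpM2l r0 IH.
  lra.
apply: (@squeeze_cvgr _ _ _ _ (fun=> 0) (fun k => (1 - r)^-1 * r ^+ k)).
- apply: nearW => k; rewrite mulr_ge0 ?exprn_ge0//=.
  rewrite -[a](sqr_sqrtr a0) -/r expr2 exprMn mulrA ler_wpM2r ?exprn_ge0//.
  rewrite -[leRHS]mul1r ler_pdivlMr ?subr_gt0//.
  by apply: le_trans (bnd k) _; rewrite lerBlDr lerDl exprn_ge0.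
- exact: cvg_cst.
- by apply: cvg_geometric; rewrite ger0_norm.
Qed.

(* q = (1 - y^k)^(k 2^k) with y = (1 + sin ((x - t) / L)) / 2: it is close to 1
   where y < 1/2, since k 2^k y^k -> 0, and below e^(-k) where y >= 1/2. *)
Lemma trigpoly_step t (del A e : R) : 0 < del -> 0 < A -> 0 < e ->
  exists q, [/\ trigpoly q, forall x, 0 <= q x <= 1,
    forall x, `|x| <= A -> x <= t - del -> 1 - e <= q x &
    forall x, `|x| <= A -> t <= x -> q x <= e].
Proof.
(* With this L the argument (x - t) / L stays in [-1, 1], hence in [-pi/2, pi/2], where sin is
   increasing. For x <= t - del one gets 2 y <= 1 - sin (del / L), which is [b] below. *)
move=> del0 A0 e0; pose L := A + `|t| + del.
have L0 : 0 < L by rewrite /L; have := normr_ge0 t; lra.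
pose y x := (1 + sin ((x - t) / L)) / 2.
have y01 x : 0 <= y x <= 1.
  by rewrite /y; have := sin_geN1 ((x - t) / L); have := sin_le1 ((x - t) / L); lra.
have ty : trigpoly y.
  rewrite (_ : y = fun x => 2^-1 + 2^-1 * cos (L^-1 * x + (- t / L - pi / 2))).
    by apply: Trig_add; [exact: trigpoly_cst|exact: Trig_cos].
  apply/funext => x; rewrite /y addrA cosBpihalf mulrDl mul1r [in RHS]mulrC; congr (_ + sin _ / _).
  by rewrite mulrBl mulNr [in RHS]mulrC.
have L1 x : `|x| <= A -> - 1 <= (x - t) / L <= 1.
  move=> xA; rewrite -ler_norml normrM normfV (gtr0_norm L0) ler_pdivrMr// mul1r.
  by rewrite (le_trans (ler_normB _ _))// /L; lra.
have pi1 := pihalf_ge1 R.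
have inpi (x : R) : - 1 <= x <= 1 -> x \in `[(- (pi / 2)), (pi / 2)].
  by rewrite in_itv/=; lra.
pose u := del / L.
have u01 : 0 < u <= 1.
  rewrite divr_gt0//= ler_pdivrMr// mul1r /L; have := normr_ge0 t; lra.
pose b := 1 - sin u.
have su : 0 < sin u by rewrite -sin0 ltr_sin ?inpi//; lra.
have b01 : 0 <= b < 1 by rewrite /b; have := sin_le1 u; lra.
have [k [hk1 hk2]] : exists k : nat, k%:R * b ^+ k <= e /\ expR (- k%:R) <= e.
  have h1 : \forall k \near \oo, k%:R * b ^+ k <= e.
    by apply: (cvgr_le _ (cvg_natX b01)).
  have h2 : \forall k \near \oo, expR (- k%:R) <= e :> R.
    by apply: (cvgr_le _ (@cvgn_expR R)).
  near \oo => k; exists k; split; near: k; [exact: h1|exact: h2].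
exists (fun x => (1 - y x ^+ k) ^+ (k * 2 ^ k)); split.
- apply: trigpoly_exp; rewrite (_ : (fun x => _) = (fun x => 1 + - 1 * y x ^+ k)).
    by apply: Trig_add; [exact: trigpoly_cst|exact/trigpoly_scale/trigpoly_exp].
  by apply/funext => x; rewrite mulN1r.
- move=> x; have /andP[h0 h1] := y01 x.
  have : 0 <= 1 - y x ^+ k <= 1 by rewrite subr_ge0 exprn_ile1//= lerBlDr lerDl exprn_ge0.
  by move=> /andP[g0 g1]; rewrite exprn_ge0//= exprn_ile1.
- move=> x xA xt; have /andP[h0 h1] := y01 x.
  apply: le_trans (bernoulli_ineq _ _); last by rewrite exprn_ge0//= exprn_ile1.
  rewrite lerD2l lerN2 natrM natrX -mulrA -exprMn; apply: le_trans hk1.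
  rewrite ler_wpM2l// lerXn2r ?nnegrE ?mulr_ge0//; first by lra.
  rewrite /y mulrC divfK ?pnatr_eq0// /b lerD2l.
  have xu : (x - t) / L <= - u by rewrite /u -mulNr ler_wpM2r ?invr_ge0 ?(ltW L0)//; lra.
  have i1 := inpi _ (L1 x xA); have i2 : - u \in `[(- (pi / 2)), (pi / 2)] by apply: inpi; lra.
  by rewrite -sinN leNgt ltr_sin// -leNgt.
- move=> x xA tx; have /andP[h0 h1] := y01 x.
  apply: le_trans (exp_ineq _ _) _; first by rewrite exprn_ile1.
  apply: le_trans hk2; rewrite ler_expR lerN2 natrM natrX -mulrA -exprMn.
  rewrite ler_peMr// exprn_ege1// /y mulrC divfK ?pnatr_eq0// lerDl.
  have i1 := inpi _ (L1 x xA); have i2 : 0 \in `[(- (pi / 2)), (pi / 2) : R] by apply: inpi; lra.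
  by rewrite -sin0 leNgt ltr_sin// -leNgt divr_ge0 ?subr_ge0 ?(ltW L0).
Unshelve. all: by end_near. Qed.

End trigonometric_polynomials.

(** * Joint laws determined by the laws of linear combinations *)

Lemma trivIset_preimage (S T : Type) (X : S -> T) (F : nat -> set T) :
  trivIset setT F -> trivIset setT (fun n => X @^-1` F n).
Proof.
move=> /trivIsetP tF; apply/trivIsetP => i j _ _ ij.
by rewrite -preimage_setI tF// preimage_set0.
Qed.

Section law_uniqueness.
Context {d d'} {T : measurableType d} {T' : measurableType d'} {R : realType}.
Variables (P : probability T R) (P' : probability T' R).

Lemma pi_lambda_law {d0} {T0 : measurableType d0} (G : set (set T0))
    (X : T -> T0) (X' : T' -> T0) (C : set T) (C' : set T') :
  @measurable _ T0 = <<s G >> -> setI_closed G ->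
  measurable_fun setT X -> measurable_fun setT X' ->
  measurable C -> measurable C' -> P C = P' C' ->
  (forall B, G B -> P (C `&` X @^-1` B) = P' (C' `&` X' @^-1` B)) ->
  forall B, measurable B -> P (C `&` X @^-1` B) = P' (C' `&` X' @^-1` B).
Proof.
move=> GE GI mX mX' mC mC' CC' H B; rewrite GE.
have mXB A : measurable A -> measurable (C `&` X @^-1` A).
  by move=> mA; apply: measurableI => //; rewrite -[X in measurable X]setTI; exact: mX.
have mXB' A : measurable A -> measurable (C' `&` X' @^-1` A).
  by move=> mA; apply: measurableI => //; rewrite -[X in measurable X]setTI; exact: mX'.
have mXp A : measurable A -> measurable (X @^-1` A).
  by move=> mA; rewrite -[X in measurable X]setTI; exact: mX.
have mXp' A : measurable A -> measurable (X' @^-1` A).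
  by move=> mA; rewrite -[X in measurable X]setTI; exact: mX'.
have CD A : C `&` X @^-1` (~` A) = C `\` (C `&` X @^-1` A).
  by rewrite preimage_setC setDE setCI setIUr setICr set0U.
have CD' A : C' `&` X' @^-1` (~` A) = C' `\` (C' `&` X' @^-1` A).
  by rewrite preimage_setC setDE setCI setIUr setICr set0U.
apply: (@dynkin_induction _ T0 G
  (fun B => P (C `&` X @^-1` B) = P' (C' `&` X' @^-1` B))) => //.
- by rewrite !preimage_setT !setIT.
- move=> S mS IH; rewrite CD CD' !measureD//.
  + by rewrite !setIA !setIid; congr (_ - _)%E; [exact: CC'|exact: IH].
  + exact: mXB'.
  + by rewrite (le_lt_trans (probability_le1 P' mC')) ?ltry.
  + exact: mXB.
  + by rewrite (le_lt_trans (probability_le1 P mC)) ?ltry.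
- move=> F mF tF IH; rewrite !preimage_bigcup !setI_bigcupr.
  rewrite !measure_bigcup//=.
  + by apply: eq_eseriesr => n _; exact: IH.
  + by move=> n _; exact: mXB'.
  + by apply: trivIset_setIl; exact: trivIset_preimage.
  + by move=> n _; exact: mXB.
  + by apply: trivIset_setIl; exact: trivIset_preimage.
Qed.

End law_uniqueness.

Section cramer_wold.
Context {d d'} {T : measurableType d} {T' : measurableType d'} {R : realType}.
Variables (P : probability T R) (P' : probability T' R).

(** Windows of radius n+1, transition width and error 1/(n+1). The descent takes place to the left
    of a, so the limit is the indicator of the open ray. *)
Lemma trigpoly_step_seq (a : R) : exists p : nat -> R -> R,
  [/\ forall n, trigpoly (p n), forall n x, 0 <= p n x <= 1 &
     forall x, p ^~ x @ \oo --> (((x < a)%R)%:R : R)].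
Proof.
have H (n : nat) : exists q : R -> R, [/\ trigpoly q, forall x, 0 <= q x <= 1,
    forall x, `|x| <= n.+1%:R -> x <= a - n.+1%:R^-1 -> 1 - n.+1%:R^-1 <= q x &
    forall x, `|x| <= n.+1%:R -> a <= x -> q x <= n.+1%:R^-1].
  by apply: trigpoly_step; rewrite ?invr_gt0 ltr0n.
have [p hp] := choice H; exists p; split => [n|n x|x].
- by have [] := hp n.
- by have [_ + _ _] := hp n; exact.
have bigx : \forall n \near \oo, `|x| <= n.+1%:R.
  near=> n; apply: (@le_trans _ _ n%:R); last by rewrite ler_nat.
  by near: n; exact: nbhs_infty_ger.
have c0 := @cvg_harmonic R.
have [xa|ax] := ltP x a.
- have bigd : \forall n \near \oo, n.+1%:R^-1 <= a - x.
    by apply: (cvgr_le _ c0); rewrite subr_gt0.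
  have c1 : (fun n => 1 - n.+1%:R^-1 : R) @ \oo --> (1 : R).
    by rewrite -[X in _ --> X]subr0; apply: cvgB; [exact: cvg_cst|exact: c0].
  apply: (squeeze_cvgr _ c1 (@cvg_cst _ _ _ _ _)); near=> n.
  have [_ h01 h1 _] := hp n.
  rewrite h1; first by have /andP[] := h01 x.
    by near: n.
  rewrite lerBrDr addrC -lerBrDr; by near: n.
- apply: (squeeze_cvgr _ (@cvg_cst _ _ _ _ _) c0); near=> n.
  have [_ h01 _ h2] := hp n; rewrite h2//; first by have /andP[->] := h01 x.
  by near: n.
Unshelve. all: by end_near. Qed.

Variables (A G : T -> R) (A' G' : T' -> R).
Hypotheses (mA : measurable_fun setT A) (mG : measurable_fun setT G)
  (mA' : measurable_fun setT A') (mG' : measurable_fun setT G').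
Hypothesis cosAG : forall s t th : R,
  mean P (fun w => cos (s * A w + t * G w + th)) =
  mean P' (fun w => cos (s * A' w + t * G' w + th)).

Lemma mean_trigpoly2 (p q : R -> R) : trigpoly p -> trigpoly q ->
  mean P (fun w => p (A w) * q (G w)) = mean P' (fun w => p (A' w) * q (G' w)).
Proof.
have ib d1 (S : measurableType d1) (Q : probability S R) (Y Z : S -> R) (p1 q1 : R -> R) :
    measurable_fun setT Y -> measurable_fun setT Z ->
    trigpoly p1 -> trigpoly q1 -> integ Q (fun w => p1 (Y w) * q1 (Z w)).
  move=> mY mZ hp hq; have [B hB] := trigpoly_bounded hp.
  have [B' hB'] := trigpoly_bounded hq.
  apply: (@integ_bnd _ _ _ _ (B * B')).
    by apply: measurable_funM; apply: measurableT_comp => //; exact: trigpoly_measurable.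
  by move=> w; rewrite normrM ler_pM.
move=> hp hq; elim: hp => {p} [c s th|p p' tp hp tp' hp']; last first.
  under eq_mean do rewrite mulrDl; under [RHS]eq_mean do rewrite mulrDl.
  rewrite meanD; last 2 first.
  - exact: (ib _ _ P A G _ _ mA mG tp hq).
  - exact: (ib _ _ P A G _ _ mA mG tp' hq).
  rewrite meanD ?hp ?hp'//.
  - exact: (ib _ _ P' A' G' _ _ mA' mG' tp hq).
  - exact: (ib _ _ P' A' G' _ _ mA' mG' tp' hq).
elim: hq => {q} [c' s' th'|q q' tq hq tq' hq']; last first.
  under eq_mean do rewrite mulrDr; under [RHS]eq_mean do rewrite mulrDr.
  have tc := Trig_cos c s th.
  rewrite meanD; last 2 first.
  - exact: (ib _ _ P A G _ _ mA mG tc tq).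
  - exact: (ib _ _ P A G _ _ mA mG tc tq').
  rewrite meanD ?hq ?hq'//.
  - exact: (ib _ _ P' A' G' _ _ mA' mG' tc tq).
  - exact: (ib _ _ P' A' G' _ _ mA' mG' tc tq').
have E (x y : R) : c * cos (s * x + th) * (c' * cos (s' * y + th')) =
    c * c' / 2 * cos (s * x + s' * y + (th + th')) +
    c * c' / 2 * cos (s * x + - s' * y + (th - th')).
  rewrite (_ : s * x + s' * y + (th + th') = (s * x + th) + (s' * y + th')); last ring.
  rewrite (_ : s * x + - s' * y + (th - th') = (s * x + th) - (s' * y + th')); last ring.
  by rewrite mulrACA cos_mul_cos; field.
under eq_mean do rewrite E; under [RHS]eq_mean do rewrite E.
have ic d1 (S : measurableType d1) (Q : probability S R) (Y Z : S -> R) (u v w : R) :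
    measurable_fun setT Y -> measurable_fun setT Z ->
    integ Q (fun x => cos (u * Y x + v * Z x + w)).
  move=> mY mZ; apply: (@integ_bnd _ _ _ _ 1) => [|x]; last exact: cos_max.
  apply: (measurableT_comp (f := cos)); first exact: continuous_measurable_fun (@continuous_cos R).
  by do 2 apply: measurable_funD => //; apply: measurable_funM.
by rewrite !meanD ?meanZ ?cosAG//; try apply: integZ; exact: ic.
Qed.

(** A product of two open-ray indicators is a bounded pointwise limit of products p(A) q(G) of
    trigonometric polynomials, and product-to-sum formulas reduce the means of these to the
    hypothesis. *)
Lemma cramer_wold_ray (a b : R) :
  P ([set w | A w < a] `&` [set w | G w < b]) =
  P' ([set w | A' w < a] `&` [set w | G' w < b]).
Proof.
have [p [tp p01 cp]] := trigpoly_step_seq a.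
have [q [tq q01 cq]] := trigpoly_step_seq b.
have lim d1 (S : measurableType d1) (Q : probability S R) (Y Z : S -> R) :
    measurable_fun setT Y -> measurable_fun setT Z ->
    measurable ([set w | Y w < a] `&` [set w | Z w < b]) /\
    (fun n => mean Q (fun w => p n (Y w) * q n (Z w))) @ \oo -->
    pr Q ([set w | Y w < a] `&` [set w | Z w < b]).
  move=> mY mZ.
  have mS : measurable ([set w | Y w < a] `&` [set w | Z w < b]).
    by apply: measurableI; exact: measurable_lt.
  split => //; rewrite -mean_indic//.
  apply: (@mean_cvg _ _ _ _ _ _ (fun=> 1)) => //.
  - by move=> n; apply: measurable_funM; apply: measurableT_comp => //; exact: trigpoly_measurable.
  - move=> w; rewrite indicI /= !indicE.
    rewrite (_ : (w \in [set w | Y w < a]) = (Y w < a)); last first.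
      by apply/idP/idP; rewrite inE.
    rewrite (_ : (w \in [set w | Z w < b]) = (Z w < b)); last first.
      by apply/idP/idP; rewrite inE.
    by apply: cvgM.
  - exact: integ_cst.
  - move=> n w; have /andP[h0 h1] := p01 n (Y w); have /andP[h2 h3] := q01 n (Z w).
    by rewrite ger0_norm ?mulr_ge0// mulr_ile1.
have [m1 l1] := lim _ _ P _ _ mA mG; have [m2 l2] := lim _ _ P' _ _ mA' mG'.
rewrite !prE//; congr EFin.
have E : (fun n => mean P (fun w => p n (A w) * q n (G w))) =
    (fun n => mean P' (fun w => p n (A' w) * q n (G' w))).
  by apply/funext => n; exact: mean_trigpoly2.
by rewrite E in l1; exact: cvg_unique l1 l2.
Qed.

End cramer_wold.

Section cramer_wold_law.
Context {d d'} {T : measurableType d} {T' : measurableType d'} {R : realType}.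
Variables (P : probability T R) (P' : probability T' R).
Variables (A G : T -> R) (A' G' : T' -> R).
Hypotheses (mA : measurable_fun setT A) (mG : measurable_fun setT G)
  (mA' : measurable_fun setT A') (mG' : measurable_fun setT G').
Hypothesis cosAG : forall s t th : R,
  mean P (fun w => cos (s * A w + t * G w + th)) =
  mean P' (fun w => cos (s * A' w + t * G' w + th)).

Lemma cramer_wold (B : set (R * R)) : measurable B ->
  P ((fun w => (A w, G w)) @^-1` B) = P' ((fun w => (A' w, G' w)) @^-1` B).
Proof.
pose rays : set (set R) := [set S | exists x, S = `]-oo, x[%classic].
have raysE : @measurable _ R = <<s rays >> by exact: (RGenInftyO.measurableE R).
have raysI : setI_closed rays.
  move=> _ _ [x ->] [y ->]; exists (Num.min x y).
  by apply/seteqP; split => z /=; rewrite !in_itv/= lt_min => /andP.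
have rayE (S : Type) (Y : S -> R) x : Y @^-1` `]-oo, x[%classic = [set w | Y w < x].
  by apply/seteqP; split => z /=; rewrite in_itv.
have raym d1 (S : measurableType d1) (Y : S -> R) x : measurable_fun setT Y ->
    measurable [set w | Y w < x] by move=> mY; exact: measurable_lt.
(* The ray statement for the pair (G, G), whose linear combinations are those of (A, G) with
   coefficients 0 and s + t; [lawA] uses (A, A) likewise. *)
have rayG b : P [set w | G w < b] = P' [set w | G' w < b].
  rewrite -[X in P X]setIid -[X in P' X]setIid; apply: cramer_wold_ray => // s t th.
  have := cosAG 0 (s + t) th.
  under eq_mean do rewrite mul0r add0r mulrDl.
  by under [in X in _ = X -> _]eq_mean do rewrite mul0r add0r mulrDl.
have preI d1 (S : measurableType d1) (Y : S -> R) D : measurable_fun setT Y ->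
    measurable D -> measurable (Y @^-1` D).
  by move=> mY mD; rewrite -[X in measurable X]setTI; exact: mY.
have step1 b D : measurable D ->
    P ([set w | G w < b] `&` A @^-1` D) = P' ([set w | G' w < b] `&` A' @^-1` D).
  move=> mD; apply: (pi_lambda_law raysE raysI mA mA') => //; try exact: raym.
  by move=> _ [x ->]; rewrite !rayE setIC [in RHS]setIC; exact: cramer_wold_ray.
have lawA D : measurable D -> P (A @^-1` D) = P' (A' @^-1` D).
  move=> mD; rewrite -[X in P X]setTI -[X in P' X]setTI.
  apply: (pi_lambda_law raysE raysI mA mA') => //.
    by rewrite !probability_setT.
  move=> _ [x ->]; rewrite !rayE !setTI.
  rewrite -[X in P X]setIid -[X in P' X]setIid; apply: cramer_wold_ray => // s t th.
  have := cosAG (s + t) 0 th.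
  under eq_mean do rewrite mul0r addr0 mulrDl.
  by under [in X in _ = X -> _]eq_mean do rewrite mul0r addr0 mulrDl.
have step2 D E : measurable D -> measurable E ->
    P (A @^-1` D `&` G @^-1` E) = P' (A' @^-1` D `&` G' @^-1` E).
  move=> mD mE; apply: (pi_lambda_law raysE raysI mG mG') => //.
  - exact: preI.
  - exact: preI.
  - exact: lawA.
  - by move=> _ [x ->]; rewrite !rayE setIC [in RHS]setIC; exact: step1.
move=> mB; rewrite -[X in P X]setTI -[X in P' X]setTI.
pose rect : set (set (R * R)) := [set D `*` E | D in measurable & E in measurable].
apply: (@pi_lambda_law _ _ _ _ _ P P' _ _ rect) => //.
- exact: measurable_prod_measurableType.
- move=> _ _ [D1 mD1 [E1 mE1 <-]] [D2 mD2 [E2 mE2 <-]].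
  exists (D1 `&` D2); first exact: measurableI.
  by exists (E1 `&` E2); [exact: measurableI|rewrite setXI].
- exact: measurable_fun_pair.
- exact: measurable_fun_pair.
- by rewrite !probability_setT.
- by move=> _ [D mD [E mE <-]]; rewrite !setTI; exact: step2.
Qed.

(** The third coordinate is independent of the pair on both sides, so equality on rectangles follows
    from the two marginal laws. It will be the uniform variable behind the random link function. *)
Lemma cramer_wold3 (U : T -> R) (U' : T' -> R) :
  measurable_fun setT U -> measurable_fun setT U' ->
  (forall D, measurable D -> P (U @^-1` D) = P' (U' @^-1` D)) ->
  (forall B D, measurable B -> measurable D ->
    P ((fun w => (A w, G w)) @^-1` B `&` U @^-1` D) =
    (P ((fun w => (A w, G w)) @^-1` B) * P (U @^-1` D))%E) ->
  (forall B D, measurable B -> measurable D ->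
    P' ((fun w => (A' w, G' w)) @^-1` B `&` U' @^-1` D) =
    (P' ((fun w => (A' w, G' w)) @^-1` B) * P' (U' @^-1` D))%E) ->
  forall B : set ((R * R) * R), measurable B ->
  P ((fun w => ((A w, G w), U w)) @^-1` B) =
  P' ((fun w => ((A' w, G' w), U' w)) @^-1` B).
Proof.
move=> mU mU' lU ind ind' B mB; rewrite -[X in P X]setTI -[X in P' X]setTI.
pose rect : set (set ((R * R) * R)) := [set D `*` E | D in measurable & E in measurable].
apply: (@pi_lambda_law _ _ _ _ _ P P' _ _ rect) => //.
- exact: measurable_prod_measurableType.
- move=> _ _ [D1 mD1 [E1 mE1 <-]] [D2 mD2 [E2 mE2 <-]].
  exists (D1 `&` D2); first exact: measurableI.
  by exists (E1 `&` E2); [exact: measurableI|rewrite setXI].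
- by apply: measurable_fun_pair => //; exact: measurable_fun_pair.
- by apply: measurable_fun_pair => //; exact: measurable_fun_pair.
- by rewrite !probability_setT.
- move=> _ [D mD [E mE <-]]; rewrite !setTI.
  by rewrite [LHS]ind// [RHS]ind'// cramer_wold// lU.
Qed.

End cramer_wold_law.

(** * From means of cosines to distribution functions *)

Lemma cvg_eq_pos (R : realType) (u v : nat -> R) (l : R) :
  (forall n, (0 < n)%N -> u n = v n) -> u @ \oo --> l -> v @ \oo --> l.
Proof.
move=> uv /cvgrPdist_le ul; apply/cvgrPdist_le => e e0.
near=> n; rewrite -uv; first by near: n; exact: ul.
by near: n; exact: nbhs_infty_gt.
Unshelve. all: by end_near. Qed.

Section smoothed_cdf.
Context {d} {T : measurableType d} {R : realType} (P : probability T R).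
Variables (Y : T -> R) (q : R -> R) (A e : R).
Hypotheses (mY : measurable_fun setT Y) (iY : integ P (fun w => Y w ^+ 2))
  (Y1 : mean P (fun w => Y w ^+ 2) <= 1).
Hypotheses (mq : measurable_fun setT q) (q01 : forall x, 0 <= q x <= 1).
Hypotheses (A0 : 0 < A) (e0 : 0 < e).

Let mqY : measurable_fun setT (fun w => q (Y w)).
Proof. exact: measurableT_comp. Qed.

Let iqY : integ P (fun w => q (Y w)).
Proof.
apply: (@integ_bnd _ _ _ _ 1) => // w.
by have /andP[h0 h1] := q01 (Y w); rewrite ger0_norm.
Qed.

Let tail := [set w | A <= `|Y w|].
Let mtail : measurable tail.
Proof. by apply: measurable_le => //; exact: measurableT_comp. Qed.

Let tail_le : pr P tail <= A ^- 2.
Proof.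
apply: le_trans (pr_cheb A0 mY iY) _.
by rewrite -[leRHS]mul1r ler_wpM2r// invr_ge0 sqr_ge0.
Qed.

(** A trigonometric step is controlled only for |x| <= A; the rest of the line costs the Chebyshev
    bound A^(-2), since the second moment of Y is at most 1. *)
Lemma cdf_le_smooth a : (forall x, `|x| <= A -> x <= a -> 1 - e <= q x) ->
  pr P [set w | Y w <= a] <= mean P (fun w => q (Y w)) + e + A ^- 2.
Proof.
move=> hq; have mS : measurable [set w | Y w <= a] by exact: measurable_le.
rewrite -mean_indic//.
apply: (@le_trans _ _ (mean P (fun w => q (Y w) + e + \1_tail w))); last first.
  rewrite !meanD ?mean_cst ?mean_indic ?lerD//; try exact: integ_indic; try exact: integ_cst.
  by apply: integD => //; exact: integ_cst.
apply: mean_le; first exact: integ_indic.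
  by apply: integD; [apply: integD => //; exact: integ_cst|exact: integ_indic].
move=> w; rewrite !indicE; have /andP[h0 h1] := q01 (Y w).
have [|_] := boolP (w \in [set w | Y w <= a]); last by rewrite !addr_ge0// ltW.
rewrite inE /= => Ya.
have [_|] := boolP (w \in tail); first by rewrite lerDr addr_ge0// ltW.
rewrite notin_setE /= => /negP; rewrite -ltNge => /ltW /hq /(_ Ya).
by rewrite addr0 lerBlDr.
Qed.

Lemma smooth_le_cdf b : (forall x, `|x| <= A -> b <= x -> q x <= e) ->
  mean P (fun w => q (Y w)) <= pr P [set w | Y w < b] + e + A ^- 2.
Proof.
move=> hq; have mS : measurable [set w | Y w < b] by exact: measurable_lt.
apply: (@le_trans _ _ (mean P (fun w => \1_[set w | Y w < b] w + e + \1_tail w))); last first.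
  rewrite !meanD ?mean_cst ?mean_indic ?lerD//; try exact: integ_indic; try exact: integ_cst.
  by apply: integD; [exact: integ_indic|exact: integ_cst].
apply: mean_le => //.
  apply: integD; last exact: integ_indic.
  by apply: integD; [exact: integ_indic|exact: integ_cst].
move=> w; rewrite !indicE; have /andP[h0 h1] := q01 (Y w).
have [_|] := boolP (w \in [set w | Y w < b]).
  by rewrite -addrA (le_trans h1)// lerDl addr_ge0// ltW.
rewrite notin_setE /= => /negP; rewrite -leNgt => Yb.
have [_|] := boolP (w \in tail); first by rewrite add0r (le_trans h1)// lerDr ltW.
rewrite notin_setE /= => /negP; rewrite -ltNge => /ltW /hq /(_ Yb).
by rewrite addr0 add0r.
Qed.

End smoothed_cdf.

Section gauss_cdf.
Context {R : realType}.

Definition Phi (t : R) : R := pr (gauss 1) `]-oo, t]%classic.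

(** The density is at most its peak 1 / sqrt(2 pi) <= 1. This is the quantitative continuity of the
    limit behind both the smoothing and Slutsky's argument. *)
Lemma Phi_lip (a b : R) : a <= b -> Phi b <= Phi a + (b - a).
Proof.
move=> ab.
have o0 : (1 : R) != 0 by exact: oner_neq0.
have mi (c : interval R) : measurable ([set` c] : set (measurableTypeR R)).
  by exact: measurable_itv.
have peak1 : normal_peak 1 <= 1 :> R.
  have h : 1 <= (1 : R) ^+ 2 * pi *+ 2.
    by rewrite expr1n mul1r; have := @pi_ge2 R; lra.
  have h' : 1 <= Num.sqrt ((1 : R) ^+ 2 * pi *+ 2).
    have h0 := lt_le_trans ltr01 h.
    by rewrite -[leLHS]sqrtr1 ler_sqrt ?h0 ?(ltW h0).
  have h0 := lt_le_trans ltr01 h'.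
  by rewrite /normal_peak invf_le1.
have h1 : pr (gauss 1) `]a, b]%classic <= b - a.
  rewrite -lee_fin -prE//.
  apply: (@le_trans _ _ (\int[@lebesgue_measure R]_(x in `]a, b]) (cst 1%E x))%E).
    apply: ge0_le_integral => //.
    - by move=> x _; rewrite lee_fin normal_pdf_ge0.
    - apply/measurable_EFinP/measurable_funTS; exact: measurable_normal_pdf.
    - by move=> x _; rewrite lee_fin (le_trans (normal_pdf_ub _ _ o0)).
  rewrite integral_cst//= mul1e lebesgue_measure_itv/= lte_fin.
  by case: ifP => _; rewrite ?EFinB// lee_fin subr_ge0.
rewrite /Phi.
have <- : (`]-oo, a]%classic : set (measurableTypeR R)) `|` `]a, b]%classic = `]-oo, b]%classic.
  by rewrite -itv_bndbnd_setU// bnd_simp.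
by apply: le_trans (prU _ _ _) _ => //; rewrite lerD2l.
Qed.

End gauss_cdf.

Lemma cdf_cvg_gauss (R : realType) (d : nat -> measure_display)
    (T : forall n : nat, measurableType (d n)) (P : forall n : nat, probability (T n) R)
    (V : forall n, T n -> R) :
  (forall n, (0 < n)%N -> [/\ measurable_fun setT (V n), integ (P n) (fun w => V n w ^+ 2) &
     mean (P n) (fun w => V n w ^+ 2) <= 1]) ->
  (forall s th, (fun n => mean (P n) (fun w => cos (s * V n w + th))) @ \oo -->
     mean (gauss 1) (fun x => cos (s * x + th))) ->
  forall t, (fun n => pr (P n) [set w | V n w <= t]) @ \oo --> Phi t.
Proof.
move=> hV hcos t.
have o0 : (1 : R) != 0 by exact: oner_neq0.
have mV n : (0 < n)%N -> measurable_fun setT (V n) by move=> /hV[].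
have htrig p : trigpoly p -> (fun n => mean (P n) (fun w => p (V n w))) @ \oo -->
    mean (gauss 1) (p : measurableTypeR R -> R).
  elim=> {p} [c s th|p p' tp hp tp' hp'].
    have mc : measurable_fun [set: R] (fun x => cos (s * x + th)).
      have := trigpoly_measurable (Trig_cos 1 s th).
      by under eq_fun do rewrite mul1r.
    have ic : integ (gauss 1) (fun x => cos (s * x + th)).
      exact: (integ_bnd (gauss 1) mc (fun x => cos_max _)).
    have hc : (fun n : nat => c) @ \oo --> c by exact: cvg_cst.
    rewrite meanZ//; apply: cvg_eq_pos (cvgM hc (hcos s th)) => n n0.
    rewrite /= meanZ//; apply: (@integ_bnd _ _ _ _ 1) => [|x]; last exact: cos_max.
    by apply: (measurableT_comp mc); exact: mV.
  have [B hB] := trigpoly_bounded tp; have [B' hB'] := trigpoly_bounded tp'.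
  have ip := integ_bnd (gauss 1) (trigpoly_measurable tp) hB.
  have ip' := integ_bnd (gauss 1) (trigpoly_measurable tp') hB'.
  rewrite meanD//; apply: cvg_eq_pos (cvgD hp hp') => n n0.
  rewrite /= meanD//.
    apply: (@integ_bnd _ _ _ _ B) => // ; apply: measurableT_comp; last exact: mV.
    exact: trigpoly_measurable.
  apply: (@integ_bnd _ _ _ _ B') => // ; apply: measurableT_comp; last exact: mV.
  exact: trigpoly_measurable.
(* Each one-sided bound spends e six times: step error and tail for V_n, convergence of the smoothed
   mean, step error and tail for the Gaussian, and the Lipschitz bound over the transition width e.
   [A] is chosen so that A^(-2) = e. *)
apply/cvgrPdist_le => eps eps0; pose e := eps / 6.
have e0 : 0 < e by rewrite divr_gt0.
pose A := Num.sqrt e^-1.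
have A0 : 0 < A by rewrite sqrtr_gt0 invr_gt0.
have A2 : A ^- 2 = e by rewrite sqr_sqrtr ?invr_ge0 ?ltW// invrK.
have mid : measurable_fun [set: measurableTypeR R] (id : measurableTypeR R -> R).
  exact: measurable_id.
have [i2 _] := gauss_moment 1 o0; rewrite muln1 in i2.
have v1 : mean (gauss 1) (fun x : measurableTypeR R => x ^+ 2) <= 1.
  by rewrite gauss_var// expr1n.
have [q [tq q01 q1 q2]] := trigpoly_step (t + e) e0 A0 e0.
have [q' [tq' q01' q1' q2']] := trigpoly_step t e0 A0 e0.
rewrite addrK in q1.
have := htrig _ tq => /cvgrPdist_le /(_ _ e0) lq.
have := htrig _ tq' => /cvgrPdist_le /(_ _ e0) lq'.
have mle (c : R) : measurable ([set x | x <= c] : set (measurableTypeR R)).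
  by exact: (measurable_itv `]-oo, c]).
have mlt (c : R) : measurable ([set x | x < c] : set (measurableTypeR R)).
  by exact: (measurable_itv `]-oo, c[).
have PhiE c : Phi c = pr (gauss 1) [set x | x <= c] by [].
have U : mean (gauss 1) (q : measurableTypeR R -> R) <= Phi t + 3 * e.
  have := smooth_le_cdf mid i2 v1 (trigpoly_measurable tq) q01 A0 e0 q2.
  rewrite A2 => /le_trans; apply.
  have : pr (gauss 1) [set x : measurableTypeR R | x < t + e] <= Phi (t + e).
    by rewrite PhiE; apply: pr_le => // x /= /ltW.
  have : Phi (t + e) <= Phi t + (t + e - t) by apply: Phi_lip; rewrite lerDl ltW.
  lra.
have L : Phi t - 3 * e <= mean (gauss 1) (q' : measurableTypeR R -> R).
  have := cdf_le_smooth mid i2 v1 (trigpoly_measurable tq') q01' A0 e0 q1'.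
  rewrite A2 -PhiE.
  have : Phi t <= Phi (t - e) + (t - (t - e)) by apply: Phi_lip; rewrite lerBlDr lerDl ltW.
  lra.
near=> n.
have n0 : (0 < n)%N by near: n; exact: nbhs_infty_gt.
have [mVn iVn vVn] := hV n n0.
have h1 := cdf_le_smooth mVn iVn vVn (trigpoly_measurable tq) q01 A0 e0 q1.
have h2 := smooth_le_cdf mVn iVn vVn (trigpoly_measurable tq') q01' A0 e0 q2'.
rewrite A2 in h1 h2.
have h3 : pr (P n) [set w | V n w < t] <= pr (P n) [set w | V n w <= t].
  apply: pr_le; [exact: measurable_lt|exact: measurable_le|].
  by move=> w /= /ltW.
have h4 : `|mean (gauss 1) (q : measurableTypeR R -> R) - mean (P n) (fun w => q (V n w))| <= e.
  by near: n.
have h5 : `|mean (gauss 1) (q' : measurableTypeR R -> R) - mean (P n) (fun w => q' (V n w))| <= e.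
  by near: n.
rewrite ler_norml in h4; rewrite ler_norml in h5; rewrite ler_norml.
have -> : eps = 6 * e by rewrite /e; field.
lra.
Unshelve. all: by end_near. Qed.

(** * A central limit theorem for rows of independent variables *)

Section taylor_bounds.
Context {R : realType}.
Implicit Types x y : R.

Let MVT0 (f df : R -> R) y : (forall x, is_derive x (1 : R) f (df x)) -> 0 <= y ->
  exists2 c, 0 <= c <= y & f y - f 0 = df c * y.
Proof.
move=> hf y0; have cf : {within `[0, y], continuous f}.
  apply: continuous_subspaceT => x.
  by apply/differentiable_continuous/derivable1_diffP; have [] := hf x.
have [c] := MVT_segment y0 (fun x _ => hf x) cf.
by rewrite in_itv subr0 => cy ->; exists c.
Qed.

Lemma norm_sin_le x : `|sin x| <= `|x|.
Proof.
wlog x0 : x / 0 <= x => [H|].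
  by have [/H//|/ltW x0] := leP 0 x; rewrite -normrN -sinN -[leRHS]normrN H// oppr_ge0.
have [c _] := MVT0 (@is_derive_sin R) x0.
rewrite sin0 subr0 => ->; rewrite normrM ler_piMl//; exact: cos_max.
Qed.

Lemma cos_sin2 x : cos x = 1 - 2 * sin (x / 2) ^+ 2.
Proof.
rewrite {1}(splitr x) -mulr2n -[in LHS]mulr_natr; rewrite mulr_natr cos_mulr2n cos2sin2.
by rewrite -mulr_natl; ring.
Qed.

Lemma norm_1cos_le x : `|1 - cos x| <= x ^+ 2 / 2.
Proof.
have -> : 1 - cos x = 2 * sin (x / 2) ^+ 2 by rewrite cos_sin2; ring.
have h : `|sin (x / 2)| ^+ 2 <= `|x / 2| ^+ 2 by rewrite lerXn2r ?nnegrE ?norm_sin_le.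
rewrite !(real_normK (num_real _)) in h.
rewrite (_ : x ^+ 2 / 2 = 2 * (x / 2) ^+ 2); last by field.
by rewrite ger0_norm; [rewrite ler_wpM2l|rewrite mulr_ge0 ?sqr_ge0].
Qed.

Lemma norm_sinB_le x : `|sin x - x| <= `|x| ^+ 3 / 2.
Proof.
wlog x0 : x / 0 <= x => [H|].
  have [/H//|/ltW x0] := leP 0 x.
  by have := H (- x); rewrite oppr_ge0 sinN normrN -opprD normrN; exact.
have d (y : R) : is_derive y (1 : R) (fun y => sin y - y) (cos y - 1).
  exact: is_deriveB.
have [c /andP[c0 cx]] := MVT0 d x0; rewrite sin0 subrr subr0 => ->.
have := norm_1cos_le c; rewrite distrC normrM (ger0_norm x0) => h.
have : c ^+ 2 <= x ^+ 2 by rewrite lerXn2r ?nnegrE.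
by have := normr_ge0 (cos c - 1); nra.
Qed.

(** By the half-angle formula the difference is 2 (y^2 - sin(y)^2) with y = x / 2, and factoring it
    reduces the bound to the cubic one for sin. *)
Lemma norm_cos_taylor x : `|cos x - (1 - x ^+ 2 / 2)| <= x ^+ 4 / 4.
Proof.
rewrite cos_sin2; set y := x / 2.
have -> : 1 - 2 * sin y ^+ 2 - (1 - x ^+ 2 / 2) = 2 * ((y - sin y) * (y + sin y)).
  by rewrite /y; field.
have h1 : `|y - sin y| <= `|y| ^+ 3 / 2 by rewrite distrC; exact: norm_sinB_le.
have h2 : `|y + sin y| <= 2 * `|y|.
  by rewrite (le_trans (ler_normD _ _))// mulr_natl mulr2n lerD2l norm_sin_le.
rewrite !normrM ger0_norm//; apply: (@le_trans _ _ (2 * ((`|y| ^+ 3 / 2) * (2 * `|y|)))).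
  by rewrite ler_wpM2l// ler_pM.
have -> : 2 * (`|y| ^+ 3 / 2 * (2 * `|y|)) = 2 * (`|y| ^+ 2) ^+ 2 by field.
rewrite (real_normK (num_real _)) /y.
have -> : 2 * ((x / 2) ^+ 2) ^+ 2 = x ^+ 4 / 8 by field.
have : 0 <= x ^+ 4 by rewrite -[4%N]/(2 * 2)%N exprM sqr_ge0.
lra.
Qed.

Lemma powR_ge_self a x : 0 <= x <= 1 -> 0 < a <= 1 -> x <= x `^ a.
Proof.
move=> /andP[x0 x1] /andP[a0 a1].
have [->|xn0] := eqVneq x 0; first by rewrite powR_ge0.
have xp : 0 < x by rewrite lt0r xn0.
rewrite /powR (negbTE xn0) -[leLHS]lnK ?posrE// ler_expR.
have : ln x <= 0 by exact: ln_le0.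
nra.
Qed.

Lemma powR_ge1 a x : 1 <= x -> 0 < a -> 1 <= x `^ a.
Proof. by move=> x1 a0; rewrite -[leLHS](powRr0 x) ler_powR// ltW. Qed.

(** Only moments of order 2 + a are available, so the cubic remainder is weakened: Taylor's bound is
    used for |x| <= 1 and the trivial linear bound beyond. The cosine is treated in the same way. *)
Lemma norm_sinB_powR a x : 0 < a <= 1 -> `|sin x - x| <= 2 * (x ^+ 2 * `|x| `^ a).
Proof.
move=> a01; have := norm_sinB_le x; have := norm_sin_le x.
rewrite -(real_normK (num_real x)); have := normr_ge0 x; set u := `|x| => u0 h1 h2.
have [u1|u1] := leP u 1.
  have := powR_ge_self (x := u) (a := a); rewrite u0 u1 => /(_ isT a01) hp.
  apply: (le_trans h2); rewrite exprS mulrC.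
  have := ler_wpM2l (sqr_ge0 u) hp; have := sqr_ge0 u; nra.
have := powR_ge1 (ltW u1) (proj1 (andP a01)) => hp.
apply: (le_trans (ler_normB _ _)); rewrite -/u.
have : u <= u ^+ 2 by rewrite expr2 ler_peMl// ltW.
by have := ler_wpM2l (sqr_ge0 u) hp; nra.
Qed.

Lemma norm_cos_taylor_powR a x : 0 < a <= 1 ->
  `|cos x - (1 - x ^+ 2 / 2)| <= x ^+ 2 * `|x| `^ a.
Proof.
move=> a01; have := norm_cos_taylor x; have := norm_1cos_le x.
have -> : x ^+ 4 = (x ^+ 2) ^+ 2 by rewrite -exprM.
rewrite -(real_normK (num_real x)); have := normr_ge0 x; set u := `|x| => u0 h1 h2.
have [u1|u1] := leP u 1.
  have := powR_ge_self (x := u) (a := a); rewrite u0 u1 => /(_ isT a01) hp.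
  apply: (le_trans h2); have := ler_wpM2l (sqr_ge0 u) hp.
  have : u ^+ 2 <= u by rewrite expr2 ler_piMl.
  have := sqr_ge0 u; set v := u ^+ 2; nra.
have := powR_ge1 (ltW u1) (proj1 (andP a01)) => hp.
have -> : cos x - (1 - u ^+ 2 / 2) = u ^+ 2 / 2 - (1 - cos x) by ring.
apply: (le_trans (ler_normB _ _)); rewrite (ger0_norm (x := u ^+ 2 / 2)); last first.
  by rewrite divr_ge0 ?sqr_ge0.
by have := ler_wpM2l (sqr_ge0 u) hp; lra.
Qed.

Lemma norm_expRN_taylor x : 0 <= x -> `|expR (- x) - (1 - x)| <= x ^+ 2.
Proof.
move=> x0; have h1 := expR_ge1Dx (- x).
rewrite ger0_norm ?subr_ge0// expRN.
have h2 := expR_ge1Dx x; have h3 : 0 < 1 + x by lra.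
have : (expR x)^-1 <= (1 + x)^-1 by rewrite lef_pV2 ?posrE// expR_gt0.
have : (1 + x)^-1 <= 1 - x + x ^+ 2.
  rewrite -[leLHS]mul1r ler_pdivrMr//.
  have -> : (1 - x + x ^+ 2) * (1 + x) = 1 + x ^+ 3 by ring.
  by rewrite lerDl exprn_ge0.
lra.
Qed.

End taylor_bounds.

Section orthogonal_sums.
Context {d} {T : measurableType d} {R : realType} (P : probability T R).
Variables (n : nat) (Y : nat -> T -> R) (v : R).
Hypotheses (mY : forall i, (1 <= i <= n)%N -> measurable_fun setT (Y i))
  (iY : forall i, (1 <= i <= n)%N -> integ P (fun w => Y i w ^+ 2))
  (Yv : forall i, (1 <= i <= n)%N -> mean P (fun w => Y i w ^+ 2) <= v)
  (orth : forall i j, (1 <= i <= n)%N -> (1 <= j <= n)%N -> (i < j)%N ->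
    mean P (fun w => Y i w * Y j w) = 0).

Let S k w := \sum_(1 <= i < k.+1) Y i w.

Let S0 w : S 0 w = 0. Proof. by rewrite /S big_geq. Qed.
Let SS k w : S k.+1 w = S k w + Y k.+1 w.
Proof. by rewrite /S big_nat_recr. Qed.

Lemma measurable_partial_sum k : (k <= n)%N ->
  measurable_fun setT (fun w => \sum_(1 <= i < k.+1) Y i w).
Proof.
elim: k => [|k IH] kn.
  by under eq_fun do rewrite big_geq//; exact: measurable_cst.
under eq_fun do rewrite big_nat_recr//=.
by apply: measurable_funD; [exact/IH/ltnW|exact: mY].
Qed.

Lemma mean_sqr_sum k : (k <= n)%N ->
  integ P (fun w => (\sum_(1 <= i < k.+1) Y i w) ^+ 2) /\
  mean P (fun w => (\sum_(1 <= i < k.+1) Y i w) ^+ 2) <= k%:R * v.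
Proof.
rewrite -/(S k).
(* Strengthened to carry orthogonality of the partial sum to all later terms; the cross term of the
   next square is one of these products. *)
suff H : (k <= n)%N -> [/\ integ P (fun w => S k w ^+ 2),
    mean P (fun w => S k w ^+ 2) <= k%:R * v &
    forall j, (k < j <= n)%N -> mean P (fun w => S k w * Y j w) = 0].
  by move=> /H[].
elim: k => [|k IH] kn.
  split.
  - by under eq_fun do rewrite S0 expr0n/=; exact: integ_cst.
  - by under eq_mean do rewrite S0 expr0n/=; rewrite mean_cst mul0r.
  - by move=> j _; under eq_mean do rewrite S0 mul0r; rewrite mean_cst.
have [i1 h1 h2] := IH (ltnW kn).
have kk : (1 <= k.+1 <= n)%N by [].
have mS : measurable_fun setT (S k) by exact/measurable_partial_sum/ltnW.
have iSY j : (1 <= j <= n)%N -> integ P (fun w => S k w * Y j w).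
  by move=> hj; apply: integM => //; [exact: mY|exact: iY].
have iYY j : (1 <= j <= n)%N -> integ P (fun w => Y k.+1 w * Y j w).
  by move=> hj; apply: integM => //; [exact: mY|exact: mY|exact: iY|exact: iY].
have E w : S k.+1 w ^+ 2 = S k w ^+ 2 + 2 * (S k w * Y k.+1 w) + Y k.+1 w ^+ 2.
  by rewrite SS; ring.
have i2 : integ P (fun w => S k w ^+ 2 + 2 * (S k w * Y k.+1 w)).
  by apply: integD => //; apply: integZ; exact: iSY.
split.
- by under eq_fun do rewrite E; apply: integD => //; exact: iY.
- under eq_mean do rewrite E.
  rewrite meanD//; last exact: iY.
  rewrite meanD//; last by apply: integZ; exact: iSY.
  rewrite meanZ; last exact: iSY.
  rewrite h2 ?ltnSn ?kn//.
  by rewrite mulr0 addr0 -natr1 mulrDl mul1r lerD// Yv.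
- move=> j /andP[kj jn]; have hj : (1 <= j <= n)%N by rewrite jn (leq_trans _ kj).
  under eq_mean do rewrite SS mulrDl.
  rewrite meanD; [|exact: iSY|exact: iYY].
  by rewrite h2 ?orth ?addr0// jn (ltnW kj).
Qed.

End orthogonal_sums.

Section clt_one_row.
Context {d} {T : measurableType d} {R : realType} (P : probability T R).
Variables (n : nat) (X : nat -> T -> R) (a K : R).
Hypothesis a01 : 0 < a <= 1.
Hypotheses (mX : forall i, (1 <= i <= n)%N -> measurable_fun setT (X i))
  (iX : forall i, (1 <= i <= n)%N -> integ P (fun w => X i w ^+ 2))
  (X0 : forall i, (1 <= i <= n)%N -> mean P (X i) = 0)
  (X1 : forall i, (1 <= i <= n)%N -> mean P (fun w => X i w ^+ 2) = 1)
  (iXa : forall i, (1 <= i <= n)%N -> integ P (fun w => X i w ^+ 2 * `|X i w| `^ a))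
  (XK : forall i, (1 <= i <= n)%N -> mean P (fun w => X i w ^+ 2 * `|X i w| `^ a) <= K).

Let S k w := \sum_(1 <= i < k.+1) X i w.

Hypothesis ind : forall k (g h : R -> R), (k < n)%N -> measurable_fun setT g ->
  measurable_fun setT h -> (forall x, `|g x| <= 1) -> (forall x, `|h x| <= 1) ->
  mean P (fun w => g (S k w) * h (X k.+1 w)) =
  mean P (fun w => g (S k w)) * mean P (fun w => h (X k.+1 w)).

Let mcos : measurable_fun [set: R] (@cos R).
Proof. exact: continuous_measurable_fun (@continuous_cos R). Qed.
Let msin : measurable_fun [set: R] (@sin R).
Proof. exact: continuous_measurable_fun (@continuous_sin R). Qed.

Lemma lyapunov_scale (t x : R) :
  (t * x) ^+ 2 * `|t * x| `^ a = t ^+ 2 * `|t| `^ a * (x ^+ 2 * `|x| `^ a).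
Proof. by rewrite normrM powRM// exprMn; ring. Qed.

Lemma mean_cos_taylor t i : (1 <= i <= n)%N ->
  `|mean P (fun w => cos (t * X i w)) - (1 - t ^+ 2 / 2)| <= t ^+ 2 * `|t| `^ a * K.
Proof.
move=> hi.
have mt : measurable_fun setT (fun w => t * X i w) by apply: measurable_funM => //; exact: mX.
have ic : integ P (fun w => cos (t * X i w)).
  by apply: (@integ_bnd _ _ _ _ 1) => [|w]; [exact: (measurableT_comp mcos)|exact: cos_max].
have i2 : integ P (fun w => (t ^+ 2 / 2) * X i w ^+ 2) by apply/integZ/iX.
have i3 : integ P (fun w => 1 - (t ^+ 2 / 2) * X i w ^+ 2).
  by apply: integB => //; exact: integ_cst.
have <- : mean P (fun w => 1 - (t ^+ 2 / 2) * X i w ^+ 2) = 1 - t ^+ 2 / 2.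
  rewrite meanB ?mean_cst ?meanZ ?X1 ?mulr1//; first exact: iX.
  exact: integ_cst.
rewrite -meanB//; apply: le_trans (mean_norm _) _; first exact: integB.
apply: (@le_trans _ _ (mean P (fun w => t ^+ 2 * `|t| `^ a * (X i w ^+ 2 * `|X i w| `^ a)))).
  apply: mean_le; [by apply/integ_norm/integB|by apply/integZ/iXa|].
  move=> w; rewrite -lyapunov_scale.
  rewrite (_ : t ^+ 2 / 2 * X i w ^+ 2 = (t * X i w) ^+ 2 / 2); last by field.
  exact: norm_cos_taylor_powR.
rewrite meanZ; last exact: iXa.
by rewrite ler_wpM2l ?XK// mulr_ge0 ?sqr_ge0// powR_ge0.
Qed.

Lemma mean_sin_taylor t i : (1 <= i <= n)%N ->
  `|mean P (fun w => sin (t * X i w))| <= 2 * (t ^+ 2 * `|t| `^ a * K).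
Proof.
move=> hi.
have mt : measurable_fun setT (fun w => t * X i w) by apply: measurable_funM => //; exact: mX.
have ic : integ P (fun w => sin (t * X i w)).
  by apply: (@integ_bnd _ _ _ _ 1) => [|w]; [exact: (measurableT_comp msin)|exact: sin_max].
have i1 : integ P (X i) by apply: integ_sqr; [exact: mX|exact: iX].
have i2 : integ P (fun w => t * X i w) by exact: integZ.
rewrite -[mean _ _]subr0 -(mulr0 t) -(X0 hi) -meanZ// -meanB//.
apply: le_trans (mean_norm _) _; first exact: integB.
apply: (@le_trans _ _ (mean P (fun w => 2 * (t ^+ 2 * `|t| `^ a) * (X i w ^+ 2 * `|X i w| `^ a)))).
  apply: mean_le; [by apply/integ_norm/integB|by apply/integZ/iXa|].
  by move=> w; rewrite -mulrA -lyapunov_scale; exact: norm_sinB_powR.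
rewrite meanZ; last exact: iXa.
rewrite -mulrA ler_wpM2l// ler_wpM2l ?XK// mulr_ge0 ?sqr_ge0// powR_ge0.
Qed.

(** One variable at a time is replaced by the Gaussian factor rho = exp(-t^2 / 2). Since rho <= 1,
    earlier errors are not enlarged and the one-step errors add up. In [eta], the 3 is one unit for
    the mean of the cosine and two for that of the sine, small because the variable is centered; t^4
    / 4 compares 1 - t^2 / 2 with rho. *)
Lemma mean_cos_sum t th k : (k <= n)%N ->
  `|mean P (fun w => cos (t * S k w + th)) - expR (- t ^+ 2 / 2) ^+ k * cos th|
  <= k%:R * (3 * (t ^+ 2 * `|t| `^ a * K) + t ^+ 4 / 4).
Proof.
set rho := expR _; set eta := 3 * _ + _.
have rho0 : 0 <= rho by exact: expR_ge0.
have rho1 : rho <= 1 by rewrite /rho expR_le1 mulNr oppr_le0 divr_ge0 ?sqr_ge0.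
elim: k th => [|k IH] th kn.
  have E w : cos (t * S 0 w + th) = cos th by rewrite /S big_geq// mulr0 add0r.
  by under eq_mean do rewrite E; rewrite mean_cst expr0 mul1r subrr normr0 mul0r.
have kk : (1 <= k.+1 <= n)%N by [].
have mS : measurable_fun setT (S k) by apply: (measurable_partial_sum mX); exact: ltnW.
have mX1 := mX kk.
have mtX : measurable_fun setT (fun w => t * X k.+1 w) by exact: measurable_funM.
have mtS : measurable_fun setT (fun w => t * S k w + th).
  by apply: measurable_funD => //; exact: measurable_funM.
have E w : cos (t * S k.+1 w + th) =
    cos (t * S k w + th) * cos (t * X k.+1 w) - sin (t * S k w + th) * sin (t * X k.+1 w).
  by rewrite /S big_nat_recr//= -cosD; congr cos; ring.
have mg (f : R -> R) b : measurable_fun setT f -> measurable_fun [set: R] (fun x => f (t * x + b)).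
  move=> mf; have ml : measurable_fun [set: R] (fun x => t * x + b).
    by apply: measurable_funD => //; exact: measurable_funM.
  exact: (measurableT_comp mf ml).
have mh (f : R -> R) : measurable_fun setT f -> measurable_fun [set: R] (fun x => f (t * x)).
  move=> mf; have ml : measurable_fun [set: R] (fun x => t * x) by exact: measurable_funM.
  exact: (measurableT_comp mf ml).
under eq_mean do rewrite E.
have ib (f g : R -> R) : measurable_fun setT f -> measurable_fun setT g ->
    (forall x, `|f x| <= 1) -> (forall x, `|g x| <= 1) ->
    integ P (fun w => f (t * S k w + th) * g (t * X k.+1 w)).
  move=> mf mg' f1 g1; apply: (@integ_bnd _ _ _ _ 1).
    by apply: measurable_funM; exact: measurableT_comp.
  by move=> w; rewrite normrM mulr_ile1.
have c1 := @cos_max R; have s1 := @sin_max R.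
rewrite meanB; [|exact: ib|exact: ib].
rewrite (@ind k (fun x => cos (t * x + th)) (fun x => cos (t * x)))//; [|exact: mg|exact: mh].
rewrite (@ind k (fun x => sin (t * x + th)) (fun x => sin (t * x)))//; [|exact: mg|exact: mh].
have {IH} := IH th (ltnW kn).
have hc := mean_cos_taylor t kk; have hs := mean_sin_taylor t kk.
have D1 : `|mean P (fun w => cos (t * S k w + th))| <= 1.
  apply: mean_norm_le => //; apply: (@integ_bnd _ _ _ _ 1) => //.
  exact: (measurableT_comp mcos).
have F1 : `|mean P (fun w => sin (t * S k w + th))| <= 1.
  apply: mean_norm_le => //; apply: (@integ_bnd _ _ _ _ 1) => //.
  exact: (measurableT_comp msin).
have hr : `|rho - (1 - t ^+ 2 / 2)| <= t ^+ 4 / 4.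
  have := @norm_expRN_taylor R (t ^+ 2 / 2); rewrite divr_ge0 ?sqr_ge0// => /(_ isT).
  by rewrite -mulNr -/rho (_ : (t ^+ 2 / 2) ^+ 2 = t ^+ 4 / 4)//; field.
move: hc hs D1 F1 hr.
set Dk := mean P (fun w => cos (t * S k w + th)); set Fk := mean P (fun w => sin (t * S k w + th)).
set c := mean P (fun w => cos (t * X k.+1 w)); set s := mean P (fun w => sin (t * X k.+1 w)).
move=> hc hs D1 F1 hr IH.
have -> : Dk * c - Fk * s - rho ^+ k.+1 * cos th =
    rho * (Dk - rho ^+ k * cos th) + (Dk * (c - rho) - Fk * s).
  by rewrite exprS; ring.
rewrite -natr1 mulrDl mul1r; apply: le_trans (ler_normD _ _) _; apply: lerD.
  by rewrite normrM (ger0_norm rho0) (le_trans _ IH)// ler_piMl.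
apply: le_trans (ler_normB _ _) _; rewrite !normrM.
have h1 : `|c - rho| <= t ^+ 2 * `|t| `^ a * K + t ^+ 4 / 4.
  rewrite (_ : c - rho = (c - (1 - t ^+ 2 / 2)) - (rho - (1 - t ^+ 2 / 2))); last ring.
  by apply: le_trans (ler_normB _ _) _; exact: lerD.
have h2 : `|Dk| * `|c - rho| <= `|c - rho| by rewrite ler_piMl.
have h3 : `|Fk| * `|s| <= `|s| by rewrite ler_piMl.
by rewrite /eta; lra.
Qed.

End clt_one_row.

Lemma cvg_inv_sqrtn (R : realType) (s : R) :
  (fun n : nat => s * (Num.sqrt n%:R)^-1) @ \oo --> 0.
Proof.
apply/cvgrPdist_le => e e0; near=> n.
have n0 : (0 < n)%N by near: n; exact: nbhs_infty_gt.
have sn0 : 0 < Num.sqrt n%:R :> R by rewrite sqrtr_gt0 ltr0n.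
rewrite sub0r normrN normrM normfV (gtr0_norm sn0) ler_pdivrMr// mulrC -ler_pdivrMr//.
have h : (`|s| / e) ^+ 2 <= n%:R by near: n; exact: nbhs_infty_ger.
by rewrite -[leLHS]ger0_norm ?divr_ge0 ?(ltW e0)// -sqrtr_sqr ler_sqrt ?ler0n.
Unshelve. all: by end_near. Qed.

Lemma cvg_powR0 (R : realType) (u : nat -> R) (a : R) : 0 < a -> u @ \oo --> 0 ->
  (fun n => `|u n| `^ a) @ \oo --> 0.
Proof.
move=> a0 /cvgrPdist_le hu; apply/cvgrPdist_le => e e0.
have e1 : 0 < e `^ a^-1 by exact: powR_gt0.
near=> n; rewrite sub0r normrN ger0_norm ?powR_ge0//.
have -> : e = (e `^ a^-1) `^ a by rewrite -powRrM mulVf ?gt_eqF// powRr1// ltW.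
have h : `|0 - u n| <= e `^ a^-1 by near: n; exact: hu.
rewrite sub0r normrN in h.
by apply: ge0_ler_powR; rewrite ?nnegrE ?powR_ge0 ?(ltW a0).
Unshelve. all: by end_near. Qed.

Lemma clt_array (R : realType) (d : nat -> measure_display)
    (T : forall n : nat, measurableType (d n)) (P : forall n : nat, probability (T n) R)
    (X : forall n, nat -> T n -> R) (a K : R) : 0 < a <= 1 ->
  (forall n i, (1 <= i <= n)%N -> measurable_fun setT (X n i)) ->
  (forall n i, (1 <= i <= n)%N -> integ (P n) (fun w => X n i w ^+ 2)) ->
  (forall n i, (1 <= i <= n)%N -> mean (P n) (X n i) = 0) ->
  (forall n i, (1 <= i <= n)%N -> mean (P n) (fun w => X n i w ^+ 2) = 1) ->
  (forall n i, (1 <= i <= n)%N -> integ (P n) (fun w => X n i w ^+ 2 * `|X n i w| `^ a)) ->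
  (forall n i, (1 <= i <= n)%N -> mean (P n) (fun w => X n i w ^+ 2 * `|X n i w| `^ a) <= K) ->
  (forall n i j, (1 <= i <= n)%N -> (1 <= j <= n)%N -> (i < j)%N ->
    mean (P n) (fun w => X n i w * X n j w) = 0) ->
  (forall n k (g h : R -> R), (k < n)%N -> measurable_fun setT g ->
    measurable_fun setT h -> (forall x, `|g x| <= 1) -> (forall x, `|h x| <= 1) ->
    mean (P n) (fun w => g (\sum_(1 <= i < k.+1) X n i w) * h (X n k.+1 w)) =
    mean (P n) (fun w => g (\sum_(1 <= i < k.+1) X n i w)) *
    mean (P n) (fun w => h (X n k.+1 w))) ->
  forall t, (fun n => pr (P n)
    [set w | (Num.sqrt n%:R)^-1 * (\sum_(1 <= i < n.+1) X n i w) <= t]) @ \oo --> Phi t.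
Proof.
move=> a01 mX iX X0 X1 iXa XK orth ind t.
have /andP[a0 a1] := a01.
apply: (cdf_cvg_gauss (V := fun n w => (Num.sqrt n%:R)^-1 * (\sum_(1 <= i < n.+1) X n i w))).
  move=> n n0.
  have X1' i : (1 <= i <= n)%N -> mean (P n) (fun w => X n i w ^+ 2) <= 1 by move=> /X1 ->.
  have [i2 h2] := @mean_sqr_sum _ _ _ (P n) n (X n) 1 (mX n) (iX n) X1' (orth n) n (leqnn n).
  have E w : ((Num.sqrt n%:R)^-1 * (\sum_(1 <= i < n.+1) X n i w)) ^+ 2 =
      n%:R^-1 * (\sum_(1 <= i < n.+1) X n i w) ^+ 2.
    by rewrite exprMn exprVn sqr_sqrtr// ler0n.
  split.
  - by apply: measurable_funM => //; exact: (measurable_partial_sum (mX n)).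
  - by under eq_fun do rewrite E; exact: integZ.
  - under eq_mean do rewrite E; rewrite meanZ//.
    by rewrite ler_pdivrMl ?ltr0n.
move=> s th; rewrite gauss_cos.
pose u (n : nat) : R := s * (Num.sqrt n%:R)^-1.
have u0 : u @ \oo --> 0 by exact: cvg_inv_sqrtn.
(* This is n times the one-step error at frequency u = s / sqrt n, simplified by n u^2 = s^2. *)
pose eta n := 3 * K * s ^+ 2 * `|u n| `^ a + s ^+ 2 / 4 * u n ^+ 2.
have eta0 : eta @ \oo --> 0.
  have -> : 0 = 3 * K * s ^+ 2 * 0 + s ^+ 2 / 4 * 0 ^+ 2 :> R by rewrite expr0n/= !mulr0 addr0.
  apply: cvgD; apply: cvgM; [exact: cvg_cst|exact: cvg_powR0|exact: cvg_cst|].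
  by rewrite expr2; apply: (cvgM u0 u0).
apply/cvgrPdist_le => e e0; near=> n.
have n0 : (0 < n)%N by near: n; exact: nbhs_infty_gt.
have nu2 : n%:R * u n ^+ 2 = s ^+ 2.
  by rewrite /u exprMn exprVn sqr_sqrtr ?ler0n// mulrCA divff ?mulr1// pnatr_eq0 -lt0n.
have := @mean_cos_sum _ _ _ (P n) n (X n) a K a01 (mX n) (iX n) (X0 n) (X1 n) (iXa n) (XK n)
  (ind n) (u n) th n (leqnn n).
rewrite -expRM_natl.
have -> : n%:R * (- u n ^+ 2 / 2) = - s ^+ 2 / 2 by rewrite -nu2; ring.
have -> : n%:R * (3 * (u n ^+ 2 * `|u n| `^ a * K) + u n ^+ 4 / 4) = eta n.
  by rewrite /eta -nu2; ring.
have -> : mean (P n) (fun w => cos (u n * (\sum_(1 <= i < n.+1) X n i w) + th)) =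
    mean (P n) (fun w => cos (s * ((Num.sqrt n%:R)^-1 * (\sum_(1 <= i < n.+1) X n i w)) + th)).
  by apply: eq_mean => w; rewrite mulrA.
rewrite distrC => /le_trans; apply.
apply: le_trans (ler_norm _) _; rewrite -normrN -sub0r.
by near: n; move/cvgrPdist_le : eta0; apply.
Unshelve. all: by end_near. Qed.

(** * Independence *)

Section self_product.
Context {d} {T : measurableType d} {R : realType}.
Variable P : probability T R.

Let m := (P \x P)%E.

HB.instance Definition _ := Measure.on m.

Let m_setT : m setT = 1%E.
Proof.
transitivity (P setT * P setT)%E; last by rewrite probability_setT mule1.
by rewrite -setXTT; exact: product_measure1E.
Qed.

HB.instance Definition _ := Measure_isProbability.Build _ _ _ m m_setT.

Definition self_product : probability (T * T)%type R := m.

End self_product.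

Section independent_mean.
Context {d} {T : measurableType d} {R : realType}.
Variable P : probability T R.
Variables X Y : T -> R.
Hypotheses (iX : integ P X) (iY : integ P Y).
Hypothesis indXY : forall A B : set R, measurable A -> measurable B ->
  P (X @^-1` A `&` Y @^-1` B) = (P (X @^-1` A) * P (Y @^-1` B))%E.

Let mX : measurable_fun setT X := integ_meas iX.
Let mY : measurable_fun setT Y := integ_meas iY.
Let Q := self_product P.
Let h (z : R * R) : R := z.1 * z.2.
Let Z' (z : T * T) : R * R := (X z.1, Y z.2).

Let mh : measurable_fun setT h.
Proof. exact: measurable_funM. Qed.

Let mZ' : measurable_fun setT Z'.
Proof.
apply: measurable_fun_pair.
  exact: (measurableT_comp mX measurable_fst).
exact: (measurableT_comp mY measurable_snd).
Qed.

Let law B : measurable B -> Q (Z' @^-1` B) = P ((fun w => (X w, Y w)) @^-1` B).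
Proof.
move=> mB; rewrite -[X in Q X]setTI -[X in P X]setTI.
pose rect : set (set (R * R)) := [set D `*` E | D in measurable & E in measurable].
apply: (@pi_lambda_law _ _ _ _ _ Q P _ _ rect) => //.
- exact: measurable_prod_measurableType.
- move=> _ _ [D1 mD1 [E1 mE1 <-]] [D2 mD2 [E2 mE2 <-]].
  exists (D1 `&` D2); first exact: measurableI.
  by exists (E1 `&` E2); [exact: measurableI|rewrite setXI].
- exact: measurable_fun_pair.
- by rewrite !probability_setT.
- move=> _ [D mD [E mE <-]]; rewrite !setTI.
  transitivity (P (X @^-1` D) * P (Y @^-1` E))%E; last by rewrite -indXY.
  rewrite (_ : Z' @^-1` _ = (X @^-1` D) `*` (Y @^-1` E))//.
  by rewrite [LHS]product_measure1E// -[X in measurable X]setTI; [exact: mX|exact: mY].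
Qed.

Let iQ : integ Q (h \o Z').
Proof.
have mf : measurable_fun setT (EFin \o (h \o Z')).
  exact/measurable_EFinP/measurableT_comp.
apply/(integrable12ltyP P P mf) => /=.
have fY : (\int[P]_y `|(Y y)%:E| < +oo)%E by case/integrableP: iY.
have fX : (\int[P]_y `|(X y)%:E| < +oo)%E by case/integrableP: iX.
have E x : (\int[P]_y `|(h (Z' (x, y)))%:E| = `|(X x)%:E| * \int[P]_y `|(Y y)%:E|)%E.
  rewrite -ge0_integralZl//; last exact/measurableT_comp/measurable_EFinP.
  by apply: eq_integral => y _; rewrite /h /Z'/= normrM EFinM.
rewrite (eq_integral (fun x => `|(X x)%:E| * \int[P]_y `|(Y y)%:E|)%E); last by move=> x _; exact: E.
rewrite ge0_integralZr//; last 2 first.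
- exact/measurableT_comp/measurable_EFinP.
- exact: integral_ge0.
by apply: lte_mul_pinfty; rewrite ?integral_ge0// ge0_fin_numE// integral_ge0.
Qed.

(** By independence (X, Y) has the law of (X z.1, Y z.2) under the product measure, where Fubini
    factors the mean and also gives integrability of the product from first moments alone. *)
Lemma mean_indep : integ P (fun w => X w * Y w) /\
  mean P (fun w => X w * Y w) = mean P X * mean P Y.
Proof.
have mZ : measurable_fun setT (fun w => (X w, Y w)) by exact: measurable_fun_pair.
have [H1 H2] := mean_law mZ' mZ law mh.
split; first exact: H1 iQ.
rewrite -[LHS]H2 meanE -(integral12_prod_meas1 iQ) /=.
have E x : (\int[P]_y (h (Z' (x, y)))%:E = (X x)%:E * (mean P Y)%:E)%E.
  rewrite -(mean_EFin iY) -integralZl//.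
rewrite (eq_integral (fun x => (X x)%:E * (mean P Y)%:E)%E); last by move=> x _; exact: E.
by rewrite integralZr// (mean_EFin iX).
Qed.

End independent_mean.

Section independent_generated.
Context {d} {T : measurableType d} {R : realType}.
Variable P : probability T R.

Lemma indep_pi_lambda (C : set (set T)) (B : set T) :
  C `<=` measurable -> setI_closed C -> measurable B ->
  (forall A, C A -> P (A `&` B) = (P A * P B)%E) ->
  forall A, <<s C >> A -> P (A `&` B) = (P A * P B)%E.
Proof.
move=> Cm CI mB H.
have sCm : <<s C >> `<=` measurable.
  by apply: smallest_sub => //; exact: sigma_algebra_measurable.
pose T0 := g_sigma_algebraType C.
apply: (@dynkin_induction _ T0 C (fun A => P (A `&` B) = (P A * P B)%E)) => //.
- by rewrite setTI probability_setT mul1e.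
- move=> S /sCm mS IH.
  have -> : ~` S `&` B = B `\` (S `&` B) by rewrite setDE setCI setIUr setICr setU0 setIC.
  rewrite measureD//; [|exact: measurableI|by rewrite (le_lt_trans (probability_le1 P mB)) ?ltry].
  rewrite [X in (_ - P X)%E](_ : _ = S `&` B); last by rewrite setICA setIid.
  rewrite [X in (_ - X)%E]IH probability_setC// (prE P mB) (prE P mS).
  rewrite [X in (X - _)%E](_ : _ = (pr P B)%:E); last exact: (prE P mB).
  transitivity (((1 - pr P S) * pr P B)%:E); last by rewrite EFinM EFinB.
  by rewrite -EFinM -EFinB; congr EFin; ring.
- move=> F mF tF IH; have mF' n : @measurable d T (F n) by apply: sCm; exact: mF.
  rewrite setI_bigcupl measure_bigcup//=; last 2 first.
  + by move=> n _; exact: measurableI.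
  + exact: trivIset_setIr.
  rewrite measure_bigcup//= (prE P mB) muleC -nneseriesZl//.
  by apply: eq_eseriesr => n _; rewrite -(prE P mB) muleC; exact: IH.
Qed.

Lemma indep_pi_lambda2 (C D : set (set T)) :
  C `<=` measurable -> setI_closed C -> D `<=` measurable -> setI_closed D ->
  (forall A B, C A -> D B -> P (A `&` B) = (P A * P B)%E) ->
  indep_pair P <<s C >> <<s D >>.
Proof.
move=> Cm CI Dm DI H A B sA sB.
have sCm : <<s C >> `<=` measurable.
  by apply: smallest_sub => //; exact: sigma_algebra_measurable.
rewrite setIC muleC; apply: (indep_pi_lambda Dm DI) sB => //; first exact: sCm.
move=> {}B hB; rewrite setIC muleC; apply: (indep_pi_lambda Cm CI) sA => //.
- exact: Dm.
- by move=> {}A hA; exact: H.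
Qed.

Lemma mean_indep_pair (F G : set (set T)) (X Y : T -> R) :
  indep_pair P F G ->
  (forall B, measurable B -> F (X @^-1` B)) -> (forall B, measurable B -> G (Y @^-1` B)) ->
  integ P X -> integ P Y -> integ P (fun w => X w * Y w) /\
  mean P (fun w => X w * Y w) = mean P X * mean P Y.
Proof.
move=> ind FX GY iX iY; apply: mean_indep => // A B mA mB.
by apply: ind; [exact: FX|exact: GY].
Qed.

End independent_generated.

Section sigma_algebra_closure.
Context {T : pointedType}.
Variable F : set (set T).
Hypothesis sF : sigma_algebra setT F.

Lemma sigma_algebraE : <<s F >> = F.
Proof.
apply/seteqP; split; last exact: sub_sigma_algebra.
by apply: smallest_sub.
Qed.

Lemma sigma_algebraT : F setT.
Proof. by rewrite -sigma_algebraE; exact: (@measurableT _ (g_sigma_algebraType F)). Qed.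

Lemma sigma_algebraI A B : F A -> F B -> F (A `&` B).
Proof.
rewrite -sigma_algebraE => hA hB.
exact: (@measurableI _ (g_sigma_algebraType F) A B hA hB).
Qed.

Lemma sigma_algebra_bigcap (s : seq nat) (A : nat -> set T) :
  (forall i, i \in s -> F (A i)) -> F (\bigcap_(i in [set` s]) A i).
Proof.
elim: s => [|i s IH] h.
  rewrite (_ : \bigcap_(i in _) _ = setT); first exact: sigma_algebraT.
  by apply/seteqP; split.
rewrite (_ : \bigcap_(j in _) _ = A i `&` \bigcap_(j in [set` s]) A j).
  apply: sigma_algebraI; first by apply: h; rewrite inE eqxx.
  by apply: IH => j js; apply: h; rewrite inE js orbT.
apply/seteqP; split => [w h1|w [h1 h2] j /=].
  by split=> [|j /= js]; apply: h1; rewrite /= inE ?eqxx// js orbT.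
by rewrite inE => /orP[/eqP->//|js]; exact: h2.
Qed.

End sigma_algebra_closure.

Section blocks.
Context {d} {T : measurableType d} {R : realType}.
Variables (P : probability T R) (N : nat).
Variables (F H : nat -> set (set T)) (FX HU : set (set T)).
Hypotheses (sF : forall i, sigma_algebra setT (F i)) (sH : forall i, sigma_algebra setT (H i))
  (sFX : sigma_algebra setT FX) (sHU : sigma_algebra setT HU).
Hypotheses (FXm : FX `<=` measurable) (HUm : HU `<=` measurable).
Hypotheses (FFX : forall i, (1 <= i <= N)%N -> F i `<=` FX)
  (HHU : forall i, (1 <= i <= N)%N -> H i `<=` HU).
Hypotheses (indF : indep_family P (iota 1 N) F) (indH : indep_family P (iota 1 N) H)
  (indFH : indep_pair P FX HU).

Let idx := iota 1 N.
Let idxP i : (i \in idx) = (1 <= i <= N)%N.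
Proof. by rewrite mem_iota add1n ltnS. Qed.

Definition block_gen (I : set nat) : set (set T) :=
  [set A | exists2 i, I i & F i A \/ H i A].

(** A pi-system generating the block. Every intersection runs over all indices 1..N, with [setT]
    outside I, so that it matches the shape of [indep_family] and two blocks share one index set. *)
Let block_pi (I : set nat) : set (set T) := [set S | exists A D : nat -> set T,
  [/\ forall i, F i (A i) /\ H i (D i), forall i, ~ I i -> A i = setT /\ D i = setT &
     S = (\bigcap_(i in [set` idx]) A i) `&` (\bigcap_(i in [set` idx]) D i)]].

Let block_piI I : setI_closed (block_pi I).
Proof.
move=> _ _ [A [D [h1 h2 ->]]] [A' [D' [h1' h2' ->]]].
exists (fun i => A i `&` A' i), (fun i => D i `&` D' i); split.
- move=> i; have [a1 a2] := h1 i; have [b1 b2] := h1' i.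
  by split; exact: sigma_algebraI.
- by move=> i Ii; have [-> ->] := h2 i Ii; have [-> ->] := h2' i Ii; rewrite !setTI.
- by rewrite !bigcapI setIACA.
Qed.

Let capA (A : nat -> set T) : (forall i, F i (A i)) -> FX (\bigcap_(i in [set` idx]) A i).
Proof.
move=> h; apply: (sigma_algebra_bigcap sFX) => i; rewrite idxP => hi.
by apply: (FFX hi); exact: h.
Qed.

Let capD (A : nat -> set T) : (forall i, H i (A i)) -> HU (\bigcap_(i in [set` idx]) A i).
Proof.
move=> h; apply: (sigma_algebra_bigcap sHU) => i; rewrite idxP => hi.
by apply: (HHU hi); exact: h.
Qed.

Let block_pim I : block_pi I `<=` measurable.
Proof.
move=> _ [A [D [h1 h2 ->]]]; apply: measurableI.
  by apply: FXm; apply: capA => i; have [] := h1 i.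
by apply: HUm; apply: capD => i; have [] := h1 i.
Qed.

Let block_gen_pi I : I `<=` [set i | (1 <= i <= N)%N] -> <<s block_gen I >> `<=` <<s block_pi I >>.
Proof.
move=> IN; apply: smallest_sub; first exact: smallest_sigma_algebra.
move=> A [i Ii FHA]; apply: sub_sigma_algebra.
(* A generator sits in slot i of exactly one of the two families; the flag [b] says whether this
   family is the one. *)
pose B (b : Prop) j := if (j == i) && `[< b >] then A else setT.
have h0 (b : Prop) j : ~ I j -> B b j = setT.
  by move=> nI; rewrite /B; case: eqP => // ji; rewrite ji in nI.
have cap (b : Prop) : b -> \bigcap_(j in [set` idx]) B b j = A.
  move=> hb; apply/seteqP; split => [w /(_ i)|w Aw j _].
    by rewrite /= idxP /B eqxx /= asboolT//; apply; exact: IN.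
  by rewrite /B; case: ifP.
have cap0 (b : Prop) : ~ b -> \bigcap_(j in [set` idx]) B b j = setT.
  by move=> hb; apply/seteqP; split => // w _ j _; rewrite /B asboolF// andbF.
have BF j : B False j = setT by rewrite /B asboolF// andbF.
have BT j : B True j = if j == i then A else setT by rewrite /B asboolT// andbT.
have [FA|nFA] := pselect (F i A).
  exists (B True), (B False); split.
  - move=> j; rewrite BT BF; split; last exact: sigma_algebraT.
    by case: eqP => [->//|_]; exact: sigma_algebraT.
  - by move=> j nI; rewrite !h0.
  - by rewrite (cap True)// (cap0 False)// setIT.
have HA : H i A by case: FHA.
exists (B False), (B True); split.
- move=> j; rewrite BT BF; split; first exact: sigma_algebraT.
  by case: eqP => [->//|_]; exact: sigma_algebraT.
- by move=> j nI; rewrite !h0.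
- by rewrite (cap True)// (cap0 False)// setTI.
Qed.

Lemma block_gen_measurable I : I `<=` [set i | (1 <= i <= N)%N] ->
  <<s block_gen I >> `<=` measurable.
Proof.
move=> IN; apply: smallest_sub; first exact: sigma_algebra_measurable.
move=> A [i /IN hi [FA|HA]]; first by apply: FXm; exact: FFX FA.
by apply: HUm; exact: HHU HA.
Qed.

(** The assumptions concern the F's, the H's, and the F's against the H's separately. On the
    pi-systems all three split probabilities into products over indices, and since I and J are
    disjoint, at each index one of the two events is [setT]; the factors therefore separate. *)
Lemma block_indep (I J : set nat) :
  I `<=` [set i | (1 <= i <= N)%N] -> J `<=` [set i | (1 <= i <= N)%N] ->
  (forall i, I i -> ~ J i) -> indep_pair P <<s block_gen I >> <<s block_gen J >>.
Proof.
move=> IN JN IJ A B /(block_gen_pi IN) sA /(block_gen_pi JN) sB.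
apply: (indep_pi_lambda2 (@block_pim I) (@block_piI I) (@block_pim J) (@block_piI J)) sA sB.
move=> {}A {}B [A1 [D1 [h1 h2 ->]]] [A2 [D2 [g1 g2 ->]]].
have PI (a1 a2 : set T) : a1 = setT \/ a2 = setT -> P (a1 `&` a2) = (P a1 * P a2)%E.
  by move=> [->|->]; rewrite ?setTI ?setIT probability_setT ?mul1e ?mule1.
have IJi i : ~ I i \/ ~ J i by have [/IJ|] := pselect (I i); [right|left].
have F1 i : F i (A1 i) by have [] := h1 i.
have F2 i : F i (A2 i) by have [] := g1 i.
have H1 i : H i (D1 i) by have [] := h1 i.
have H2 i : H i (D2 i) by have [] := g1 i.
transitivity (P ((\bigcap_(i in [set` idx]) (A1 i `&` A2 i)) `&`
    (\bigcap_(i in [set` idx]) (D1 i `&` D2 i)))); first by rewrite setIACA !bigcapI.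
rewrite indFH; [|by apply: capA => i; exact: sigma_algebraI|by apply: capD => i; exact: sigma_algebraI].
rewrite indFH; [|exact: capA|exact: capD].
rewrite indFH; [|exact: capA|exact: capD].
rewrite (indF (fun i _ => F1 i)) (indF (fun i _ => F2 i)).
rewrite (indF (fun i _ => sigma_algebraI (sF i) (F1 i) (F2 i))).
rewrite (indH (fun i _ => H1 i)) (indH (fun i _ => H2 i)).
rewrite (indH (fun i _ => sigma_algebraI (sH i) (H1 i) (H2 i))).
rewrite [RHS]muleACA; congr (_ * _)%E; rewrite -big_split /=.
  apply: eq_bigr => i _; apply: PI.
  by have [nI|nJ] := IJi i; [left; have [] := h2 i nI|right; have [] := g2 i nJ].
apply: eq_bigr => i _; apply: PI.
by have [nI|nJ] := IJi i; [left; have [] := h2 i nI|right; have [] := g2 i nJ].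
Qed.

End blocks.

(** * Quadratic forms and spectral bounds *)

Section quadratic_forms.
Context {R : realType}.

Lemma dotpC p (u v : 'cV[R]_p) : dotp u v = dotp v u.
Proof. by apply: eq_bigr => k _; rewrite mulrC. Qed.

Lemma dotpDl p (u v w : 'cV[R]_p) : dotp (u + v) w = dotp u w + dotp v w.
Proof. by rewrite -big_split; apply: eq_bigr => k _; rewrite mxE mulrDl. Qed.

Lemma dotpZl p a (u w : 'cV[R]_p) : dotp (a *: u) w = a * dotp u w.
Proof. by rewrite mulr_sumr; apply: eq_bigr => k _; rewrite mxE mulrA. Qed.

Lemma dotpDr p (u v w : 'cV[R]_p) : dotp u (v + w) = dotp u v + dotp u w.
Proof. by rewrite dotpC dotpDl !(dotpC _ u). Qed.

Lemma dotpZr p a (u w : 'cV[R]_p) : dotp u (a *: w) = a * dotp u w.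
Proof. by rewrite dotpC dotpZl dotpC. Qed.

Lemma dotpBr p (u v w : 'cV[R]_p) : dotp u (v - w) = dotp u v - dotp u w.
Proof. by rewrite -scaleN1r dotpDr dotpZr mulN1r. Qed.

Lemma dotp0l p (u : 'cV[R]_p) : dotp 0 u = 0.
Proof. by rewrite -(scale0r 0) dotpZl mul0r. Qed.

Lemma dotp_ge0 p (u : 'cV[R]_p) : 0 <= dotp u u.
Proof. by apply: sumr_ge0 => k _; rewrite -expr2 sqr_ge0. Qed.

Lemma dotp_eq0 p (u : 'cV[R]_p) : (dotp u u == 0) = (u == 0).
Proof.
apply/eqP/eqP => [h|->]; last by rewrite dotp0l.
apply/matrixP => k j; rewrite (ord1 j) mxE.
have hk : u k 0 * u k 0 = 0.
  by have /psumr_eq0P := h; apply => // i _; rewrite -expr2 sqr_ge0.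
by apply/eqP; rewrite -sqrf_eq0 expr2 hk.
Qed.

Lemma dotp_gt0 p (u : 'cV[R]_p) : u != 0 -> 0 < dotp u u.
Proof. by move=> u0; rewrite lt0r dotp_eq0 u0 dotp_ge0. Qed.

Lemma dotpE p (u v : 'cV[R]_p) : dotp u v = (u^T *m v) 0 0.
Proof. by rewrite mxE; apply: eq_bigr => k _; rewrite mxE. Qed.

Lemma dotp_mulmx p (A : 'M[R]_p) (u v : 'cV[R]_p) : dotp u (A *m v) = dotp (A^T *m u) v.
Proof. by rewrite !dotpE trmx_mul trmxK mulmxA. Qed.

Lemma dotp_sym p (A : 'M[R]_p) (u v : 'cV[R]_p) : A^T = A ->
  dotp u (A *m v) = dotp v (A *m u).
Proof. by move=> AT; rewrite dotp_mulmx AT dotpC. Qed.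

Lemma dotp_qf_lin p (A : 'M[R]_p) (u v : 'cV[R]_p) (s t : R) : A^T = A ->
  dotp (s *: u + t *: v) (A *m (s *: u + t *: v)) =
  s ^+ 2 * dotp u (A *m u) + 2 * (s * t) * dotp u (A *m v) + t ^+ 2 * dotp v (A *m v).
Proof.
move=> AT; rewrite mulmxDr -!scalemxAr dotpDl !dotpDr !dotpZl !dotpZr (dotp_sym v u AT).
by ring.
Qed.

Lemma psd_cauchy p (B : 'M[R]_p) (u v : 'cV[R]_p) : B^T = B ->
  (forall x : 'cV[R]_p, 0 <= dotp x (B *m x)) ->
  dotp u (B *m v) ^+ 2 <= dotp u (B *m u) * dotp v (B *m v).
Proof.
move=> BT B0; have h s t := B0 (s *: u + t *: v).
have {}h s t : 0 <= s ^+ 2 * dotp u (B *m u) + 2 * (s * t) * dotp u (B *m v) +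
    t ^+ 2 * dotp v (B *m v) by rewrite -dotp_qf_lin.
move: (B0 u) (B0 v) h; set a := dotp u (B *m u); set b := dotp u (B *m v).
set c := dotp v (B *m v) => a0 c0 h.
have [c1|c1] := eqVneq c 0; last first.
  have cp : 0 < c by rewrite lt0r c1.
  have := h c (- b); have -> : c ^+ 2 * a + 2 * (c * - b) * b + (- b) ^+ 2 * c =
    c * (a * c - b ^+ 2) by ring.
  by rewrite pmulr_rge0// subr_ge0.
rewrite c1 mulr0; have [->|b1] := eqVneq b 0; first by rewrite expr0n.
(* When c = 0 and b != 0 the form is affine in t, and this choice makes it equal to -1. *)
have := h 1 (- (a + 1) / (2 * b)).
have -> : 1 ^+ 2 * a + 2 * (1 * (- (a + 1) / (2 * b))) * b +
    (- (a + 1) / (2 * b)) ^+ 2 * c = -1 by rewrite c1; field.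
by rewrite oppr_ge0 ler10.
Qed.

(** K is the squared Frobenius norm plus 1, which keeps it positive for the zero matrix. *)
Lemma matrix_bound p q (M : 'M[R]_(p, q)) : exists2 K : R, 0 < K &
  forall v : 'cV[R]_q, dotp (M *m v) (M *m v) <= K * dotp v v.
Proof.
have cs (u v : 'cV[R]_q) : dotp u v ^+ 2 <= dotp u u * dotp v v.
  have := @psd_cauchy _ 1%:M u v (trmx1 _ _); rewrite !mul1mx; apply.
  by move=> x; rewrite mul1mx dotp_ge0.
exists (\sum_i dotp (row i M)^T (row i M)^T + 1).
  by rewrite ltr_wpDl// sumr_ge0// => i _; exact: dotp_ge0.
move=> v; rewrite mulrDl mul1r mulr_suml.
apply: (@le_trans _ _ (\sum_i dotp (row i M)^T (row i M)^T * dotp v v)); last first.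
  by rewrite lerDl dotp_ge0.
apply: ler_sum => i _; apply: le_trans (cs _ _).
rewrite -expr2 (_ : (M *m v) i 0 = dotp (row i M)^T v)//.
by rewrite mxE; apply: eq_bigr => k _; rewrite !mxE.
Qed.

(** No compactness of the sphere is used. Let a be the supremum of the form on unit vectors, so that
    B = a I - A is semidefinite. If B were invertible, Cauchy-Schwarz for the form B at v and w =
    B^(-1) v would give 1 <= (a - <v, A v>) <w, v> with <w, v> bounded, so the form would stay below
    a by a fixed amount. Hence B is singular and a is an eigenvalue. *)
Lemma rayleigh_max p (A : 'M[R]_p.+1) : A^T = A -> exists2 a : R, eigenvalue A a &
  forall v : 'cV[R]_p.+1, dotp v (A *m v) <= a * dotp v v.
Proof.
move=> AT.
pose E := [set dotp v (A *m v) | v in [set v : 'cV[R]_p.+1 | dotp v v = 1]].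
have E0 : E !=set0.
  exists (dotp (delta_mx 0 0) (A *m delta_mx 0 0)); exists (delta_mx 0 0) => //=.
  rewrite /dotp (bigD1 ord0)//= big1 => [|k k0]; rewrite !mxE ?eqxx ?mulr1 ?addr0//.
  by rewrite (negbTE k0) mulr0.
have amgm (u v : 'cV[R]_p.+1) : dotp u v <= (dotp u u + dotp v v) / 2.
  have := dotp_ge0 (u - v); rewrite dotpBr !(dotpC (u - v)) !dotpBr (dotpC v u).
  lra.
have Eub : has_ubound E.
  have [K K0 hK] := matrix_bound A; exists ((1 + K) / 2) => _ [v /= v1 <-].
  have := amgm v (A *m v); have := hK v; rewrite v1; lra.
pose a := sup E.
have ha (v : 'cV[R]_p.+1) : dotp v (A *m v) <= a * dotp v v.
  have [->|v0] := eqVneq v 0; first by rewrite !dotp0l mulr0.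
  have vp := dotp_gt0 v0; pose l := (Num.sqrt (dotp v v))^-1.
  have l2 : l ^+ 2 = (dotp v v)^-1 by rewrite exprVn sqr_sqrtr ?ltW.
  have : dotp (l *: v) (A *m (l *: v)) <= a.
    apply: ub_le_sup => //; exists (l *: v) => //=.
    by rewrite dotpZl dotpZr mulrA -expr2 l2 mulVf// gt_eqF.
  by rewrite -scalemxAr dotpZl dotpZr mulrA -expr2 l2 ler_pdivrMl// mulrC.
exists a => //.
pose B := a%:M - A.
have BE (u v : 'cV[R]_p.+1) : dotp u (B *m v) = a * dotp u v - dotp u (A *m v).
  by rewrite mulmxBl dotpBr mul_scalar_mx dotpZr.
have BT : B^T = B by rewrite /B linearB/= tr_scalar_mx AT.
have B0 (v : 'cV[R]_p.+1) : 0 <= dotp v (B *m v) by rewrite BE subr_ge0.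
have [Bu|Bu] := boolP (B \in unitmx); last first.
  rewrite /eigenvalue /eigenspace kermx_eq0 row_free_unit.
  have -> : A - a%:M = -1 *: B by rewrite scaleN1r /B opprB.
  by rewrite unitmxZ// unitrN1.
exfalso.
have [K K0 hK] := matrix_bound (invmx B).
have lb (v : 'cV[R]_p.+1) : dotp v v = 1 -> dotp v (A *m v) <= a - 2 / (K + 1).
  move=> v1; pose w := invmx B *m v.
  have Bw : B *m w = v by rewrite mulmxA mulmxV// mul1mx.
  have := psd_cauchy v w BT B0; rewrite Bw v1 expr1n BE v1 mulr1.
  have := amgm w v; have := hK v; rewrite -/w v1 mulr1.
  set x := dotp w w; set y := dotp w v; set z := dotp v (A *m v) => h1 h2 h3.
  have za : 0 <= a - z by have := ha v; rewrite v1 mulr1 subr_ge0.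
  have h4 : y <= (K + 1) / 2 by lra.
  have h5 : 1 <= (a - z) * ((K + 1) / 2) by apply: le_trans h3 _; rewrite ler_wpM2l.
  have Kp : 0 < K + 1 by lra.
  have : 2 / (K + 1) <= a - z by rewrite ler_pdivrMr//; lra.
  lra.
have : a <= a - 2 / (K + 1).
  by apply: sup_le_ub => // _ [v /= v1 <-]; exact: lb.
have : 0 < 2 / (K + 1) by rewrite divr_gt0// addr_gt0.
lra.
Qed.

(** [lambda_min] and [lambda_max] bound the form once its extreme values are known to be
    eigenvalues: [rayleigh_max] is applied to A and to -A. The resulting bounds on the form also
    show that the set of eigenvalues is bounded, without which [inf] and [sup] would say nothing. *)
Lemma eigenvalue_bounds p (A : 'M[R]_p.+1) (c C : R) : A^T = A ->
  c <= lambda_min A -> lambda_max A <= C ->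
  forall v : 'cV[R]_p.+1, c * dotp v v <= dotp v (A *m v) <= C * dotp v v.
Proof.
move=> AT cA AC v.
have eigv b : eigenvalue A b -> exists2 w : 'cV[R]_p.+1, w != 0 & A *m w = b *: w.
  move=> /eigenvalueP[w wA w0]; exists w^T.
    by apply: contra_neq w0 => h; rewrite -[w]trmxK h trmx0.
  by rewrite -[LHS]trmxK trmx_mul trmxK AT wA linearZ.
apply/andP; split.
- have NT : (- A)^T = - A by rewrite linearN/= AT.
  have [b eb hb] := rayleigh_max NT.
  have hb' (u : 'cV[R]_p.+1) : - b * dotp u u <= dotp u (A *m u).
    by have := hb u; rewrite mulNmx -scaleN1r dotpZr; lra.
  have eb' : eigenvalue A (- b).
    move/eigenvalueP: eb => [w wA w0]; apply/eigenvalueP; exists w => //.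
    by rewrite scaleNr -wA mulmxN opprK.
  apply: le_trans (hb' v); rewrite ler_wpM2r ?dotp_ge0// (le_trans cA)//.
  apply: ge_inf => //; exists (- b) => x /= /eigv[w w0 Aw].
  by have := hb' w; rewrite Aw dotpZr ler_pM2r// dotp_gt0.
- have [b eb hb] := rayleigh_max AT.
  apply: le_trans (hb v) _; rewrite ler_wpM2r ?dotp_ge0// (le_trans _ AC)//.
  apply: ub_le_sup => //; exists b => x /= /eigv[w w0 Aw].
  by have := hb w; rewrite Aw dotpZr ler_pM2r// dotp_gt0.
Qed.

(** The vector (1, -gamma): it makes the residual a linear functional of x, treated like any
    other. *)
Definition resid_vec q (gamma : 'cV[R]_q) : 'cV[R]_q.+1 :=
  \col_k (if unlift ord0 k is Some j then - gamma j 0 else 1).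

Lemma resid_vec0 q (gamma : 'cV[R]_q) : resid_vec gamma ord0 0 = 1.
Proof. by rewrite mxE unlift_none. Qed.

Lemma resid_vec_lift q (gamma : 'cV[R]_q) j : resid_vec gamma (lift ord0 j) 0 = - gamma j 0.
Proof. by rewrite mxE liftK. Qed.

Lemma node_residE q (gamma : 'cV[R]_q) v : node_resid gamma v = dotp (resid_vec gamma) v.
Proof.
rewrite /node_resid /dotp big_ord_recl resid_vec0 mul1r; congr (_ + _).
rewrite -sumrN; apply: eq_bigr => j _; rewrite resid_vec_lift mxE mulNr//.
Qed.

Section schur_complement.
Context {q : nat}.
Variables (A : 'M[R]_q.+1) (c C : R).
Hypotheses (AT : A^T = A) (c0 : 0 < c)
  (Ac : forall v : 'cV[R]_q.+1, c * dotp v v <= dotp v (A *m v) <= C * dotp v v).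

Let M : 'M[R]_q := \matrix_(j, k) A (lift ord0 j) (lift ord0 k).
Let b : 'cV[R]_q := \col_j A (lift ord0 j) ord0.
Let gamma := invmx M *m b.
Let w := resid_vec gamma.

Let Munit : M \in unitmx.
Proof.
rewrite -row_free_unit -kermx_eq0; apply/eqP/row_matrixP => i; rewrite row0.
set u := row i (kermx M).
have uM : u *m M = 0 by rewrite /u -row_mul mulmx_ker row0.
(* A kernel vector of the submatrix, padded with a zero, makes the form of A vanish, so definiteness
   forces it to be 0. *)
pose v : 'cV[R]_q.+1 := \col_k (if unlift ord0 k is Some j then u 0 j else 0).
have v0 : v ord0 0 = 0 by rewrite mxE unlift_none.
have vl j : v (lift ord0 j) 0 = u 0 j by rewrite mxE liftK.
have AvE j : (A *m v) j 0 = \sum_k A j (lift ord0 k) * u 0 k.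
  by rewrite mxE big_ord_recl v0 mulr0 add0r; apply: eq_bigr => k _; rewrite vl.
have uME k : (u *m M) 0 k = \sum_j u 0 j * A (lift ord0 j) (lift ord0 k).
  by rewrite mxE; apply: eq_bigr => j _; rewrite [M j k]mxE.
have : dotp v (A *m v) = 0.
  rewrite /dotp big_ord_recl v0 mul0r add0r.
  transitivity (\sum_k (u *m M) 0 k * u 0 k); last by rewrite big1// => k _; rewrite uM mxE mul0r.
  under [RHS]eq_bigr do rewrite uME mulr_suml.
  rewrite exchange_big /=; apply: eq_bigr => j _; rewrite vl AvE mulr_sumr.
  by apply: eq_bigr => k _; rewrite mulrA.
move=> vAv; have /andP[h _] := Ac v; rewrite vAv in h.
have v00 : v = 0.
  apply/eqP; rewrite -dotp_eq0 eq_le dotp_ge0 andbT.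
  by rewrite -(pmulr_rle0 _ c0).
apply/matrixP => k j; rewrite (ord1 k) [RHS]mxE -vl v00 mxE//.
Qed.

(** The normal equations of the regression: [A *m w] vanishes outside the first coordinate. *)
Lemma resid_vec_orth (v : 'cV[R]_q.+1) :
  dotp v (A *m w) = v ord0 0 * dotp w (A *m w).
Proof.
have Aw j : (A *m w) (lift ord0 j) 0 = 0.
  rewrite mxE big_ord_recl resid_vec0 mulr1.
  have : (M *m gamma) j 0 = b j 0 by rewrite /gamma mulKVmx.
  rewrite !mxE => <-; rewrite -big_split /= big1// => k _.
  by rewrite resid_vec_lift mxE mulrN subrr.
have E (x : 'cV[R]_q.+1) : dotp x (A *m w) = x ord0 0 * (A *m w) ord0 0.
  by rewrite /dotp big_ord_recl big1 ?addr0// => j _; rewrite Aw mulr0.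
by rewrite !E resid_vec0 mul1r.
Qed.

(** Below, because the first entry of w is 1 and so |w| >= 1. Above, because a residual has at most
    the variance of the regressed coordinate: positivity of the form at e - w, with [resid_vec_orth]
    at the first unit vector e. *)
Lemma resid_vec_bounds : c <= dotp w (A *m w) <= C.
Proof.
have w1 : 1 <= dotp w w.
  rewrite /dotp big_ord_recl resid_vec0 mulr1 lerDl sumr_ge0// => j _.
  by rewrite -expr2 sqr_ge0.
have /andP[h _] := Ac w; apply/andP; split.
  by apply: le_trans h; rewrite ler_peMr// ltW.
pose e : 'cV[R]_q.+1 := delta_mx ord0 0.
have e0 : e ord0 0 = 1 by rewrite mxE !eqxx.
have ee : dotp e e = 1.
  rewrite /dotp (bigD1 ord0)//= big1 => [|k k0]; rewrite !mxE ?eqxx ?mulr1 ?addr0//.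
  by rewrite (negbTE k0) mulr0.
have h1 := resid_vec_orth e; rewrite e0 mul1r in h1.
have /andP[_ h2] := Ac e; rewrite ee mulr1 in h2.
have /andP[h3 _] := Ac (1 *: e + -1 *: w); rewrite dotp_qf_lin// h1 in h3.
have := mulr_ge0 (ltW c0) (dotp_ge0 (1 *: e + -1 *: w)); lra.
Qed.

End schur_complement.

End quadratic_forms.

(** * The single-index model at a fixed sample size *)

Section one_row_model.
Context {d} {T : measurableType d} {R : realType} {q : nat}.
Variables (P : probability T R) (n : nat) (Sigma : 'M[R]_q.+1) (tau : 'cV[R]_q.+1)
  (f : R * R -> R) (x : nat -> T -> 'cV[R]_q.+1) (u : nat -> T -> R).
Hypothesis model : single_index_model P n Sigma tau f x u.

Let sym : Sigma^T = Sigma.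
Proof. by case: (sim_posdef model). Qed.

Let posdef (v : 'cV[R]_q.+1) : v != 0 -> 0 < dotp v (Sigma *m v).
Proof. by case: (sim_posdef model) => _; exact. Qed.

Let nnegdef (v : 'cV[R]_q.+1) : 0 <= dotp v (Sigma *m v).
Proof. by have [->|/posdef/ltW//] := eqVneq v 0; rewrite dotp0l. Qed.

Lemma tau_normalized : dotp tau (Sigma *m tau) = 1.
Proof.
have [S [[ST _] <-]] := sim_tau model.
rewrite /norm2 => h; rewrite -mulmxA dotp_mulmx ST.
by rewrite -[LHS]sqr_sqrtr ?dotp_ge0// h expr1n.
Qed.

Definition sigx i := sigma_of [set: 'I_q.+1] (fun k w => x i w k 0).
Definition sigu i := sigma_of [set: unit] (fun=> u i).

(* The sigma-algebra generated by the pairs (x_i, u_i) with i in I. *)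
Definition obs (I : set nat) := g_sigma_algebraType (block_gen sigx sigu I).

Lemma obs_x (I : set nat) i (v : 'cV[R]_q.+1) : I i ->
  @measurable_fun _ _ (obs I) R setT (fun w => dotp v (x i w)).
Proof.
move=> Ii.
have mk k : @measurable_fun _ _ (obs I) R setT (fun w => x i w k 0).
  move=> _ B mB; rewrite setTI; apply: sub_sigma_algebra; exists i => //; left.
  by apply: sub_sigma_algebra; exists k => //; exists B.
have -> : (fun w => dotp v (x i w)) = (fun w => \sum_(k < q.+1) v k 0 * x i w k 0) by [].
by apply: measurable_sum => k; apply: measurable_funM => //; exact: mk.
Qed.

Lemma obs_u (I : set nat) i : I i -> @measurable_fun _ _ (obs I) R setT (u i).
Proof.
move=> Ii _ B mB; rewrite setTI; apply: sub_sigma_algebra; exists i => //; right.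
by apply: sub_sigma_algebra; exists tt => //; exists B.
Qed.

Lemma obs_y (I : set nat) i : I i ->
  @measurable_fun _ _ (obs I) R setT (response tau f x u i).
Proof.
move=> Ii; have mf := sim_f model.
apply: (measurableT_comp mf); apply: measurable_fun_pair; last exact: obs_u.
by under eq_fun do rewrite dotpC; exact: obs_x.
Qed.

Let row : set nat := [set i | (1 <= i <= 2 * n)%N].

Let xm i k : row i -> measurable_fun setT (fun w => x i w k 0).
Proof. by move=> /(sim_x model)[+ _]; exact. Qed.

Let um i : row i -> measurable_fun setT (u i).
Proof. by move=> /(sim_u model)[]. Qed.

Let FX := sigma_of [set ik : nat * 'I_q.+1 | (1 <= ik.1 <= 2 * n)%N] (fun ik w => x ik.1 w ik.2 0).
Let HU := sigma_of [set i : nat | (1 <= i <= 2 * n)%N] u.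

Let FXm : FX `<=` measurable.
Proof.
apply: smallest_sub; first exact: sigma_algebra_measurable.
move=> _ [[i k] /= hi [B mB <-]]; rewrite -[X in measurable X]setTI; exact: xm.
Qed.

Let HUm : HU `<=` measurable.
Proof.
apply: smallest_sub; first exact: sigma_algebra_measurable.
move=> _ [i /= hi [B mB <-]]; rewrite -[X in measurable X]setTI; exact: um.
Qed.

Let sigxFX i : row i -> sigx i `<=` FX.
Proof.
move=> hi; apply: smallest_sub; first exact: smallest_sigma_algebra.
by move=> _ [k _ [B mB <-]]; apply: sub_sigma_algebra; exists (i, k) => //; exists B.
Qed.

Let siguHU i : row i -> sigu i `<=` HU.
Proof.
move=> hi; apply: smallest_sub; first exact: smallest_sigma_algebra.
by move=> _ [k _ [B mB <-]]; apply: sub_sigma_algebra; exists i => //; exists B.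
Qed.

Lemma obs_measurable (I : set nat) (A : set T) : I `<=` row ->
  @measurable _ (obs I) A -> measurable A.
Proof.
move=> IR; apply: (block_gen_measurable FXm HUm sigxFX siguHU IR).
Qed.

Lemma obs_measurable_fun (I : set nat) (X : T -> R) : I `<=` row ->
  @measurable_fun _ _ (obs I) R setT X -> measurable_fun setT X.
Proof.
by move=> IR mX _ B mB; apply: (obs_measurable IR); exact: mX.
Qed.

(** All independence between observations, and between the two halves of the sample, is used in this
    form. *)
Lemma obs_indep (I J : set nat) (X Y : T -> R) : I `<=` row -> J `<=` row ->
  (forall i, I i -> ~ J i) ->
  @measurable_fun _ _ (obs I) R setT X -> @measurable_fun _ _ (obs J) R setT Y ->
  integ P X -> integ P Y -> integ P (fun w => X w * Y w) /\
  mean P (fun w => X w * Y w) = mean P X * mean P Y.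
Proof.
move=> IR JR IJ mX mY; have ind := block_indep (fun i => smallest_sigma_algebra _ _)
  (fun i => smallest_sigma_algebra _ _) (smallest_sigma_algebra _ _) (smallest_sigma_algebra _ _)
  FXm HUm sigxFX siguHU (sim_indep_x model) (sim_indep_u model) (sim_indep_xu model) IR JR IJ.
apply: (mean_indep_pair ind) => B mB; rewrite -[X in <<s _ >> X]setTI; [exact: mX|exact: mY].
Qed.

Let lin (v : 'cV[R]_q.+1) i w := dotp v (x i w).

Lemma measurable_lin v i : row i -> measurable_fun setT (fun w => dotp v (x i w)).
Proof.
move=> hi; apply: (@obs_measurable_fun [set i]); last exact: obs_x.
by move=> _ ->.
Qed.

Let sd v := Num.sqrt (dotp v (Sigma *m v)).

Let law_lin v i B : row i -> v != 0 -> measurable B ->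
  P (lin v i @^-1` B) = gauss (sd v) B.
Proof. by move=> /(sim_x model)[_ h] v0 mB; exact: h. Qed.

Let mid : measurable_fun [set: measurableTypeR R] (id : measurableTypeR R -> R).
Proof. exact: measurable_id. Qed.

Lemma lin_moment v i m : row i ->
  integ P (fun w => dotp v (x i w) ^+ (2 * m)) /\
  mean P (fun w => dotp v (x i w) ^+ (2 * m)) <=
    2 * (m`!%:R * (8 * dotp v (Sigma *m v)) ^+ m).
Proof.
(* The Gaussian law is prescribed for nonzero v only. For v = 0 the case m = 0 stands apart, as 0 ^+
   0 = 1. *)
move=> hi; have [->|v0] := eqVneq v 0.
  have -> : (fun w => dotp 0 (x i w) ^+ (2 * m)) = fun=> 0 ^+ (2 * m).
    by apply/funext => w; rewrite dotp0l.
  rewrite mean_cst dotp0l mulr0; split; first exact: integ_cst.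
  case: m => [|m]; first by rewrite muln0 !expr0 mulr1 fact0; lra.
  by rewrite !expr0n muln_eq0 /= !mulr0.
have s0 : sd v != 0 by rewrite gt_eqF// sqrtr_gt0 posdef.
have mX : measurable_fun [set: R] (fun z : R => z ^+ (2 * m)) by exact: measurable_funX.
have [i1 h1] := gauss_moment m s0.
have law B : measurable B -> gauss (sd v) (id @^-1` B) = P (lin v i @^-1` B).
  by move=> mB; rewrite law_lin.
have [H1 H2] := mean_law mid (measurable_lin v hi) law mX.
split; first exact: H1.
rewrite -[X in X <= _]H2; apply: (le_trans h1).
by rewrite sqr_sqrtr.
Qed.

Lemma lin_sqr v i : row i -> integ P (fun w => dotp v (x i w) ^+ 2) /\
  mean P (fun w => dotp v (x i w) ^+ 2) = dotp v (Sigma *m v).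
Proof.
move=> hi; split; first by have [] := lin_moment v 1 hi.
have [->|v0] := eqVneq v 0.
  by under eq_mean do rewrite dotp0l expr0n/=; rewrite mean_cst dotp0l.
have s0 : sd v != 0 by rewrite gt_eqF// sqrtr_gt0 posdef.
have mX : measurable_fun [set: R] (fun z : R => z ^+ 2) by exact: measurable_funX.
have law B : measurable B -> gauss (sd v) (id @^-1` B) = P (lin v i @^-1` B).
  by move=> mB; rewrite law_lin.
have [_ H2] := mean_law mid (measurable_lin v hi) law mX.
by rewrite -[LHS]H2 -[RHS](sqr_sqrtr (nnegdef v)); exact: gauss_var.
Qed.

(** Polarization: covariances are recovered from the variance of the sum of the two functionals. *)
Lemma lin_prod v v' i : row i -> integ P (fun w => dotp v (x i w) * dotp v' (x i w)) /\
  mean P (fun w => dotp v (x i w) * dotp v' (x i w)) = dotp v (Sigma *m v').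
Proof.
move=> hi; have [i1 h1] := lin_sqr v hi; have [i2 h2] := lin_sqr v' hi.
have [_ h3] := lin_sqr (v + v') hi.
have i3 : integ P (fun w => dotp v (x i w) * dotp v' (x i w)).
  by apply: integM => //; exact: measurable_lin.
split => //; move: h3.
have E w : dotp (v + v') (x i w) ^+ 2 =
    dotp v (x i w) ^+ 2 + 2 * (dotp v (x i w) * dotp v' (x i w)) + dotp v' (x i w) ^+ 2.
  by rewrite dotpDl; ring.
under eq_mean do rewrite E.
rewrite meanD//; last by apply: integD => //; exact: integZ.
rewrite meanD//; last exact: integZ.
rewrite meanZ// h1 h2 mulmxDr dotpDl !dotpDr (dotp_sym v' v sym); lra.
Qed.

(** A linear functional has a law determined by its variance; by positive definiteness both vectors
    vanish together. This feeds the Cramer-Wold hypothesis. *)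
Lemma lin_cos v v' i i' th : row i -> row i' ->
  dotp v (Sigma *m v) = dotp v' (Sigma *m v') ->
  mean P (fun w => cos (dotp v (x i w) + th)) = mean P (fun w => cos (dotp v' (x i' w) + th)).
Proof.
move=> hi hi' vv'.
have mcos : measurable_fun [set: R] (fun z : R => cos (z + th)).
  have ml : measurable_fun [set: R] (fun z : R => z + th) by exact: measurable_funD.
  exact: (measurableT_comp (continuous_measurable_fun (@continuous_cos R)) ml).
have [v0|v0] := eqVneq v 0.
  have v'0 : v' = 0.
    apply/eqP; apply: contraT => /posdef; rewrite -vv' v0 dotp0l ltxx//.
  by rewrite v0 v'0; apply: eq_mean => w; rewrite !dotp0l.
have v'0 : v' != 0 by apply: contra_neq v0 => v'0; apply/eqP; apply: contraT => /posdef;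
  rewrite vv' v'0 dotp0l ltxx.
have law B : measurable B -> P (lin v i @^-1` B) = P (lin v' i' @^-1` B).
  move=> mB; rewrite (law_lin hi v0 mB) (law_lin hi' v'0 mB).
  by have -> : sd v = sd v' by rewrite /sd vv'.
by have [_ H] := mean_law (measurable_lin v hi) (measurable_lin v' hi') law mcos.
Qed.

(* Only the Gram matrix of the two linear functionals matters for their joint law with u. *)
Lemma lin_law3 (a b a' b' : 'cV[R]_q.+1) i i' : row i -> row i' ->
  dotp a (Sigma *m a) = dotp a' (Sigma *m a') ->
  dotp a (Sigma *m b) = dotp a' (Sigma *m b') ->
  dotp b (Sigma *m b) = dotp b' (Sigma *m b') ->
  forall B : set ((R * R) * R), measurable B ->
  P ((fun w => ((dotp a (x i w), dotp b (x i w)), u i w)) @^-1` B) =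
  P ((fun w => ((dotp a' (x i' w), dotp b' (x i' w)), u i' w)) @^-1` B).
Proof.
move=> hi hi' haa hab hbb.
have indu (a0 b0 : 'cV[R]_q.+1) j (B : set (R * R)) (D : set R) : row j ->
    measurable B -> measurable D ->
    P ((fun w => (dotp a0 (x j w), dotp b0 (x j w))) @^-1` B `&` u j @^-1` D) =
    (P ((fun w => (dotp a0 (x j w), dotp b0 (x j w))) @^-1` B) * P (u j @^-1` D))%E.
  move=> hj mB mD; apply: (sim_indep_xu model).
    have mk k : @measurable_fun _ _ (g_sigma_algebraType FX) R setT (fun w => x j w k 0).
      move=> _ E mE; rewrite setTI; apply: sub_sigma_algebra.
      by apply: sub_sigma_algebra; exists (j, k) => //; exists E.
    have ml (v : 'cV[R]_q.+1) :
        @measurable_fun _ _ (g_sigma_algebraType FX) R setT (fun w => dotp v (x j w)).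
      have -> : (fun w => dotp v (x j w)) = (fun w => \sum_(k < q.+1) v k 0 * x j w k 0) by [].
      by apply: measurable_sum => k; apply: measurable_funM => //; exact: mk.
    have := measurable_fun_pair (ml a0) (ml b0) => /(_ measurableT B mB); rewrite setTI.
    by rewrite /measurable /= (sigma_algebraE (smallest_sigma_algebra _ _)).
  by apply: sub_sigma_algebra; exists j => //; exists D.
apply: cramer_wold3; try exact: measurable_lin; try exact: um.
- move=> s t th.
  have E (a0 b0 : 'cV[R]_q.+1) j w : s * dotp a0 (x j w) + t * dotp b0 (x j w) + th =
      dotp (s *: a0 + t *: b0) (x j w) + th by rewrite dotpDl !dotpZl.
  under eq_mean do rewrite E; under [RHS]eq_mean do rewrite E.
  by apply: lin_cos => //; rewrite !dotp_qf_lin// haa hab hbb.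
- move=> D mD; have [_ h1] := sim_u model hi; have [_ h2] := sim_u model hi'.
  by rewrite h1// h2.
- by move=> B D mB mD; exact: indu.
- by move=> B D mB mD; exact: indu.
Qed.

End one_row_model.

(** * Elementary inequalities for moments of order 2 + a *)

Section lyapunov_bounds.
Context {R : realType}.
Implicit Types (a r y z : R).

Let one_powR (b : R) : 1 `^ b = 1.
Proof. by rewrite powR1. Qed.

Lemma powR_le_pow (v b : R) m : 0 <= v -> 0 <= b -> b <= (2 * m)%:R -> v `^ b <= 1 + v ^+ (2 * m).
Proof.
move=> v0 b0 bm; have [v1|v1] := leP 1 v.
  apply: (@le_trans _ _ (v `^ (2 * m)%:R)); first by rewrite ler_powR.
  by rewrite powR_mulrn// lerDr.
apply: (@le_trans _ _ 1); last by rewrite lerDl exprn_ge0.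
rewrite -[leRHS](one_powR b); apply: ge0_ler_powR; rewrite ?nnegrE//; exact: ltW.
Qed.

Lemma powR_sqrD (v a : R) : 0 <= v -> v ^+ 2 * v `^ a = v `^ (2 + a) \/ v = 0.
Proof.
move=> v0; have [->|vn0] := eqVneq v 0; [by right|left].
by rewrite powRD ?vn0 ?implybT// -powR_mulrn.
Qed.

Lemma sqr_le_lyapunov (a v : R) : 0 < a -> v ^+ 2 <= 1 + v ^+ 2 * `|v| `^ a.
Proof.
move=> a0; have [v1|v1] := leP 1 `|v|.
  have := powR_ge1 v1 a0 => h; have := sqr_ge0 v; nra.
have : v ^+ 2 <= 1.
  by rewrite -(real_normK (num_real v)) exprn_ile1// ltW.
have : 0 <= v ^+ 2 * `|v| `^ a by rewrite mulr_ge0 ?sqr_ge0 ?powR_ge0.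
lra.
Qed.

(* Young-type trade-off: split according to whether |r| <= |z|^(alpha/8). *)
Lemma lyapunov_product (alpha : R) : 0 < alpha -> exists a (m : nat), 0 < a <= 1 /\
  forall r z : R, (r * z) ^+ 2 * `|r * z| `^ a <= 2 + r ^+ (2 * m) + `|z| `^ (2 + alpha).
Proof.
(* These choices give (k + 1) (2 + a) <= 2 + alpha, which settles |r| <= |z|^k when |z| >= 1. If |r|
   > |z|^k then |r z| <= |r|^(1 + 1/k), and [b] is the exponent of |r| that results. *)
move=> al0; pose a := Num.min 1 (alpha / 4); pose k := alpha / 8.
have a0 : 0 < a by rewrite lt_min ltr01 divr_gt0.
have a1 : a <= 1 by rewrite ge_min lexx.
have a4 : a <= alpha / 4 by rewrite ge_min lexx orbT.
have k0 : 0 < k by rewrite divr_gt0.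
pose b := (1 + k^-1) * (2 + a).
have b0 : 0 <= b by rewrite mulr_ge0// addr_ge0 ?invr_ge0 ?ltW.
have [m bm] : exists m : nat, b <= (2 * m)%:R.
  exists (Num.truncn b).+1; apply: (@le_trans _ _ (Num.truncn b).+1%:R).
    by rewrite ltW// truncnS_gt.
  by rewrite ler_nat leq_pmull.
exists a, m; split; first by rewrite a0.
move=> r z; set v := `|r|; set s := `|z|.
have v0 : 0 <= v by exact: normr_ge0.
have s0 : 0 <= s by exact: normr_ge0.
have rm : r ^+ (2 * m) = v ^+ (2 * m) by rewrite !exprM real_normK ?num_real.
have e : (r * z) ^+ 2 = `|r * z| ^+ 2 by rewrite real_normK ?num_real.
rewrite e rm normrM -/v -/s; have vs0 : 0 <= v * s by rewrite mulr_ge0.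
have sp : 0 <= s `^ (2 + alpha) by exact: powR_ge0.
have vp : 0 <= v ^+ (2 * m) by rewrite exprn_ge0.
have [->|->] := powR_sqrD a vs0; last by rewrite expr0n mul0r; lra.
have a20 : 0 <= 2 + a by rewrite addr_ge0// ltW.
have [vk|vk] := leP v (s `^ k).
  have [s1|s1] := leP 1 s.
    apply: (@le_trans _ _ (s `^ (2 + alpha))); last by lra.
    apply: (@le_trans _ _ ((s `^ (k + 1)) `^ (2 + a))).
      apply: ge0_ler_powR; rewrite ?nnegrE ?powR_ge0//.
      rewrite powRD; last by rewrite implybE (gt_eqF (lt_le_trans ltr01 s1)) orbT.
      by rewrite powRr1// ler_wpM2r.
    rewrite -powRrM ler_powR//; have ka : k * a <= k by rewrite ler_piMr// ltW.
    by rewrite mulrDl mul1r mulrDr; move: a4 ka; rewrite /k; lra.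
  apply: (@le_trans _ _ 1); last by lra.
  rewrite -[leRHS](one_powR (2 + a)); apply: ge0_ler_powR; rewrite ?nnegrE//.
  apply: mulr_ile1 => //; last exact: ltW.
  apply: (le_trans vk); rewrite -[leRHS](one_powR k).
  by apply: ge0_ler_powR; rewrite ?nnegrE// ltW.
have vpos : 0 < v by apply: le_lt_trans vk; exact: powR_ge0.
have sk : s <= v `^ k^-1.
  rewrite -[leLHS]powRr1// -(mulfV (lt0r_neq0 k0)) powRrM.
  by apply: ge0_ler_powR; rewrite ?nnegrE ?powR_ge0 ?invr_ge0// ltW.
apply: (@le_trans _ _ (1 + v ^+ (2 * m))); last by lra.
apply: le_trans (powR_le_pow v0 b0 bm).
rewrite /b powRrM; apply: ge0_ler_powR; rewrite ?nnegrE ?powR_ge0//.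
rewrite powRD; last by rewrite implybE (gt_eqF vpos) orbT.
by rewrite powRr1// ler_wpM2l.
Qed.

(** Bounding by the maximum of |y| and |g| instead of their sum lets the real power through without
    a convexity inequality. *)
Lemma powR_residual (b : R) (mu y g : R) m : 0 <= b -> b <= (2 * m)%:R ->
  `|y - mu * g| `^ b <= (2 * (1 + `|mu|)) `^ b * (`|y| `^ b + (1 + g ^+ (2 * m))).
Proof.
move=> b0 bm.
have gm : g ^+ (2 * m) = `|g| ^+ (2 * m) by rewrite !exprM real_normK ?num_real.
have hg : `|g| `^ b <= 1 + g ^+ (2 * m) by rewrite gm; exact: powR_le_pow.
pose v := Num.max `|y| `|g|.
have hv : v `^ b <= `|y| `^ b + (1 + g ^+ (2 * m)).
  rewrite /v; have := powR_ge0 `|y| b; have := powR_ge0 `|g| b.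
  by have [_|_] := leP `|y| `|g|; lra.
have h1 : `|y - mu * g| <= 2 * (1 + `|mu|) * v.
  apply: (le_trans (ler_normB _ _)); rewrite normrM.
  have hy : `|y| <= v by rewrite le_max lexx.
  have hg' : `|g| <= v by rewrite le_max lexx orbT.
  have := ler_wpM2l (normr_ge0 mu) hg'; have := normr_ge0 mu; have := normr_ge0 y.
  nra.
have L0 : 0 <= 2 * (1 + `|mu|) by rewrite mulr_ge0// addr_ge0.
have v0 : 0 <= v by rewrite le_max normr_ge0.
apply: (@le_trans _ _ ((2 * (1 + `|mu|) * v) `^ b)).
  by apply: ge0_ler_powR; rewrite ?nnegrE ?mulr_ge0.
by rewrite powRM// ler_wpM2l ?powR_ge0.
Qed.

End lyapunov_bounds.

(** * The standardized scores of one row *)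

Section row_analysis.
Context {d} {T : measurableType d} {R : realType} {q : nat}.
Variables (P : probability T R) (n : nat) (Sigma : 'M[R]_q.+1) (tau : 'cV[R]_q.+1)
  (f : R * R -> R) (x : nat -> T -> 'cV[R]_q.+1) (u : nat -> T -> R).
Hypothesis model : single_index_model P n Sigma tau f x u.
Hypothesis n0 : (0 < n)%N.
Variables (c C alpha M : R).
Hypotheses (c0 : 0 < c) (Ac : forall v : 'cV[R]_q.+1,
  c * dotp v v <= dotp v (Sigma *m v) <= C * dotp v v).
Hypotheses (alpha0 : 0 < alpha) (M0 : 0 < M).

Notation y := (response tau f x u).
Hypothesis y_moment : ('E_P[(fun w => `|y n w| `^ (2 + alpha))%R] <= M%:E)%E.

Definition slope := mean P (fun w => y n w * dotp (x n w) tau).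
Definition resid_dir := resid_vec (node_coef P (x n)).
Definition resid i w := dotp resid_dir (x i w).
Definition noise i w := y i w - slope * dotp tau (x i w).
Notation mu := slope.
Notation rv := resid_dir.
Notation r := resid.
Notation z := noise.
Let g i w := dotp tau (x i w).
Let row : set nat := [set i | (1 <= i <= 2 * n)%N].

Let rown : row n.
Proof. by rewrite /row /= n0 mul2n -addnn leq_addr. Qed.

Let sym : Sigma^T = Sigma.
Proof. by case: (sim_posdef model). Qed.

Let e (k : 'I_q.+1) : 'cV[R]_q.+1 := delta_mx k 0.

Let dotpe k (v : 'cV[R]_q.+1) : dotp (e k) v = v k 0.
Proof.
rewrite /dotp (bigD1 k)//= big1 => [|j jk]; rewrite !mxE ?eqxx ?mul1r ?addr0//.
by rewrite (negbTE jk) mul0r.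
Qed.

Let Sigma_e j k : dotp (e j) (Sigma *m e k) = Sigma j k.
Proof.
rewrite dotpe mxE (bigD1 k)//= big1 => [|i ik]; rewrite !mxE ?eqxx ?mulr1 ?addr0//.
by rewrite (negbTE ik) mulr0.
Qed.

Lemma cov_coord i j k : row i -> mean P (fun w => x i w j 0 * x i w k 0) = Sigma j k.
Proof.
move=> hi; have [_ h] := lin_prod model (e j) (e k) hi; rewrite Sigma_e in h.
by rewrite -h; apply: eq_mean => w; rewrite !dotpe.
Qed.

Lemma node_coefE : node_coef P (x n) =
  invmx (\matrix_(j, k) Sigma (lift ord0 j) (lift ord0 k)) *m \col_j Sigma (lift ord0 j) ord0.
Proof.
rewrite /node_coef; congr (invmx _ *m _); apply/matrixP => j k; rewrite !mxE.
  rewrite -(cov_coord _ _ rown) /mean; congr (fine 'E_P[_]); apply/funext => w; rewrite !mxE//.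
rewrite -(cov_coord _ _ rown) /mean; congr (fine 'E_P[_]); apply/funext => w; rewrite !mxE//.
Qed.

Definition resid_var := dotp rv (Sigma *m rv).
Notation s2 := resid_var.

Lemma resid_orth v : dotp v (Sigma *m rv) = v ord0 0 * s2.
Proof.
rewrite /s2 /resid_var /rv; move: (node_coefE) => ->.
exact: (resid_vec_orth c0 Ac).
Qed.

Lemma resid_var_bounds : c <= s2 <= C.
Proof. by rewrite /s2 /resid_var /rv node_coefE; exact: (resid_vec_bounds sym c0 Ac). Qed.

Let mf := sim_f model.

Let obs_r (I : set nat) i : I i -> @measurable_fun _ _ (obs x u I) R setT (r i).
Proof. exact: obs_x. Qed.

Let obs_z (I : set nat) i : I i -> @measurable_fun _ _ (obs x u I) R setT (z i).
Proof.
move=> Ii; apply: measurable_funB; first exact: (obs_y model).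
by apply: measurable_funM => //; exact: obs_x.
Qed.

Let my i : row i -> measurable_fun setT (y i).
Proof.
move=> hi; apply: (obs_measurable_fun model (I := [set i])); first by move=> _ ->.
exact: (obs_y model).
Qed.

Let mr i : row i -> measurable_fun setT (r i).
Proof. exact: (measurable_lin model). Qed.

Let mg i : row i -> measurable_fun setT (g i).
Proof. exact: (measurable_lin model). Qed.

Let mz i : row i -> measurable_fun setT (z i).
Proof. by move=> hi; apply: measurable_funB; [exact: my|apply: measurable_funM => //; exact: mg]. Qed.

Let ya : integ P (fun w => `|y n w| `^ (2 + alpha)) /\
  mean P (fun w => `|y n w| `^ (2 + alpha)) <= M.
Proof.
have m : measurable_fun setT (fun w => `|y n w| `^ (2 + alpha)).
  apply: (measurableT_comp (measurable_powR _)); apply: measurableT_comp => //; exact: my.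
have i1 : integ P (fun w => `|y n w| `^ (2 + alpha)).
  apply/integrableP; split; first exact/measurable_EFinP.
  move: y_moment; rewrite unlock => h; apply: le_lt_trans (ltry M); apply: le_trans h.
  by under eq_integral do rewrite /= (ger0_norm (powR_ge0 _ _)).
split => //; rewrite -lee_fin -mean_EFin//.
by move: y_moment; rewrite unlock.
Qed.

Let y2 : integ P (fun w => y n w ^+ 2) /\ mean P (fun w => y n w ^+ 2) <= 1 + M.
Proof.
have [i1 h1] := ya.
have h w : y n w ^+ 2 <= 1 + `|y n w| `^ (2 + alpha).
  have := sqr_le_lyapunov (y n w) alpha0; rewrite -[X in _ <= 1 + X * _ -> _](real_normK (num_real _)).
  have [->//|->] := powR_sqrD alpha (normr_ge0 (y n w)).
  by rewrite expr0n mul0r addr0 => /le_trans; apply; rewrite lerDl powR_ge0.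
have i2 : integ P (fun w => 1 + `|y n w| `^ (2 + alpha)).
  by apply: integD => //; exact: integ_cst.
have i3 : integ P (fun w => y n w ^+ 2).
  apply: (integ_dom _ _ i2); first by apply: measurable_funX; exact: my.
  by move=> w; rewrite ger0_norm ?sqr_ge0.
split => //; apply: (le_trans (mean_le i3 i2 h)).
by rewrite meanD ?mean_cst ?lerD//; exact: integ_cst.
Qed.

Let g2 : integ P (fun w => g n w ^+ 2) /\ mean P (fun w => g n w ^+ 2) = 1.
Proof. by rewrite -(tau_normalized model); exact: (lin_sqr model). Qed.

Let muE : mu = mean P (fun w => y n w * g n w).
Proof. by apply: eq_mean => w; rewrite dotpC. Qed.

Lemma mu_bound : `|mu| <= 1 + M.
Proof.
have [i1 h1] := y2; have [i2 h2] := g2.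
have iyg : integ P (fun w => y n w * g n w) by apply: integM => //; [exact: my|exact: mg].
rewrite muE; apply: le_trans (mean_norm iyg) _.
apply: (@le_trans _ _ (mean P (fun w => 2^-1 * (y n w ^+ 2 + g n w ^+ 2)))).
  apply: mean_le; [exact: integ_norm|by apply/integZ/integD|move=> w].
  rewrite normrM -(real_normK (num_real (y n w))) -(real_normK (num_real (g n w))).
  by have := sqr_ge0 (`|y n w| - `|g n w|); nra.
rewrite meanZ; last exact: integD.
by rewrite meanD// h2; move: h1 M0; lra.
Qed.

(** The response is a function of g and u, so everything about the score is a function of the triple
    (r, g, u), whose law does not depend on i. Moment assumptions made at index n thus serve the
    whole row. *)
Let transfer (h : (R * R) * R -> R) i : row i -> measurable_fun setT h ->
  (integ P (fun w => h ((r n w, g n w), u n w)) -> integ P (fun w => h ((r i w, g i w), u i w))) /\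
  mean P (fun w => h ((r n w, g n w), u n w)) = mean P (fun w => h ((r i w, g i w), u i w)).
Proof.
move=> hi mh; apply: mean_law mh; last by move=> B mB; exact: (lin_law3 model).
- apply: measurable_fun_pair; last by have [] := sim_u model rown.
  by apply: measurable_fun_pair; [exact: mr|exact: mg].
- apply: measurable_fun_pair; last by have [] := sim_u model hi.
  by apply: measurable_fun_pair; [exact: mr|exact: mg].
Qed.

(* The part of r uncorrelated with g may be flipped without changing its joint law with (g, u). *)
Lemma mean_rz0 : integ P (fun w => r n w * z n w) /\ mean P (fun w => r n w * z n w) = 0.
Proof.
pose rho := dotp rv (Sigma *m tau); pose a := rv - rho *: tau.
have at0 : dotp a (Sigma *m tau) = 0.
  rewrite dotpC dotpBr dotpZr !(dotpC (Sigma *m tau)) (tau_normalized model) mulr1.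
  by rewrite -/rho subrr.
have mt : measurable_fun setT (fun v : (R * R) * R => v.1.1 * f (v.1.2, v.2)).
  apply: measurable_funM; first exact: measurableT_comp.
  apply: (measurableT_comp mf); apply: measurable_fun_pair => //.
  exact: measurableT_comp.
have [i1 h1] := y2; have [i2 h2] := g2.
have [ia _] := lin_sqr model a rown; have [ir _] := lin_sqr model rv rown.
have iay : integ P (fun w => dotp a (x n w) * y n w).
  by apply: integM => //; [exact: (measurable_lin model)|exact: my].
have igy : integ P (fun w => g n w * y n w) by apply: integM => //; [exact: mg|exact: my].
have ay0 : mean P (fun w => dotp a (x n w) * y n w) = 0.
  have NE w : dotp (-1 *: a) (x n w) * y n w = -1 * (dotp a (x n w) * y n w).
    by rewrite dotpZl mulrA.
  have yE w : y n w = f (dotp tau (x n w), u n w) by rewrite /response dotpC.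
  have mp (v : 'cV[R]_q.+1) : measurable_fun setT
      (fun w => ((dotp v (x n w), dotp tau (x n w)), u n w)).
    apply: measurable_fun_pair; last by have [] := sim_u model rown.
    by apply: measurable_fun_pair; exact: (measurable_lin model).
  have e1 : dotp a (Sigma *m a) = dotp (-1 *: a) (Sigma *m (-1 *: a)).
    by rewrite -scalemxAr dotpZl dotpZr; ring.
  have e2 : dotp a (Sigma *m tau) = dotp (-1 *: a) (Sigma *m tau).
    by rewrite dotpZl at0; ring.
  have [_ h] := mean_law (mp a) (mp (-1 *: a)) (lin_law3 model rown rown e1 e2 erefl) mt.
  have h' : mean P (fun w => dotp a (x n w) * y n w) = mean P (fun w => -1 * (dotp a (x n w) * y n w)).
    rewrite -(eq_mean _ NE); under eq_mean do rewrite yE; rewrite h; apply: eq_mean => w.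
    by rewrite /= yE.
  by move: h'; rewrite meanZ//; lra.
have iry : integ P (fun w => r n w * y n w).
  by apply: integM => //; [exact: mr|exact: my].
have [irg hrg] := lin_prod model rv tau rown.
have zE w : r n w * z n w = r n w * y n w - mu * (r n w * g n w) by rewrite /z /g; ring.
have ryE w : r n w * y n w = dotp a (x n w) * y n w + rho * (g n w * y n w).
  rewrite /r /g /a -[in RHS]scaleN1r dotpDl !dotpZl; ring.
split; first by under eq_fun do rewrite zE; apply: integB => //; exact: integZ.
(* With <rv, x> = <a, x> + rho g one has E[r y] = rho E[g y] = rho mu and E[r g] = rho, so the two
   terms cancel. *)
under eq_mean do rewrite zE; rewrite meanB//; last exact: integZ.
rewrite meanZ// hrg -/rho; under eq_mean do rewrite ryE.
rewrite meanD//; last exact: integZ.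
rewrite meanZ// ay0 add0r muE.
under [in X in rho * X - _]eq_mean do rewrite mulrC.
by rewrite mulrC subrr.
Qed.

Variables (a : R) (m m' : nat).
Hypotheses (a01 : 0 < a <= 1) (lyap : forall r z : R,
  (r * z) ^+ 2 * `|r * z| `^ a <= 2 + r ^+ (2 * m) + `|z| `^ (2 + alpha)).
Hypothesis m'b : 2 + alpha <= (2 * m')%:R.

(** The three terms bound the means of those in [lyap]: the residual variance is at most C, |mu| <=
    1 + M gives the factor 2 (2 + M), and g has variance 1. None depends on n. *)
Definition lyapunov_cst : R := 2 + 2 * (m`!%:R * (8 * C) ^+ m) +
  (2 * (2 + M)) `^ (2 + alpha) * (M + (1 + 2 * (m'`!%:R * 8 ^+ m'))).

Let al0 : 0 <= 2 + alpha.
Proof. by rewrite addr_ge0// ltW. Qed.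

Let z_moment : integ P (fun w => `|z n w| `^ (2 + alpha)) /\
  mean P (fun w => `|z n w| `^ (2 + alpha)) <=
  (2 * (2 + M)) `^ (2 + alpha) * (M + (1 + 2 * (m'`!%:R * 8 ^+ m'))).
Proof.
have [i1 h1] := ya; have [i2 h2] := lin_moment model tau m' rown.
rewrite (tau_normalized model) mulr1 in h2.
have i3 : integ P (fun w => 1 + g n w ^+ (2 * m')) by apply: integD => //; exact: integ_cst.
have i4 : integ P (fun w => `|y n w| `^ (2 + alpha) + (1 + g n w ^+ (2 * m'))) by exact: integD.
set L := (2 * (1 + `|mu|)) `^ (2 + alpha).
have hL : L <= (2 * (2 + M)) `^ (2 + alpha).
  apply: ge0_ler_powR => //; rewrite ?nnegrE ?mulr_ge0 ?addr_ge0 ?(ltW M0)//.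
  by have := mu_bound; lra.
have i5 : integ P (fun w => L * (`|y n w| `^ (2 + alpha) + (1 + g n w ^+ (2 * m')))) by exact: integZ.
have h w : `|z n w| `^ (2 + alpha) <= L * (`|y n w| `^ (2 + alpha) + (1 + g n w ^+ (2 * m'))).
  exact: powR_residual.
have i6 : integ P (fun w => `|z n w| `^ (2 + alpha)).
  apply: (integ_dom _ _ i5); last by move=> w; rewrite ger0_norm ?powR_ge0.
  by apply: (measurableT_comp (measurable_powR _)); apply: measurableT_comp => //; exact: mz.
split => //; apply: (le_trans (mean_le i6 i5 h)).
rewrite meanZ// meanD// meanD//; last exact: integ_cst.
rewrite mean_cst; apply: ler_pM => //; first exact: powR_ge0.
  apply: addr_ge0; first by apply: mean_ge0 => w; exact: powR_ge0.
  by apply: addr_ge0 => //; apply: mean_ge0 => w; rewrite exprM exprn_ge0// sqr_ge0.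
by rewrite lerD// lerD2l.
Qed.

Lemma mean_rz_lyapunov : integ P (fun w => (r n w * z n w) ^+ 2 * `|r n w * z n w| `^ a) /\
  mean P (fun w => (r n w * z n w) ^+ 2 * `|r n w * z n w| `^ a) <= lyapunov_cst.
Proof.
have [i1 h1] := z_moment; have [i2 h2] := lin_moment model rv m rown.
have i3 : integ P (fun w => 2 + r n w ^+ (2 * m)) by apply: integD => //; exact: integ_cst.
have i4 : integ P (fun w => 2 + r n w ^+ (2 * m) + `|z n w| `^ (2 + alpha)) by exact: integD.
have mrz : measurable_fun setT (fun w => r n w * z n w).
  by apply: measurable_funM; [exact: mr|exact: mz].
have i5 : integ P (fun w => (r n w * z n w) ^+ 2 * `|r n w * z n w| `^ a).
  apply: (integ_dom _ _ i4).
    apply: measurable_funM; first exact: measurable_funX.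
    by apply: (measurableT_comp (measurable_powR _)); exact: measurableT_comp.
  by move=> w; rewrite ger0_norm; [exact: lyap|rewrite mulr_ge0 ?sqr_ge0 ?powR_ge0].
split => //; apply: (le_trans (mean_le i5 i4 (fun w => lyap _ _))).
rewrite meanD// meanD//; last exact: integ_cst.
rewrite mean_cst /lyapunov_cst lerD// lerD2l (le_trans h2)// ler_wpM2l//.
rewrite ler_wpM2l// lerXn2r ?nnegrE//.
- by rewrite mulr_ge0//; have := resid_var_bounds; rewrite /s2 /resid_var; move: c0; lra.
- by rewrite mulr_ge0//; have := resid_var_bounds; move: c0; lra.
- by rewrite ler_wpM2l//; have /andP[] := resid_var_bounds.
Qed.

Definition score_var := mean P (fun w => r n w ^+ 2 * z n w ^+ 2).
Definition score_sd := Num.sqrt score_var.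
Notation sigma := score_sd.

Variable nu0 : R.
Hypotheses (nu00 : 0 < nu0) (nub : nu0 <= Num.sqrt (score_var / s2 ^+ 2)).

Lemma resid_var_gt0 : 0 < s2.
Proof. by have /andP[+ _] := resid_var_bounds; exact: lt_le_trans. Qed.

(** nu is sigma / s2, and s2 >= c. *)
Lemma score_sd_ge : nu0 * c <= sigma.
Proof.
have s20 := resid_var_gt0; have /andP[cs _] := resid_var_bounds.
have v0 : 0 <= score_var by apply: mean_ge0 => w; rewrite mulr_ge0 ?sqr_ge0.
move: nub; rewrite sqrtrM// sqrtrV ?sqr_ge0// sqrtr_sqr (gtr0_norm s20) -/sigma.
rewrite ler_pdivlMr//; apply: le_trans.
by rewrite ler_wpM2l// ltW.
Qed.

Lemma score_sd_gt0 : 0 < sigma.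
Proof. by apply: lt_le_trans score_sd_ge; exact: mulr_gt0. Qed.

Definition score i w := sigma^-1 * (r i w * z i w).
Notation X := score.

Let hh (v : (R * R) * R) : R := v.1.1 * (f (v.1.2, v.2) - mu * v.1.2).

Let mhh : measurable_fun setT hh.
Proof.
have m1 : measurable_fun setT (fun v : (R * R) * R => v.1.1) by exact: measurableT_comp.
have m2 : measurable_fun setT (fun v : (R * R) * R => v.1.2) by exact: measurableT_comp.
apply: measurable_funM => //; apply: measurable_funB; last exact: measurable_funM.
by apply: (measurableT_comp mf); exact: measurable_fun_pair.
Qed.

Let XE i w : X i w = sigma^-1 * hh ((r i w, g i w), u i w).
Proof. by rewrite /X /hh /z /response dotpC. Qed.

Let transferX (h : R -> R) i : row i -> measurable_fun setT h ->
  (integ P (fun w => h (X n w)) -> integ P (fun w => h (X i w))) /\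
  mean P (fun w => h (X n w)) = mean P (fun w => h (X i w)).
Proof.
move=> hi mh; have mk : measurable_fun setT (fun v => h (sigma^-1 * hh v)).
  by apply: (measurableT_comp mh); exact: measurable_funM.
have [h1 h2] := transfer hi mk; split.
  by under eq_fun do rewrite XE; move=> /h1; under eq_fun do rewrite -XE.
by under eq_mean do rewrite XE; rewrite h2; apply: eq_mean => w; rewrite -XE.
Qed.

Let mX0 i : row i -> measurable_fun setT (X i).
Proof. by move=> hi; apply: measurable_funM => //; apply: measurable_funM; [exact: mr|exact: mz]. Qed.

Let rowi i : (1 <= i <= n)%N -> row i.
Proof.
by move=> /andP[i1 i2]; rewrite /row /= i1 (leq_trans i2)// mul2n -addnn leq_addr.
Qed.

Lemma score_sqr i : (1 <= i <= n)%N ->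
  integ P (fun w => X i w ^+ 2) /\ mean P (fun w => X i w ^+ 2) = 1.
Proof.
move=> /rowi hi; have /andP[a0 _] := a01.
have [h1 <-] := transferX hi (h := fun t => t ^+ 2) (measurable_funX _ (@measurable_id _ _ setT)).
have [i1 _] := mean_rz_lyapunov.
have i2 : integ P (fun w => (r n w * z n w) ^+ 2).
  apply: (@integ_dom _ _ _ P _ (fun w => 1 + (r n w * z n w) ^+ 2 * `|r n w * z n w| `^ a)).
  - by apply: measurable_funX; apply: measurable_funM; [exact: mr|exact: mz].
  - by move=> w; rewrite ger0_norm ?sqr_ge0//; exact: sqr_le_lyapunov.
  - by apply: integD => //; exact: integ_cst.
have E w : X n w ^+ 2 = sigma^-1 ^+ 2 * (r n w * z n w) ^+ 2 by rewrite /X exprMn.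
split; first by apply: h1; under eq_fun do rewrite E; exact: integZ.
under eq_mean do rewrite E; rewrite meanZ//; under eq_mean do rewrite exprMn.
rewrite -/score_var exprVn sqr_sqrtr; last first.
  by apply: mean_ge0 => w; rewrite mulr_ge0 ?sqr_ge0.
by rewrite mulVf// gt_eqF// -sqrtr_gt0 score_sd_gt0.
Qed.

Lemma score_meas i : (1 <= i <= n)%N -> measurable_fun setT (X i).
Proof. by move=> /rowi/mX0. Qed.

Lemma score_mean0 i : (1 <= i <= n)%N -> mean P (X i) = 0.
Proof.
move=> /rowi hi; have [_ <-] := transferX hi (h := id) (@measurable_id _ _ setT).
by have [i1 h1] := mean_rz0; rewrite meanZ// h1 mulr0.
Qed.

Definition score_cst := (nu0 * c)^-1 ^+ 2 * (nu0 * c)^-1 `^ a * lyapunov_cst.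

Lemma score_lyapunov i : (1 <= i <= n)%N ->
  integ P (fun w => X i w ^+ 2 * `|X i w| `^ a) /\
  mean P (fun w => X i w ^+ 2 * `|X i w| `^ a) <= score_cst.
Proof.
move=> /rowi hi; have /andP[a0 _] := a01.
have mh : measurable_fun setT (fun t : R => t ^+ 2 * `|t| `^ a).
  apply: measurable_funM; first exact: measurable_funX.
  by apply: (measurableT_comp (measurable_powR _)); exact: normr_measurable.
have [h1 <-] := transferX hi mh.
have [i1 h2] := mean_rz_lyapunov.
have E w : X n w ^+ 2 * `|X n w| `^ a = sigma^-1 ^+ 2 * `|sigma^-1| `^ a *
    ((r n w * z n w) ^+ 2 * `|r n w * z n w| `^ a) by exact: lyapunov_scale.
split; first by apply: h1; under eq_fun do rewrite E; exact: integZ.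
under eq_mean do rewrite E; rewrite meanZ//.
have s0 := score_sd_gt0; have nc0 : 0 < nu0 * c by exact: mulr_gt0.
have hi' : `|sigma^-1| <= (nu0 * c)^-1.
  by rewrite ger0_norm ?invr_ge0 ?(ltW s0)// lef_pV2// score_sd_ge.
apply: ler_pM => //.
- by rewrite mulr_ge0 ?sqr_ge0 ?powR_ge0.
- by apply: mean_ge0 => w; rewrite mulr_ge0 ?sqr_ge0 ?powR_ge0.
- apply: ler_pM; rewrite ?sqr_ge0 ?powR_ge0//.
    by rewrite -(real_normK (num_real _)) lerXn2r ?nnegrE ?invr_ge0 ?(ltW nc0).
  by apply: ge0_ler_powR; rewrite ?nnegrE ?invr_ge0 ?(ltW nc0) ?(ltW a0).
Qed.

Let obs_X (I : set nat) i : I i -> @measurable_fun _ _ (obs x u I) R setT (X i).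
Proof.
by move=> Ii; apply: measurable_funM => //; apply: measurable_funM; [exact: obs_r|exact: obs_z].
Qed.

Lemma score_orth i j : (1 <= i <= n)%N -> (1 <= j <= n)%N -> (i < j)%N ->
  mean P (fun w => X i w * X j w) = 0.
Proof.
move=> hi hj ij; have [i1 _] := score_sqr hi; have [j1 _] := score_sqr hj.
have hI k : (1 <= k <= n)%N -> [set k] `<=` row by move=> hk _ ->; exact: rowi.
have dij k : [set i] k -> ~ [set j] k by move=> -> /eqP; rewrite (ltn_eqF ij).
have [] := obs_indep model (hI _ hi) (hI _ hj) dij (obs_X erefl) (obs_X erefl).
- by apply: integ_sqr => //; exact: score_meas.
- by apply: integ_sqr => //; exact: score_meas.
by move=> _ ->; rewrite score_mean0// mul0r.
Qed.

Lemma score_indep k (phi psi : R -> R) : (k < n)%N -> measurable_fun setT phi ->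
  measurable_fun setT psi -> (forall t, `|phi t| <= 1) -> (forall t, `|psi t| <= 1) ->
  mean P (fun w => phi (\sum_(1 <= i < k.+1) X i w) * psi (X k.+1 w)) =
  mean P (fun w => phi (\sum_(1 <= i < k.+1) X i w)) * mean P (fun w => psi (X k.+1 w)).
Proof.
move=> kn mg' mh g1 h1.
have kr : row k.+1 by apply: rowi; rewrite kn.
pose I : set nat := [set i | (1 <= i <= k)%N].
have Irow : I `<=` row.
  by move=> i /andP[i1 i2]; apply: rowi; rewrite i1 (leq_trans i2)// ltnW.
have mS : @measurable_fun _ _ (obs x u I) R setT (fun w => \sum_(1 <= i < k.+1) X i w).
  apply: (@measurable_partial_sum _ (obs x u I) R k X) => // i hi; exact: obs_X.
have m1 : @measurable_fun _ _ (obs x u I) R setT (fun w => phi (\sum_(1 <= i < k.+1) X i w)).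
  exact: (measurableT_comp mg').
have m2 : @measurable_fun _ _ (obs x u [set k.+1]) R setT (fun w => psi (X k.+1 w)).
  by apply: (measurableT_comp mh); exact: obs_X.
have Jrow : [set k.+1] `<=` row by move=> _ ->.
have [] := obs_indep model Irow Jrow _ m1 m2 => //.
- by move=> i /andP[_ ik] ike; rewrite ike ltnn in ik.
- by apply: (@integ_bnd _ _ _ P 1) => //; exact: (obs_measurable_fun model Irow m1).
- by apply: (@integ_bnd _ _ _ P 1) => //; exact: (obs_measurable_fun model Jrow m2).
Qed.

End row_analysis.

(** * The remainder of the debiased estimator *)

Section remainder.
Context {d} {T : measurableType d} {R : realType} {q : nat}.
Variables (P : probability T R) (n : nat) (Sigma : 'M[R]_q.+1) (tau : 'cV[R]_q.+1)
  (f : R * R -> R) (x : nat -> T -> 'cV[R]_q.+1) (u : nat -> T -> R).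
Hypothesis model : single_index_model P n Sigma tau f x u.
Hypothesis n0 : (0 < n)%N.
Variables (c C : R).
Hypotheses (c0 : 0 < c) (Ac : forall v : 'cV[R]_q.+1,
  c * dotp v v <= dotp v (Sigma *m v) <= C * dotp v v).

Notation r := (resid P n x).
Notation rv := (resid_dir P n x).
Notation s2 := (resid_var P n Sigma x).
Let row : set nat := [set i | (1 <= i <= 2 * n)%N].
Let e (k : 'I_q.+1) : 'cV[R]_q.+1 := delta_mx k 0.

Let dotpe k (v : 'cV[R]_q.+1) : dotp (e k) v = v k 0.
Proof.
rewrite /dotp (bigD1 k)//= big1 => [|j jk]; rewrite !mxE ?eqxx ?mul1r ?addr0//.
by rewrite (negbTE jk) mul0r.
Qed.

Let rowi i : (1 <= i <= n)%N -> row i.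
Proof.
by move=> /andP[i1 i2]; rewrite /row /= i1 (leq_trans i2)// mul2n -addnn leq_addr.
Qed.

Let C0 : 0 < C.
Proof. by have /andP[h1 h2] := resid_var_bounds model n0 c0 Ac; apply: lt_le_trans (le_trans h1 h2). Qed.

Let quad4 v i : row i -> integ P (fun w => dotp v (x i w) ^+ 4) /\
  mean P (fun w => dotp v (x i w) ^+ 4) <= 256 * (C * dotp v v) ^+ 2.
Proof.
move=> hi; have [i1 h1] := lin_moment model v 2 hi; split => //.
apply: (le_trans h1); have /andP[h2 h3] := Ac v.
rewrite exprMn mulrA mulrA (_ : 2 * 2`!%:R * 8 ^+ 2 = 256)//; last first.
  by rewrite !factS fact0; ring.
rewrite ler_wpM2l// lerXn2r ?nnegrE//; last by rewrite mulr_ge0 ?dotp_ge0 ?(ltW C0).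
by apply: le_trans h2; rewrite mulr_ge0 ?dotp_ge0 ?(ltW c0).
Qed.

Lemma resid_moment4 i : row i -> integ P (fun w => r i w ^+ 4) /\
  mean P (fun w => r i w ^+ 4) <= 256 * C ^+ 2.
Proof.
move=> hi; have [i1 h1] := lin_moment model rv 2 hi; split => //.
apply: (le_trans h1); have /andP[h2 h3] := resid_var_bounds model n0 c0 Ac.
rewrite exprMn mulrA mulrA (_ : 2 * 2`!%:R * 8 ^+ 2 = 256)//; last first.
  by rewrite !factS fact0; ring.
rewrite ler_wpM2l// lerXn2r ?nnegrE//; last exact: ltW.
by apply: le_trans h2; exact: ltW.
Qed.

Let mlin v i : row i -> measurable_fun setT (fun w => dotp v (x i w)).
Proof. exact: (measurable_lin model). Qed.

(** Weighted arithmetic-geometric inequality: the weight V = |v|^2 balances r^4 against <v, x>^4 /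
    V^2, so both halves have the same bound and the result is linear in |v|^2. *)
Lemma resid_lin_moment v i : row i -> integ P (fun w => (r i w * dotp v (x i w)) ^+ 2) /\
  mean P (fun w => (r i w * dotp v (x i w)) ^+ 2) <= 256 * C ^+ 2 * dotp v v.
Proof.
move=> hi; have [i1 h1] := resid_moment4 hi.
have [->|v0] := eqVneq v 0.
  have E w : (r i w * dotp 0 (x i w)) ^+ 2 = 0 by rewrite dotp0l mulr0 expr0n.
  split; first by under eq_fun do rewrite E; exact: integ_cst.
  by under eq_mean do rewrite E; rewrite mean_cst dotp0l mulr0.
have [i2 h2] := quad4 v hi; set V := dotp v v.
have V0 : 0 < V by exact: dotp_gt0.
pose G w := 2^-1 * (V * r i w ^+ 4 + V^-1 * dotp v (x i w) ^+ 4).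
have i3 : integ P (fun w => V * r i w ^+ 4 + V^-1 * dotp v (x i w) ^+ 4).
  by apply: integD; exact: integZ.
have iG : integ P G by exact: integZ.
have h w : (r i w * dotp v (x i w)) ^+ 2 <= G w.
  rewrite /G; set a := r i w; set b := dotp _ _; have := sqr_ge0 (V * a ^+ 2 - b ^+ 2).
  have E : V * (a * b) ^+ 2 <= 2^-1 * (V ^+ 2 * a ^+ 4 + b ^+ 4) ->
      (a * b) ^+ 2 <= 2^-1 * (V * a ^+ 4 + V^-1 * b ^+ 4).
    move=> hE; rewrite -(ler_pM2l V0); apply: (le_trans hE).
    by rewrite le_eqVlt; apply/orP; left; apply/eqP; field; rewrite gt_eqF.
  by move=> h; apply: E; move: h; nra.
have i4 : integ P (fun w => (r i w * dotp v (x i w)) ^+ 2).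
  apply: (integ_dom _ _ iG); last by move=> w; rewrite ger0_norm ?sqr_ge0.
  by apply: measurable_funX; apply: measurable_funM; exact: mlin.
split => //; apply: (le_trans (mean_le i4 iG h)).
rewrite meanZ// meanD; [|exact: integZ|exact: integZ]; rewrite !meanZ//.
have e1 : V * mean P (fun w => r i w ^+ 4) <= V * (256 * C ^+ 2) by rewrite ler_pM2l.
have e2 : V^-1 * mean P (fun w => dotp v (x i w) ^+ 4) <= V * (256 * C ^+ 2).
  rewrite ler_pdivrMl//; apply: (le_trans h2).
  by rewrite le_eqVlt; apply/orP; left; apply/eqP; rewrite /V; ring.
by move: e1 e2; nra.
Qed.

Lemma mean_resid_lin v i : row i -> integ P (fun w => r i w * dotp v (x i w)) /\
  mean P (fun w => r i w * dotp v (x i w)) = v ord0 0 * s2.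
Proof.
move=> hi; have [i1 h1] := lin_prod model v rv hi.
have E w : r i w * dotp v (x i w) = dotp v (x i w) * dotp rv (x i w) by rewrite mulrC.
split; first by under eq_fun do rewrite E.
by under eq_mean do rewrite E; rewrite h1 (resid_orth model n0 c0 Ac).
Qed.

(** Chebyshev for uncorrelated summands. By [mean_resid_lin] at the first unit vector they have mean
    s2, and centering keeps the second moment bound 256 C^2; dividing by s2 >= c brings c into the
    denominator. *)
Lemma design_deviation (eps : R) : 0 < eps ->
  let D w := n%:R^-1 * \sum_(1 <= i < n.+1) r i w * x i w ord0 0 in
  measurable_fun setT D /\
  pr P [set w | eps <= `|D w / s2 - 1|] <= (256 * C ^+ 2 / (c * eps) ^+ 2) / n%:R.
Proof.
move=> eps0 D; have /andP[cs sC] := resid_var_bounds model n0 c0 Ac.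
have s20 : 0 < s2 by exact: lt_le_trans cs.
have E w i : r i w * x i w ord0 0 = r i w * dotp (e ord0) (x i w) by rewrite dotpe.
have mri i : (1 <= i <= n)%N -> measurable_fun setT (fun w => r i w * x i w ord0 0).
  move=> /rowi hi; under eq_fun do rewrite E.
  by apply: measurable_funM; exact: mlin.
have mD : measurable_fun setT D.
  by apply: measurable_funM => //; exact: (measurable_partial_sum mri).
split => //.
pose W i w := r i w * x i w ord0 0 - s2.
have mW i : (1 <= i <= n)%N -> measurable_fun setT (W i).
  by move=> hi; apply: measurable_funB => //; exact: mri.
have W2 i : (1 <= i <= n)%N -> integ P (fun w => W i w ^+ 2) /\
    mean P (fun w => W i w ^+ 2) <= 256 * C ^+ 2.
  move=> /rowi hi; have [i1 h1] := resid_lin_moment (e ord0) hi.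
  have [i2 h2] := mean_resid_lin (e ord0) hi.
  have ee : dotp (e ord0) (e ord0) = 1 by rewrite dotpe /e !mxE !eqxx.
  have e0 : e ord0 ord0 0 = 1 by rewrite /e !mxE !eqxx.
  have WE w : W i w ^+ 2 = (r i w * dotp (e ord0) (x i w)) ^+ 2 -
      2 * s2 * (r i w * dotp (e ord0) (x i w)) + s2 ^+ 2 by rewrite /W E; ring.
  have i3 : integ P (fun w => 2 * s2 * (r i w * dotp (e ord0) (x i w))) by exact: integZ.
  split.
    under eq_fun do rewrite WE; apply: integD; last exact: integ_cst.
    exact: integB.
  under eq_mean do rewrite WE.
  rewrite meanD; [|exact: integB|exact: integ_cst].
  rewrite meanB// meanZ// mean_cst h2 e0; move: h1; rewrite ee mulr1.
  by have := sqr_ge0 s2; nra.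
have W0 i : (1 <= i <= n)%N -> mean P (W i) = 0.
  move=> /rowi hi; have [i2 h2] := mean_resid_lin (e ord0) hi.
  have e0 : e ord0 ord0 0 = 1 by rewrite /e !mxE !eqxx.
  rewrite -[RHS](subrr s2) -[X in _ = X - _]mul1r -e0 -h2 -[X in _ - X](mean_cst P).
  rewrite -meanB//; last exact: integ_cst.
  by apply: eq_mean => w; rewrite /W E.
have pW i : (1 <= i <= n)%N -> @measurable_fun _ _ (obs x u [set i]) R setT (W i).
  move=> _; apply: measurable_funB => //; under eq_fun do rewrite E.
  by apply: measurable_funM; exact: obs_x.
have orth i j : (1 <= i <= n)%N -> (1 <= j <= n)%N -> (i < j)%N ->
    mean P (fun w => W i w * W j w) = 0.
  move=> hi hj ij; have [i1 _] := W2 _ hi; have [j1 _] := W2 _ hj.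
  have hI k : (1 <= k <= n)%N -> [set k] `<=` row by move=> hk _ ->; exact: rowi.
  have dij k : [set i] k -> ~ [set j] k by move=> -> /eqP; rewrite (ltn_eqF ij).
  have [] := obs_indep model (hI _ hi) (hI _ hj) dij (pW _ hi) (pW _ hj).
  - by apply: integ_sqr => //; exact: mW.
  - by apply: integ_sqr => //; exact: mW.
  by move=> _ ->; rewrite W0// mul0r.
have [i2 h2] := mean_sqr_sum mW (fun i hi => (W2 i hi).1) (fun i hi => (W2 i hi).2) orth (leqnn n).
pose Z w := (n%:R * s2)^-1 * \sum_(1 <= i < n.+1) W i w.
have nR : 0 < n%:R :> R by rewrite ltr0n.
have ZE w : D w / s2 - 1 = Z w.
  rewrite /D /Z /W sumrB big_const_nat subn1/= iter_addr addr0 -mulr_natl.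
  by field; rewrite !gt_eqF.
have mZ : measurable_fun setT Z by apply: measurable_funM => //; exact: (measurable_partial_sum mW).
have Z2E w : Z w ^+ 2 = (n%:R * s2)^-1 ^+ 2 * (\sum_(1 <= i < n.+1) W i w) ^+ 2 by rewrite /Z exprMn.
have iZ : integ P (fun w => Z w ^+ 2) by under eq_fun do rewrite Z2E; exact: integZ.
have mZ2 : mean P (fun w => Z w ^+ 2) <= 256 * C ^+ 2 / (c ^+ 2 * n%:R).
  under eq_mean do rewrite Z2E; rewrite meanZ//.
  apply: (@le_trans _ _ ((n%:R * s2)^-1 ^+ 2 * (n%:R * (256 * C ^+ 2)))).
    by rewrite ler_wpM2l ?sqr_ge0.
  have -> : (n%:R * s2)^-1 ^+ 2 * (n%:R * (256 * C ^+ 2)) = 256 * C ^+ 2 / (s2 ^+ 2 * n%:R).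
    by field; rewrite !gt_eqF.
  apply: ler_wpM2l; first by rewrite mulr_ge0 ?sqr_ge0.
  rewrite lef_pV2 ?posrE ?mulr_gt0 ?exprn_gt0//.
  by rewrite ler_pM2r// lerXn2r ?nnegrE// ltW.
under eq_set do rewrite ZE.
apply: (le_trans (pr_cheb eps0 mZ iZ)).
rewrite (_ : 256 * C ^+ 2 / (c * eps) ^+ 2 / n%:R = 256 * C ^+ 2 / (c ^+ 2 * n%:R) / eps ^+ 2).
  by rewrite ler_pM2r// invr_gt0 exprn_gt0.
by field; rewrite !gt_eqF.
Qed.

(** The substitute for conditional expectation given block J: in a finite sum of products, the
    factors from block I may be replaced by their means. *)
Lemma mean_freeze (K : finType) (I J : set nat) (B : R) (a b : K -> T -> R) :
  I `<=` row -> J `<=` row -> (forall i, I i -> ~ J i) ->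
  (forall k, @measurable_fun _ _ (obs x u I) R setT (a k)) ->
  (forall k, @measurable_fun _ _ (obs x u J) R setT (b k)) ->
  (forall k, integ P (a k)) -> (forall k w, `|b k w| <= B) ->
  integ P (fun w => \sum_k a k w * b k w) /\
  mean P (fun w => \sum_k a k w * b k w) = mean P (fun w => \sum_k mean P (a k) * b k w).
Proof.
move=> IR JR IJ ma mb ia bB.
have ib k : integ P (b k).
  by apply: (@integ_bnd _ _ _ P B) => //; exact: (obs_measurable_fun model JR (mb k)).
have h k := obs_indep model IR JR IJ (ma k) (mb k) (ia k) (ib k).
split; first by apply: integ_sum => k; have [] := h k.
rewrite !mean_sum; last by move=> k; have [] := h k.
  by apply: eq_bigr => k _; have [_ ->] := h k; rewrite meanZ.
by move=> k; exact: integZ.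
Qed.

(** Each product Y_i Y_j is a sum over pairs of coordinates of a first-half product [ab] times a
    product [bb] of entries of D, so [mean_freeze] reduces its mean to that with D held fixed. *)
Lemma remainder_moment (D : T -> 'cV[R]_q.+1) (B : R) : 0 <= B ->
  (forall k, @measurable_fun _ _ (obs x u [set i | (n < i <= 2 * n)%N]) R setT
    (fun w => D w k 0)) ->
  (forall w, D w ord0 0 = 0) -> (forall w, dotp (D w) (D w) <= B ^+ 2) ->
  let S w := \sum_(1 <= i < n.+1) r i w * dotp (D w) (x i w) in
  [/\ measurable_fun setT S, integ P (fun w => S w ^+ 2) &
    mean P (fun w => S w ^+ 2) <= n%:R * (256 * C ^+ 2 * B ^+ 2)].
Proof.
move=> B0 mD D0 DB S; pose J : set nat := [set i | (n < i <= 2 * n)%N].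
have JR : J `<=` row by move=> i /andP[h1 h2]; rewrite /row /= h2 (leq_ltn_trans _ h1).
have DkB k w : `|D w k 0| <= B.
  rewrite -ler_sqr ?nnegrE// real_normK ?num_real//; apply: le_trans (DB w).
  rewrite /dotp (bigD1 k)//= expr2 lerDl sumr_ge0// => j _; by rewrite -expr2 sqr_ge0.
have mDT k := obs_measurable_fun model JR (mD k).
pose a i k w := r i w * dotp (e k) (x i w).
have ma (I : set nat) i k : I i -> @measurable_fun _ _ (obs x u I) R setT (a i k).
  by move=> Ii; apply: measurable_funM; exact: obs_x.
have maT i k : row i -> measurable_fun setT (a i k).
  by move=> hi; apply: measurable_funM; exact: mlin.
have ia2 i k : row i -> integ P (fun w => a i k w ^+ 2).
  by move=> hi; have [] := resid_lin_moment (e k) hi.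
have ia i k : row i -> integ P (a i k).
  by move=> hi; apply: integ_sqr; [exact: maT|exact: ia2].
have mea i k : row i -> k != ord0 -> mean P (a i k) = 0.
  move=> hi k0; have [_ ->] := mean_resid_lin (e k) hi.
  by rewrite /e !mxE eq_sym (negbTE k0) mul0r.
pose Y i w : R := r i w * dotp (D w) (x i w).
have YE i w : Y i w = \sum_k a i k w * D w k 0.
  rewrite /Y /dotp mulr_sumr; apply: eq_bigr => k _.
  by rewrite /a dotpe; ring.
pose ab i j (kl : 'I_q.+1 * 'I_q.+1) w := a i kl.1 w * a j kl.2 w.
pose bb (kl : 'I_q.+1 * 'I_q.+1) w := D w kl.1 0 * D w kl.2 0.
have YYE i j w : Y i w * Y j w = \sum_kl ab i j kl w * bb kl w.
  rewrite !YE big_distrlr/= pair_big/=; apply: eq_bigr => -[k l] _.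
  by rewrite /ab /bb/=; ring.
have mbb kl : @measurable_fun _ _ (obs x u J) R setT (bb kl).
  by apply: measurable_funM; exact: mD.
have bbB kl w : `|bb kl w| <= B * B by rewrite normrM ler_pM.
have mab (I : set nat) i j kl : I i -> I j -> @measurable_fun _ _ (obs x u I) R setT (ab i j kl).
  by move=> Ii Ij; apply: measurable_funM; exact: ma.
have iab i j kl : row i -> row j -> integ P (ab i j kl).
  by move=> hi hj; apply: integM; [exact: maT|exact: maT|exact: ia2|exact: ia2].
have frz i j : (1 <= i <= n)%N -> (1 <= j <= n)%N ->
    integ P (fun w => Y i w * Y j w) /\
    mean P (fun w => Y i w * Y j w) = mean P (fun w => \sum_kl mean P (ab i j kl) * bb kl w).
  move=> hi hj; under eq_fun do rewrite YYE.
  apply: (@mean_freeze _ [set k | (1 <= k <= n)%N] J (B * B)) => //.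
  - by move=> k /andP[_ h1] /andP[h2 _]; rewrite ltnNge h1 in h2.
  - by move=> kl; exact: mab.
  - by move=> kl; apply: iab; exact: rowi.
have mY i : (1 <= i <= n)%N -> measurable_fun setT (Y i).
  move=> /rowi hi; rewrite (_ : Y i = fun w => \sum_k a i k w * D w k 0); last exact/funext.
  by apply: measurable_sum => k; apply: measurable_funM; [exact: maT|exact: mDT].
have Y2 i : (1 <= i <= n)%N -> integ P (fun w => Y i w ^+ 2) /\
    mean P (fun w => Y i w ^+ 2) <= 256 * C ^+ 2 * B ^+ 2.
  move=> hi; have [h1 h2] := frz i i hi hi; have hr := rowi hi.
  have -> : (fun w => Y i w ^+ 2) = (fun w => Y i w * Y i w).
    by apply/funext => w; rewrite expr2.
  split => //; rewrite h2.
  rewrite -[leRHS](mean_cst P); apply: mean_le; [|exact: integ_cst|].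
    apply: integ_sum => kl; apply: integZ; apply: (@integ_bnd _ _ _ P (B * B)) => //.
    exact: (obs_measurable_fun model JR (mbb kl)).
  move=> w; have [i3 h3] := resid_lin_moment (D w) hr.
  apply: (@le_trans _ _ (256 * C ^+ 2 * dotp (D w) (D w))); last first.
    by rewrite ler_wpM2l// mulr_ge0// sqr_ge0.
  apply: le_trans h3; rewrite le_eqVlt; apply/orP; left; apply/eqP.
  have E w' : (r i w' * dotp (D w) (x i w')) ^+ 2 = \sum_kl bb kl w * ab i i kl w'.
    have E1 : r i w' * dotp (D w) (x i w') = \sum_k a i k w' * D w k 0.
      by rewrite /dotp mulr_sumr; apply: eq_bigr => k _; rewrite /a dotpe; ring.
    rewrite expr2 E1 big_distrlr/= pair_big/=; apply: eq_bigr => -[k l] _.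
    by rewrite /ab /bb/=; ring.
  under [RHS]eq_mean do rewrite E.
  rewrite mean_sum => [|kl]; last by apply: integZ; exact: iab.
  by apply: eq_bigr => kl _; rewrite meanZ ?(mulrC (bb _ _))//; exact: iab.
have orth i j : (1 <= i <= n)%N -> (1 <= j <= n)%N -> (i < j)%N ->
    mean P (fun w => Y i w * Y j w) = 0.
  move=> hi hj ij; have [_ ->] := frz i j hi hj.
  rewrite -[RHS](mean_cst P); apply: eq_mean => w; apply: big1 => -[k l] _.
  (* The first coordinate is removed by D, the others by orthogonality of the residual. *)
  have [k0|k0] := eqVneq k ord0; first by rewrite /bb /= k0 D0 mul0r mulr0.
  have hI i' : (1 <= i' <= n)%N -> [set i'] `<=` row by move=> hi' _ ->; exact: rowi.
  have dij i' : [set i] i' -> ~ [set j] i' by move=> -> /eqP; rewrite (ltn_eqF ij).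
  have [_ h] := obs_indep model (hI _ hi) (hI _ hj) dij (ma _ _ k erefl) (ma _ _ l erefl)
    (ia _ k (rowi hi)) (ia _ l (rowi hj)).
  by rewrite /ab /= h mea ?mul0r//; exact: rowi.
have [i2 h2] := mean_sqr_sum mY (fun i hi => (Y2 i hi).1) (fun i hi => (Y2 i hi).2) orth (leqnn n).
by split => //; exact: (measurable_partial_sum mY).
Qed.

End remainder.

(** * Expansion of the estimator outside a small event *)

Section row_expansion.
Context {d} {T : measurableType d} {R : realType} {q : nat}.
Variables (P : probability T R) (n : nat) (Sigma : 'M[R]_q.+1) (tau : 'cV[R]_q.+1)
  (f : R * R -> R) (x : nat -> T -> 'cV[R]_q.+1) (u : nat -> T -> R).
Hypothesis model : single_index_model P n Sigma tau f x u.
Hypothesis n0 : (0 < n)%N.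
Variables (c C : R).
Hypotheses (c0 : 0 < c) (Ac : forall v : 'cV[R]_q.+1,
  c * dotp v v <= dotp v (Sigma *m v) <= C * dotp v v).
Variables (lam : R) (bhat : T -> 'cV[R]_q.+1).
Notation y := (response tau f x u).
Hypothesis pilot : pilot_estimator n lam x y bhat.

Notation r := (resid P n x).
Notation s2 := (resid_var P n Sigma x).
Notation sd := (score_sd P n tau f x u).
Notation beta := (slope P n tau f x u *: tau).

Let J : set nat := [set i | (n < i <= 2 * n)%N].

Lemma obs_pilot k : @measurable_fun _ _ (obs x u J) R setT (fun w => bhat w k 0).
Proof.
move=> _ B mB; rewrite setTI; have [_ /(_ k B mB)] := pilot.
apply: smallest_sub; first exact: sigma_algebra_measurable.
move=> _ [[i o] /= hi [A mA <-]]; rewrite -[X in measurable X]setTI.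
case: o => [j|]; last exact: (obs_y model).
have E w : x i w j 0 = dotp (delta_mx j 0) (x i w).
  rewrite /dotp (bigD1 j)//= big1 => [|l lj]; rewrite !mxE ?eqxx ?mul1r ?addr0//.
  by rewrite (negbTE lj) mul0r.
by rewrite (_ : (fun w => x i w j 0) = fun w => dotp (delta_mx j 0) (x i w));
  [exact: obs_x|exact/funext].
Qed.

Variable B0 : R.
Hypothesis B00 : 0 <= B0.
Let E := [set w | norm2 (bhat w - beta) <= B0].

Let mE : @measurable _ (obs x u J) E.
Proof.
apply: measurable_le => //; apply: (measurableT_comp (continuous_measurable_fun (@sqrt_continuous R))).
apply: measurable_sum => k; rewrite (_ : (fun w => _) =
    fun w => (bhat w k 0 - beta k 0) * (bhat w k 0 - beta k 0)).
  by apply: measurable_funM; apply: measurable_funB => //; exact: obs_pilot.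
by apply/funext => w; rewrite !mxE.
Qed.

Let JR : J `<=` [set i | (1 <= i <= 2 * n)%N].
Proof. by move=> i /andP[h1 h2]; rewrite /= h2 (leq_ltn_trans _ h1). Qed.

Lemma pilot_event_measurable : measurable E.
Proof. exact: (obs_measurable model JR). Qed.

(** The indicator makes the norm bound hold everywhere, as [remainder_moment] requires, and E is
    itself an event of the second half. *)
Let D w : 'cV[R]_q.+1 := \col_k (\1_E w * (if k == ord0 then 0 else beta k 0 - bhat w k 0)).

Let mD k : @measurable_fun _ _ (obs x u J) R setT (fun w => D w k 0).
Proof.
rewrite (_ : (fun w => _) = fun w => \1_E w * (if k == ord0 then 0 else beta k 0 - bhat w k 0)).
  apply: measurable_funM; first exact: measurable_indic.
  by case: (k == ord0) => //; apply: measurable_funB => //; exact: obs_pilot.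
by apply/funext => w; rewrite mxE.
Qed.

Let DB w : dotp (D w) (D w) <= B0 ^+ 2.
Proof.
have [Ew|Ew] := boolP (w \in E); last first.
  rewrite /dotp big1 ?sqr_ge0// => k _; rewrite !mxE indicE (negbTE Ew) /=; ring.
apply: (@le_trans _ _ (norm2 (bhat w - beta) ^+ 2)); last first.
  by rewrite lerXn2r ?nnegrE ?sqrtr_ge0//; move: Ew; rewrite inE.
rewrite sqr_sqrtr ?dotp_ge0//; apply: ler_sum => k _.
rewrite !mxE indicE Ew/= mul1r; case: ifP => _; first by rewrite mul0r -expr2 sqr_ge0.
by rewrite le_eqVlt; apply/orP; left; apply/eqP; ring.
Qed.

Let V w := (Num.sqrt n%:R)^-1 * \sum_(1 <= i < n.+1) score P n tau f x u i w.
Let S w := \sum_(1 <= i < n.+1) r i w * dotp (D w) (x i w).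
Let H w := n%:R^-1 * \sum_(1 <= i < n.+1) r i w * x i w ord0 0.

Let sqrtn0 : 0 < Num.sqrt n%:R :> R.
Proof. by rewrite sqrtr_gt0 ltr0n. Qed.

Let s20 : 0 < s2.
Proof. by have /andP[+ _] := resid_var_bounds model n0 c0 Ac; exact: lt_le_trans. Qed.

(** The error of the pilot in the first coordinate enters the numerator multiplied by the
    denominator itself, so it cancels exactly against bhat_1 - beta_1; this is the effect of the
    debiasing. *)
Let debiased_expansion w : 0 < sd -> E w -> H w != 0 ->
  Num.sqrt n%:R * (debiased n (r^~ w) (x^~ w) (y^~ w) (bhat w) - beta ord0 0) =
  sd / s2 * ((V w + (Num.sqrt n%:R * sd)^-1 * S w) / (H w / s2)).
Proof.
move=> sd0 Ew; rewrite /H /debiased; set G := \sum_(1 <= i < n.+1) _ * _ => H0.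
have := sqr_sqrtr (ler0n R n); rewrite /V; move: sqrtn0.
set N := Num.sqrt _ => N0 nR.
have G0 : G != 0 by apply: contra_neq H0 => ->; rewrite mulr0.
have nu : \sum_(1 <= i < n.+1) r i w * (y i w - dotp (x i w) (bhat w)) =
    (beta ord0 0 - bhat w ord0 0) * G + S w + sd * \sum_(1 <= i < n.+1) score P n tau f x u i w.
  rewrite /G /S !mulr_sumr -!big_split/=; apply: eq_bigr => i _.
  have -> : sd * score P n tau f x u i w = r i w * noise P n tau f x u i w.
    by rewrite /score mulrA divff ?mul1r// gt_eqF.
  rewrite /noise.
  have -> : dotp (D w) (x i w) = slope P n tau f x u * dotp tau (x i w) -
      dotp (x i w) (bhat w) - (beta ord0 0 - bhat w ord0 0) * x i w ord0 0.
    rewrite -dotpZl (dotpC (x i w)) /dotp -sumrB [RHS](_ : _ =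
      \sum_k (beta k 0 * x i w k 0 - bhat w k 0 * x i w k 0
        - (if k == ord0 then (beta k 0 - bhat w k 0) * x i w k 0 else 0))).
      apply: eq_bigr => k _; rewrite ![in LHS]mxE indicE mem_set//= mul1r.
      by case: ifP => _; rewrite ?mxE; ring.
    by rewrite [RHS]sumrB -big_mkcond/= big_pred1_eq.
  by ring.
rewrite nu -nR; field.
by rewrite G0 !gt_eqF.
Qed.

(** The three terms pay for failure of the pilot rate, a large remainder, and a design average far
    from s2. L stands in for [sd], so the bound can be uniform over rows. *)
Lemma row_expansion (L eps : R) : 0 < L -> L <= sd -> 0 < eps < 1 ->
  exists N : set T, [/\ measurable N,
    pr P N <= (1 - pr P E) + 256 * C ^+ 2 * B0 ^+ 2 / (L * eps) ^+ 2 +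
      (256 * C ^+ 2 / (c * eps) ^+ 2) / n%:R &
    forall w, ~ N w -> exists b h : R, [/\ `|b| < eps, `|h - 1| < eps &
      Num.sqrt n%:R * (debiased n (r^~ w) (x^~ w) (y^~ w) (bhat w) - beta ord0 0) =
      sd / s2 * (((Num.sqrt n%:R)^-1 * \sum_(1 <= i < n.+1) score P n tau f x u i w + b) / h)]].
Proof.
move=> L0 Lsd /andP[eps0 eps1]; have sd0 : 0 < sd by exact: lt_le_trans Lsd.
have D0 w : D w ord0 0 = 0 by rewrite mxE eqxx mulr0.
have [mS iS hS] := remainder_moment model n0 c0 Ac B00 mD D0 DB.
have [mH hH] := design_deviation model n0 c0 Ac eps0.
pose Z w := (Num.sqrt n%:R * sd)^-1 * S w.
have mZ : measurable_fun setT Z by exact: measurable_funM.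
have ZE w : Z w ^+ 2 = (Num.sqrt n%:R * sd)^-1 ^+ 2 * S w ^+ 2 by rewrite /Z exprMn.
have iZ : integ P (fun w => Z w ^+ 2) by under eq_fun do rewrite ZE; exact: integZ.
have nR : 0 < n%:R :> R by rewrite ltr0n.
have hZ : mean P (fun w => Z w ^+ 2) <= 256 * C ^+ 2 * B0 ^+ 2 / L ^+ 2.
  under eq_mean do rewrite ZE; rewrite meanZ// exprVn exprMn sqr_sqrtr ?(ltW nR)//.
  apply: (@le_trans _ _ (256 * C ^+ 2 * B0 ^+ 2 / sd ^+ 2)).
    rewrite ler_pdivrMl ?mulr_gt0 ?exprn_gt0//; apply: (le_trans hS).
    by rewrite le_eqVlt; apply/orP; left; apply/eqP; field; rewrite gt_eqF.
  apply: ler_wpM2l; first by apply: mulr_ge0; [apply: mulr_ge0 => //|]; exact: sqr_ge0.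
  by rewrite lef_pV2 ?posrE ?exprn_gt0// lerXn2r ?nnegrE// ltW.
have mN1 : measurable [set w | eps <= `|Z w|] by apply: measurable_le => //; exact: measurableT_comp.
have mN2 : measurable [set w | eps <= `|H w / s2 - 1|].
  apply: measurable_le => //; apply: measurableT_comp => //.
  by apply: measurable_funB => //; exact: measurable_funM.
have mEc : measurable (~` E) by apply: measurableC; exact: pilot_event_measurable.
exists (~` E `|` [set w | eps <= `|Z w|] `|` [set w | eps <= `|H w / s2 - 1|]); split.
- by apply: measurableU => //; exact: measurableU.
- apply: (le_trans (prU P (measurableU _ _ mEc mN1) mN2)).
  apply: lerD; last exact: hH.
  apply: (le_trans (prU P mEc mN1)).
  rewrite prC ?lerD//; last exact: pilot_event_measurable.
  apply: (le_trans (pr_cheb eps0 mZ iZ)).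
  rewrite (_ : _ / (L * eps) ^+ 2 = 256 * C ^+ 2 * B0 ^+ 2 / L ^+ 2 / eps ^+ 2).
    by rewrite ler_pM2r// invr_gt0 exprn_gt0.
  by field; rewrite !gt_eqF.
- move=> w /not_orP[/not_orP[/contrapT Ew /negP]]; rewrite -ltNge => h1 /negP; rewrite -ltNge => h2.
  exists (Z w), (H w / s2); split => //; apply: debiased_expansion => //.
  (* H = 0 would put H / s2 at distance 1 > eps from 1. *)
  apply: contraTneq h2 => ->; rewrite mul0r sub0r normrN normr1 -leNgt ltW//.
Qed.

End row_expansion.

(** * Slutsky's argument and the passage to the limit *)

Lemma slutsky_cdf (R : realType) (d : nat -> measure_display)
    (T : forall n : nat, measurableType (d n)) (P : forall n : nat, probability (T n) R)
    (V Xi : forall n, T n -> R) :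
  (forall n, measurable_fun setT (V n)) -> (forall n, measurable_fun setT (Xi n)) ->
  (forall t, (fun n => pr (P n) [set w | V n w <= t]) @ \oo --> Phi t) ->
  (forall eps : R, 0 < eps < 1 -> exists2 rho : nat -> R, rho @ \oo --> (0 : R) &
    forall n, (0 < n)%N -> exists N : set (T n), [/\ measurable N, pr (P n) N <= rho n &
      forall w, ~ N w -> exists b h : R, [/\ `|b| < eps, `|h - 1| < eps &
        Xi n w = (V n w + b) / h]]) ->
  forall t, (fun n => pr (P n) [set w | Xi n w <= t]) @ \oo --> Phi t.
Proof.
move=> mV mX cV hN t; apply/cvgrPdist_le => e e0.
(* Outside N, Xi <= t means V <= t h - b, and this threshold is within eta = eps (|t| + 1) <= e / 3
   of t. The other two thirds of e go to the exceptional event and to the convergence of the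
   distribution functions of V. *)
pose eps := Num.min 2^-1 (e / (3 * (`|t| + 1))).
have t1 : 0 < `|t| + 1 by rewrite ltr_wpDl.
have eps0 : 0 < eps by rewrite lt_min; apply/andP; split; [lra|rewrite divr_gt0// mulr_gt0].
have eps1 : eps < 1 by rewrite gt_min (_ : 2^-1 < 1)//; lra.
pose eta := eps * (`|t| + 1).
have eta0 : 0 < eta by rewrite mulr_gt0.
have etae : eta <= e / 3.
  rewrite /eta (@le_trans _ _ (e / (3 * (`|t| + 1)) * (`|t| + 1)))//.
    by rewrite ler_pM2r// ge_min lexx orbT.
  by rewrite le_eqVlt; apply/orP; left; apply/eqP; field; rewrite gt_eqF.
have eps01 : 0 < eps < 1 by rewrite eps0.
have [rho rho0 hrho] := hN eps eps01.
have ml n s : measurable [set w | V n w <= s] by exact: measurable_le.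
have mx n s : measurable [set w | Xi n w <= s] by exact: measurable_le.
have c1 := cV (t + eta); have c2 := cV (t - eta).
have e3 : 0 < e / 3 by rewrite divr_gt0.
have p1 := @Phi_lip R t (t + eta); have p2 := @Phi_lip R (t - eta) t.
near=> n.
have n0 : (0 < n)%N by near: n; exact: nbhs_infty_gt.
have [N [mN pN hN']] := hrho n n0.
have r3 : rho n <= e / 3.
  suff : `|0 - rho n| <= e / 3 by rewrite sub0r normrN; exact: le_trans (ler_norm _).
  by near: n; move/cvgrPdist_le : rho0; exact.
have q1 : `|Phi (t + eta) - pr (P n) [set w | V n w <= t + eta]| <= e / 3.
  by near: n; move/cvgrPdist_le : c1; exact.
have q2 : `|Phi (t - eta) - pr (P n) [set w | V n w <= t - eta]| <= e / 3.
  by near: n; move/cvgrPdist_le : c2; exact.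
have key w : ~ N w -> (Xi n w <= t -> V n w <= t + eta) /\ (V n w <= t - eta -> Xi n w <= t).
  move=> /hN'[b [h [b1 h1 ->]]].
  have hp : 0 < h by move: h1; rewrite ltr_norml => /andP[]; lra.
  rewrite ler_pdivrMr//.
  have : `|t * (h - 1)| <= `|t| * eps by rewrite normrM ler_wpM2l// ltW.
  move: b1; rewrite ler_norml ltr_norml /eta => /andP[b1 b2] /andP[b3 b4].
  by split => hh; nra.
have u1 : pr (P n) [set w | Xi n w <= t] <= pr (P n) [set w | V n w <= t + eta] + rho n.
  apply: (@le_trans _ _ (pr (P n) ([set w | V n w <= t + eta] `|` N))).
    apply: pr_le => //; first exact: measurableU.
    move=> w hw; have [Nw|Nw] := pselect (N w); first by right.
    by left; have [+ _] := key w Nw; exact.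
  by apply: (le_trans (prU (P n) (ml n _) mN)); rewrite lerD2l.
have u2 : pr (P n) [set w | V n w <= t - eta] <= pr (P n) [set w | Xi n w <= t] + rho n.
  apply: (@le_trans _ _ (pr (P n) ([set w | Xi n w <= t] `|` N))).
    apply: pr_le => //; first exact: measurableU.
    move=> w hw; have [Nw|Nw] := pselect (N w); first by right.
    by left; have [_] := key w Nw; exact.
  by apply: (le_trans (prU (P n) (mx n _) mN)); rewrite lerD2l.
have p1' : Phi (t + eta) <= Phi t + eta by have := p1; rewrite lerDl ltW// => /(_ isT); lra.
have p2' : Phi t <= Phi (t - eta) + eta.
  by have := p2; rewrite gerBl ltW// => /(_ isT); lra.
move: q1 q2; rewrite !ler_norml => /andP[q1 q1'] /andP[q2 q2'].
by apply/andP; split; lra.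
Unshelve. all: by end_near. Qed.

(** Writing 1/g as g times the power -1 of g^2 reduces to a nonnegative base; at g = 0 both sides
    are 0, the inverse of 0 being 0. *)
Lemma measurable_fun_inv {d} {T : measurableType d} {R : realType} (g : T -> R) :
  measurable_fun setT g -> measurable_fun setT (fun w => (g w)^-1).
Proof.
move=> mg; rewrite (_ : (fun w => _) = fun w => g w * (g w ^+ 2) `^ (-1)).
  apply: measurable_funM => //; apply: (measurableT_comp (measurable_powR _)).
  exact: measurable_funX.
apply/funext => w; rewrite powR_inv1 ?sqr_ge0//.
have [->|g0] := eqVneq (g w) 0; first by rewrite invr0 mul0r.
by field.
Qed.

Lemma measurable_debiased {d} {T : measurableType d} {R : realType} {q n : nat}
    (r : nat -> T -> R) (x : nat -> T -> 'cV[R]_q.+1) (y : nat -> T -> R)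
    (bhat : T -> 'cV[R]_q.+1) :
  (forall i, (1 <= i <= n)%N -> measurable_fun setT (r i)) ->
  (forall i k, (1 <= i <= n)%N -> measurable_fun setT (fun w => x i w k 0)) ->
  (forall i, (1 <= i <= n)%N -> measurable_fun setT (y i)) ->
  (forall k, measurable_fun setT (fun w => bhat w k 0)) ->
  measurable_fun setT (fun w => debiased n (r^~ w) (x^~ w) (y^~ w) (bhat w)).
Proof.
move=> mr mx my mb; apply: measurable_funD => //; apply: measurable_funM.
  apply: (@measurable_partial_sum _ _ _ n (fun i w => r i w * (y i w - dotp (x i w) (bhat w)))) => //.
  move=> i hi; apply: measurable_funM; first exact: mr.
  apply: measurable_funB; first exact: my.
  by apply: measurable_sum => k; apply: measurable_funM => //; exact: mx.
apply: measurable_fun_inv.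
apply: (@measurable_partial_sum _ _ _ n (fun i w => r i w * x i w ord0 0)) => // i hi.
by apply: measurable_funM; [exact: mr|exact: mx].
Qed.

Lemma cvg_inv_nat (R : realType) (a : R) : (fun n : nat => a / n%:R) @ \oo --> (0 : R).
Proof.
have h := @cvg_inv_sqrtn R 1.
rewrite (_ : (fun n => _) = fun n : nat => a * ((1 * (Num.sqrt n%:R)^-1) * (1 * (Num.sqrt n%:R)^-1))).
  rewrite -(mulr0 a) -[X in a * X](mulr0 0).
  by apply: cvgM; [exact: cvg_cst|exact: cvgM].
by apply/funext => n; rewrite !mul1r -expr2 exprVn sqr_sqrtr.
Qed.

(** ln p <= (ln p)^2 / ln 2: for p >= 2 because ln p >= ln 2, and for p <= 1 because ln p is 0,
    including the default value at 0. *)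
Lemma cvg_sparsity (R : realType) (s p : nat -> nat) :
  (fun n : nat => (s n)%:R * ln (p n)%:R ^+ 2 / n%:R : R) @ \oo --> (0 : R) ->
  (fun n : nat => (s n)%:R * ln (p n)%:R / n%:R : R) @ \oo --> (0 : R).
Proof.
move=> hs; have l2 : 0 < ln 2 :> R by rewrite ln_gt0// ltr1n.
have hp n : 0 <= ln (p n)%:R :> R.
  by case: (p n) => [|k]; [rewrite ln0|rewrite ln_ge0// ler1n].
have hle n : (s n)%:R * ln (p n)%:R / n%:R <=
    (ln 2)^-1 * ((s n)%:R * ln (p n)%:R ^+ 2 / n%:R) :> R.
  have h : ln (p n)%:R <= (ln 2)^-1 * ln (p n)%:R ^+ 2 :> R.
    case: (p n) => [|[|k]].
    - by rewrite ln0// expr0n/= mulr0.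
    - by rewrite ln1 expr0n/= mulr0.
    rewrite ler_pdivlMl// expr2 ler_wpM2r ?ln_ge0 ?ler1n//.
    by rewrite ler_ln ?posrE ?ltr0n// ler_nat.
  rewrite !mulrA ler_wpM2r ?invr_ge0// [_ * (s n)%:R]mulrC -!mulrA ler_wpM2l//.
apply: (@squeeze_cvgr _ _ _ _ (fun=> 0)
  (fun n => (ln 2)^-1 * ((s n)%:R * ln (p n)%:R ^+ 2 / n%:R))).
- by apply: nearW => n; rewrite hle andbT divr_ge0// mulr_ge0.
- exact: cvg_cst.
- by rewrite -[X in _ --> X](mulr0 (ln 2)^-1); apply: cvgM => //; exact: cvg_cst.
Qed.

Theorem theorem1 (R : realType)
    (d : nat -> measure_display) (T : forall n : nat, measurableType (d n))
    (P : forall n : nat, probability (T n) R)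
    (q : nat -> nat)
    (Sigma : forall n : nat, 'M[R]_((q n).+1))
    (tau : forall n : nat, 'cV[R]_((q n).+1))
    (f : nat -> R * R -> R)
    (x : forall n : nat, nat -> T n -> 'cV[R]_((q n).+1))
    (u : forall n : nat, nat -> T n -> R)
    (lam : nat -> R)
    (bhat : forall n : nat, T n -> 'cV[R]_((q n).+1))
    (c C alpha M : R) :
  let p (n : nat) : nat := (q n).+1 in
  let y (n : nat) := response (tau n) (f n) (x n) (u n) in
  let mu (n : nat) : R :=
    fine 'E_(P n)[(fun w => y n n w * dotp (x n n w) (tau n))%R] in
  let beta (n : nat) : 'cV[R]_((q n).+1) := mu n *: tau n in
  let z (n i : nat) (w : T n) : R := y n i w - dotp (x n i w) (beta n) in
  let gamma (n : nat) : 'cV[R]_(q n) := node_coef (P n) (x n n) in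
  let r (n i : nat) (w : T n) : R := node_resid (gamma n) (x n i w) in
  let nu (n : nat) : R :=
    Num.sqrt (fine 'E_(P n)[(fun w => r n n w ^+ 2 * z n n w ^+ 2)%R]
              / fine 'E_(P n)[(fun w => r n n w ^+ 2)%R] ^+ 2) in
  let btilde (n : nat) (w : T n) : R :=
    debiased n ((r n)^~ w) ((x n)^~ w) ((y n)^~ w) (bhat n w) in
  let s (n : nat) : nat := norm0 (beta n) in
  forall
    (hmodel : forall n, (0 < n)%N ->
       single_index_model (P n) n (Sigma n) (tau n) (f n) (x n) (u n))
    (hmu : forall n, (0 < n)%N -> mu n != 0)
    (hpilot : forall n, (0 < n)%N ->
       pilot_estimator n (lam n) (x n) (y n) (bhat n))
    (hlam : lesssim
       (fun n => subgaussian_const (P n) (x n n) * psi2_norm (P n) (z n n)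
                 * (Num.sqrt (ln (p n)%:R / n%:R))%:E)%E
       (fun n => (lam n)%:E))
    (hnu : exists2 nu0 : R, 0 < nu0 & forall n, (0 < n)%N -> nu0 <= nu n)
    (hs : ((s n)%:R * ln (p n)%:R ^+ 2 / n%:R : R) @[n --> \oo] --> (0 : R))
    (hc : 0 < c)
    (hSigma : forall n, (0 < n)%N ->
       c <= lambda_min (Sigma n) /\ lambda_min (Sigma n) <= lambda_max (Sigma n)
       /\ lambda_max (Sigma n) <= C)
    (halpha : 0 < alpha)
    (hM : 0 < M)
    (hmoment : forall n, (0 < n)%N ->
       ('E_(P n)[(fun w => `|y n n w| `^ (2 + alpha))%R] <= M%:E)%E)
    (hrate : exists2 K : R, 0 < K &
       P n [set w | norm2 (bhat n w - beta n)
                    <= K * Num.sqrt ((s n)%:R * ln (p n)%:R / n%:R)]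
         @[n --> \oo] --> 1%E),
  exists Xi : forall n : nat, {RV (P n) >-> R},
    (forall n, (0 < n)%N -> forall w : T n,
       Num.sqrt n%:R * (btilde n w - beta n ord0 0) = nu n * Xi n w) /\
    cvg_in_distribution Xi (normal_prob 0 1).
Proof.
move=> p y mu beta z gamma r nu btilde s hmodel _ hpilot _ [nu0 nu00 hnu] hs hc hSigma
  halpha hM hmoment [K K0 hrate].
have [a [m [a01 lyap]]] := lyapunov_product halpha.
(* 2 m' is an even order above 2 + alpha, for the Gaussian part of the noise. *)
pose m' := (Num.truncn (2 + alpha)).+1.
have hm' : 2 + alpha <= (2 * m')%:R.
  apply: (@le_trans _ _ m'%:R); first by rewrite ltW// truncnS_gt.
  by rewrite ler_nat leq_pmull.
have Ac n : (0 < n)%N -> forall v : 'cV[R]_(q n).+1,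
    c * dotp v v <= dotp v (Sigma n *m v) <= C * dotp v v.
  move=> n0; have [h1 [_ h2]] := hSigma n n0; apply: eigenvalue_bounds => //.
  by case: (sim_posdef (hmodel n n0)).
have rE n i w : r n i w = resid (P n) n (x n) i w by exact: node_residE.
have zE n i w : z n i w = noise (P n) n (tau n) (f n) (x n) (u n) i w.
  by rewrite /z /noise /beta dotpZr (dotpC (x n i w)).
pose sd n := score_sd (P n) n (tau n) (f n) (x n) (u n).
pose s2 n := resid_var (P n) n (Sigma n) (x n).
have nuE n : (0 < n)%N -> nu n = Num.sqrt (score_var (P n) n (tau n) (f n) (x n) (u n) / s2 n ^+ 2).
  move=> n0; rewrite /nu; congr (Num.sqrt (_ / _ ^+ 2)).
    by apply: eq_mean => w; rewrite rE zE.
  have hn : (1 <= n <= 2 * n)%N by rewrite n0 leq_pmull.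
  have [_ h] := lin_sqr (hmodel n n0) (resid_dir (P n) n (x n)) hn.
  rewrite /s2 /resid_var -h.
  by apply: eq_mean => w; rewrite rE.
have nub n : (0 < n)%N -> nu0 <= Num.sqrt (score_var (P n) n (tau n) (f n) (x n) (u n) / s2 n ^+ 2).
  by move=> n0; rewrite -nuE//; exact: hnu.
have s20 n : (0 < n)%N -> 0 < s2 n.
  by move=> n0; exact: (resid_var_gt0 (hmodel n n0) n0 hc (Ac n n0)).
have nusd n : (0 < n)%N -> nu n = sd n / s2 n.
  move=> n0; rewrite nuE// sqrtrM; last by apply: mean_ge0 => w; rewrite mulr_ge0 ?sqr_ge0.
  by rewrite sqrtrV ?sqr_ge0// sqrtr_sqr gtr0_norm// s20.
have nun0 n : (0 < n)%N -> nu n != 0 by move=> /hnu h; rewrite gt_eqF// (lt_le_trans nu00).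
pose X n i w := score (P n) n (tau n) (f n) (x n) (u n) i w.
have pos n i : (1 <= i <= n)%N -> (0 < n)%N by move=> /andP[h1 h2]; exact: leq_trans h2.
have mX n i : (1 <= i <= n)%N -> measurable_fun setT (X n i).
  by move=> hi; have n0 := pos _ _ hi; exact: (score_meas (hmodel n n0) hi).
have sqr n i (hi : (1 <= i <= n)%N) := let n0 := pos n i hi in
  score_sqr (hmodel n n0) n0 hc (Ac n n0) halpha hM (hmoment n n0) a01 lyap hm' nu00 (nub n n0) hi.
have lya n i (hi : (1 <= i <= n)%N) := let n0 := pos n i hi in
  score_lyapunov (hmodel n n0) n0 hc (Ac n n0) halpha hM (hmoment n n0) a01 lyap hm' nu00 (nub n n0) hi.
have clt := @clt_array R d T P X a (score_cst c C alpha M a m m' nu0) a01 mX.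
pose V n w := (Num.sqrt n%:R)^-1 * \sum_(1 <= i < n.+1) X n i w.
have cV t : (fun n => pr (P n) [set w | V n w <= t]) @ \oo --> Phi t.
  apply: clt.
  - by move=> n i hi; have [] := sqr n i hi.
  - move=> n i hi; have n0 := pos _ _ hi.
    exact: (score_mean0 (hmodel n n0) n0 halpha (hmoment n n0) hi).
  - by move=> n i hi; have [] := sqr n i hi.
  - by move=> n i hi; have [] := lya n i hi.
  - by move=> n i hi; have [] := lya n i hi.
  - move=> n i j hi hj ij; have n0 := pos _ _ hi.
    exact: (score_orth (hmodel n n0) n0 hc (Ac n n0) halpha hM (hmoment n n0) a01 lyap hm'
      nu00 (nub n n0) hi hj ij).
  - move=> n k g h kn; have n0 : (0 < n)%N := leq_ltn_trans (leq0n k) kn.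
    exact: (score_indep (hmodel n n0) kn).
(* The model is assumed for n > 0 only; the value 0 at n = 0 gives a random variable at every
   index. *)
pose Y n w : R := if n is 0 then 0 else Num.sqrt n%:R * (btilde n w - beta n ord0 0) / nu n.
have YE n w : (0 < n)%N -> Y n w = Num.sqrt n%:R * (btilde n w - beta n ord0 0) / nu n.
  by case: n w.
have mY n : measurable_fun setT (Y n).
  case: n => [|n]; first exact: measurable_cst.
  rewrite /Y; apply: measurable_funM => //; apply: measurable_funM => //.
  apply: measurable_funB => //; have md := hmodel n.+1 isT.
  have hin i : (1 <= i <= n.+1)%N -> (1 <= i <= 2 * n.+1)%N.
    by move=> /andP[-> h]; rewrite (leq_trans h)// leq_pmull.
  apply: measurable_debiased.
  - move=> i hi; rewrite (_ : r n.+1 i = resid (P n.+1) n.+1 (x n.+1) i); last exact/funext.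
    exact: (measurable_lin md _ (hin _ hi)).
  - by move=> i k hi; have [+ _] := sim_x md (hin _ hi); exact.
  - move=> i hi; have h := obs_y md (I := [set i]) erefl.
    by apply: (obs_measurable_fun md _ h) => _ ->; exact: hin.
  - move=> k; apply: (obs_measurable_fun md _ (obs_pilot md (hpilot n.+1 isT) k)).
    by move=> i /andP[h1 h2]; rewrite /= h2 (leq_ltn_trans _ h1).
have mV n : measurable_fun setT (V n).
  by apply: measurable_funM => //; exact: (measurable_partial_sum (mX n)).
have cY t : (fun n => pr (P n) [set w | Y n w <= t]) @ \oo --> Phi t.
  apply: (slutsky_cdf mV mY cV) => eps eps01.
  pose B n : R := K * Num.sqrt ((s n)%:R * ln (p n)%:R / n%:R).
  pose pE n := pr (P n) [set w | norm2 (bhat n w - beta n) <= B n].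
  (* The bound of [row_expansion] with the pilot rate B n and L = nu0 * c. Its middle term vanishes
     because B n ^+ 2 is a multiple of s log p / n. *)
  exists (fun n => (1 - pE n) + 256 * C ^+ 2 * B n ^+ 2 / (nu0 * c * eps) ^+ 2 +
      (256 * C ^+ 2 / (c * eps) ^+ 2) / n%:R).
    have cB : (fun n => B n ^+ 2) @ \oo --> (0 : R).
      rewrite (_ : (fun n => _) = fun n => K ^+ 2 * ((s n)%:R * ln (p n)%:R / n%:R)).
        rewrite -[X in _ --> X](mulr0 (K ^+ 2)); apply: cvgM; first exact: cvg_cst.
        exact: cvg_sparsity.
      apply/funext => n; rewrite /B exprMn sqr_sqrtr//.
      by rewrite divr_ge0// mulr_ge0// ln_ge0// ler1n.
    rewrite -[X in _ --> X]addr0; apply: cvgD; last exact: cvg_inv_nat.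
    rewrite -[X in _ --> X]addr0; apply: cvgD.
      rewrite -[X in _ --> X](subrr 1); apply: cvgB; first exact: cvg_cst.
      exact: fine_cvg hrate.
    rewrite -[X in _ --> X](mul0r ((nu0 * c * eps) ^+ 2)^-1).
    apply: cvgM; last exact: cvg_cst.
    by rewrite -[X in _ --> X](mulr0 (256 * C ^+ 2)); apply: cvgM => //; exact: cvg_cst.
  move=> n n0.
  have B0 : 0 <= B n by rewrite mulr_ge0 ?sqrtr_ge0// ltW.
  have L0 : 0 < nu0 * c by exact: mulr_gt0.
  have [N [mN pN hN]] := row_expansion (hmodel n n0) n0 hc (Ac n n0) (hpilot n n0) B0 L0
    (score_sd_ge (hmodel n n0) n0 hc (Ac n n0) nu00 (nub n n0)) eps01.
  exists N; split => // w /hN[b [h [b1 h1 e1]]]; exists b, h; split => //.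
  rewrite YE//.
  have -> : btilde n w = debiased n ((resid (P n) n (x n))^~ w) ((x n)^~ w) ((y n)^~ w) (bhat n w).
    by congr (debiased n _ _ _ _); apply/funext => i; rewrite rE.
  by rewrite e1 -/(sd n) -/(s2 n) -nusd// mulrAC divff ?nun0// mul1r.
exists (fun n => mfun_Sub (mem_set (mY n))); split.
  by move=> n n0 w /=; rewrite YE// mulrCA divff ?mulr1// nun0.
move=> t _.
have mYt n : measurable [set w | Y n w <= t] by exact: measurable_le.
have -> : normal_prob 0 1 `]-oo, t]%classic = (Phi t)%:E.
  by rewrite /Phi -prE.
rewrite (_ : (fun n => _) = fun n => (pr (P n) [set w | Y n w <= t])%:E).
  exact/cvg_EFin/cY/nearW.
apply/funext => n; rewrite -prE//.
Qed.
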